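(* Let $\{X_u:u\in\Lambda^*\setminus\{\emptyset\}\}$ be i.i.d. copies of a nonnegative random variable $X$ with $\mathbb E(X)=1$, let $h_X=\mathbb E(X\log X)\in[0,\infty]$, and let $Q$ be the associated Mandelbrot multiplicative cascade. Let $\nu$ be a Borel probability measure on $\Sigma$. (a) If $\underline{\dim}_{\rm loc}(\nu,x)>h_X$ for $\nu$-almost every $x\in\Sigma$, then $\nu$ is $Q$-regular. This holds in particular if $\underline{\dim}_H(\nu)>h_X$. (b) If $\underline{\dim}_{\rm loc}(\nu,x)<h_X$ for $\nu$-almost every $x\in\Sigma$, then $\nu$ is $Q$-singular. This holds in particular if $\overline{\dim}_H(\nu)<h_X$. (c) Under the assumption of (a) (that is, $\underline{\dim}_{\rm loc}(\nu,x)>h_X$ for $\nu$-almost every $x$), with probability $1$, conditional on $Q\cdot\nu\neq0$, $$\underline{\dim}_H(\nu)-h_X\le\underline{\dim}_H(Q\cdot\nu)\le\overline{\dim}_P(Q\cdot\nu)\le\overline{\dim}_P(\nu)-h_X.$$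
   Context: Let $b\ge2$ be an integer, $\Lambda=\{0,\dots,b-1\}$, $\Lambda^*=\bigcup_{n\ge0}\Lambda^n$ the finite words, and $\Sigma=\Lambda^{\mathbb N}$ the space of sequences $x=x_1x_2\cdots$ with the metric $d(x,y)=e^{-\min\{n\ge1:x_n\ne y_n\}}$ and its Borel $\sigma$-field. Write $x|_n=x_1\cdots x_n$, and let $[u]$ be the cylinder of sequences with prefix $u$. Convention: $0\log0=0$. For $n\ge1$ put $Q_n(\omega,x)=\prod_{k=1}^nX_{x|_k}(\omega)$. For a finite Borel measure $\nu$ on $\Sigma$, the measures $Q_n(\omega,\cdot)\,\nu$ almost surely converge weakly to a random measure $Q\cdot\nu$. The measure $\nu$ is called $Q$-regular if $\mathbb E\|Q\cdot\nu\|=\|\nu\|$ (where $\|\cdot\|$ is total mass), and $Q$-singular if $Q\cdot\nu=0$ almost surely. For a finite nonzero Borel measure $\nu$ on $\Sigma$ and $x$ in its support, $$\underline{\dim}_{\rm loc}(\nu,x)=\liminf_{n\to\infty}\frac{-\log\nu([x|_n])}{n},\qquad\overline{\dim}_{\rm loc}(\nu,x)=\limsup_{n\to\infty}\frac{-\log\nu([x|_n])}{n}.$$ Moreover $\underline{\dim}_H(\nu)=\operatorname{ess\,inf}_\nu\underline{\dim}_{\rm loc}(\nu,\cdot)$, $\overline{\dim}_H(\nu)=\operatorname{ess\,sup}_\nu\underline{\dim}_{\rm loc}(\nu,\cdot)$ and $\overline{\dim}_P(\nu)=\operatorname{ess\,sup}_\nu\overline{\dim}_{\rm loc}(\nu,\cdot)$.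 *)

(* Defs.v *)
From HB Require Import structures.
From mathcomp Require Import all_boot all_order all_algebra.
From mathcomp Require Import all_classical all_reals all_analysis ess_sup_inf.

Set Implicit Arguments.
Unset Strict Implicit.
Unset Printing Implicit Defensive.

Import Order.TTheory GRing.Theory Num.Theory.
Import numFieldNormedType.Exports.

Local Open Scope classical_set_scope.
Local Open Scope ring_scope.

(* The parameter R is only there so that the distance can take its values in
   the real numbers of the ambient development; [hb] provides the point that
   measurable types are required to have. *)
Definition seqspace (R : realType) (b : nat) (hb : (1 < b)%N) : Type :=
  nat -> 'I_b.

Section sequence_space.
Context (R : realType) (b : nat) (hb : (1 < b)%N).
Local Notation S := (seqspace R hb).
Implicit Types (x y z : S) (u : seq 'I_b) (n : nat).

HB.instance Definition _ := gen_eqMixin S.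
HB.instance Definition _ := gen_choiceMixin S.
HB.instance Definition _ :=
  isPointed.Build S (fun=> Ordinal (ltnW hb) : 'I_b).

(* Positions start at 0: the letter written x_n in x = x_1 x_2 ... is
   [x n.-1], which explains the successor in the exponent. *)
Definition seqdist x y : R :=
  if pselect (exists n, x n != y n) is left xy then expR (- (ex_minn xy).+1%:R)
  else 0.

Lemma seqdist_leP x y n :
  (seqdist x y <= expR (- n.+1%:R)) <-> (forall k, (k < n)%N -> x k = y k).
Proof.
rewrite /seqdist; case: pselect => [xy|nxy]; last first.
  split=> [_ k _|_]; last exact: expR_ge0.
  by apply/eqP/negP => /negP kxy; apply: nxy; exists k.
rewrite ler_expR lerN2 ler_nat ltnS; case: ex_minnP => m mxy mmin; split.
  move=> nm k kn; apply/eqP/negP => /negP /mmin.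
  by rewrite leqNgt (leq_trans kn nm).
move=> xyn; rewrite leqNgt; apply/negP => /xyn e.
by rewrite e eqxx in mxy.
Qed.

Let seqdistxx x : seqdist x x = 0.
Proof.
rewrite /seqdist; case: pselect => // h; exfalso.
by case: h => n; rewrite eqxx.
Qed.

Let seqdist_positivity x y : seqdist x y = 0 -> x = y.
Proof.
rewrite /seqdist; case: pselect => [xy /eqP|nxy _].
  by rewrite gt_eqF ?expR_gt0.
by apply/funext => n; apply/eqP/negP => /negP ne; apply: nxy; exists n.
Qed.

Let seqdist_sym x y : seqdist x y = seqdist y x.
Proof.
suff H : forall x' y', seqdist x' y' <= seqdist y' x'.
  by apply/eqP; rewrite eq_le !H.
move=> {}x {}y; rewrite {2}/seqdist; case: pselect => [yx|nyx].
  case: ex_minnP => m _ mmin; apply/seqdist_leP => k km.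
  by apply/eqP/negP; rewrite eq_sym => /negP /mmin; rewrite leqNgt km.
suff -> : x = y by rewrite seqdistxx.
by apply/funext => n; apply/eqP/negP; rewrite eq_sym => /negP ne; apply: nyx; exists n.
Qed.

Let seqdist_ge0 x y : 0 <= seqdist x y.
Proof. by rewrite /seqdist; case: pselect => // xy; exact: expR_ge0. Qed.

Let seqdist_triangle y x z : seqdist x z <= seqdist x y + seqdist y z.
Proof.
have [->|nxz] := pselect (x = z); first by rewrite seqdistxx addr_ge0.
have nxz0 : exists n, x n != z n.
  apply: contra_notP nxz => nxz; apply/funext => n; apply/eqP/negP => /negP ne.
  by apply: nxz; exists n.
have [m] : exists2 m, seqdist x z = expR (- m.+1%:R) & x m != z m.
  rewrite /seqdist; case: pselect => // xz; case: ex_minnP => m mxz _.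
  by exists m.
move=> -> mxz.
have key x' y' : x' m != y' m -> expR (- m.+1%:R) <= seqdist x' y'.
  rewrite /seqdist => ne; case: pselect => [h|[]]; last by exists m.
  by rewrite ler_expR lerN2 ler_nat ltnS; case: ex_minnP => k _; apply.
have [xy|xy] := eqVneq (x m) (y m).
  by rewrite (le_trans (key y z _)) ?lerDr// -xy.
by rewrite (le_trans (key x y xy)) ?lerDl.
Qed.

HB.instance Definition _ := @isMetric.Build R S
  seqdist seqdistxx seqdist_positivity seqdist_sym seqdist_triangle.

(* The Borel sigma-field of the metric space. *)
HB.instance Definition _ :=
  Measurable.copy S (g_sigma_algebraType (@open S)).

Definition restr x n : seq 'I_b := mkseq x n.

Definition cylinder u : set S := [set x | restr x (size u) = u].

End sequence_space.

Local Open Scope ereal_scope.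

Section local_dimension.
Context (R : realType) (b : nat) (hb : (1 < b)%N).
Local Notation S := (seqspace R hb).
Implicit Types (mu : {measure set S -> \bar R}) (x : S).

(* Outside the support of mu both values are +oo, as [lne 0 = -oo]; this null
   set is irrelevant below. *)
Definition lower_dim_loc mu x : \bar R :=
  limn_einf (fun n => (n%:R^-1)%:E * - lne (mu (cylinder (restr x n)))).

Definition upper_dim_loc mu x : \bar R :=
  limn_esup (fun n => (n%:R^-1)%:E * - lne (mu (cylinder (restr x n)))).

Definition lower_dimH mu : \bar R := ess_inf mu (lower_dim_loc mu).
Definition upper_dimH mu : \bar R := ess_sup mu (lower_dim_loc mu).
Definition upper_dimP mu : \bar R := ess_sup mu (upper_dim_loc mu).

Definition zero_measure mu := forall A, measurable A -> mu A = 0.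

End local_dimension.

Section cascade.
Context (R : realType) (b : nat) (hb : (1 < b)%N).
Local Notation S := (seqspace R hb).
Context (d : measure_display) (Omega : measurableType d).
Context (P : probability Omega R).

(* Weights are indexed by all words, but the weight of the empty word is never
   used nor constrained. *)
Implicit Types (X : seq 'I_b -> {RV P >-> R}).

Definition mutually_independent X :=
  forall (s : seq (seq 'I_b)) (B : seq 'I_b -> set R),
    uniq s -> [::] \notin s -> (forall u, measurable (B u)) ->
    P (\bigcap_(u in [set` s]) (X u @^-1` B u)) =
    \prod_(u <- s) P (X u @^-1` B u).

Definition iid_copies X (d0 : measure_display) (T0 : measurableType d0)
    (P0 : probability T0 R) (X0 : {RV P0 >-> R}) :=
  mutually_independent X /\
  (forall u, u != [::] -> forall A, measurable A ->
    distribution P (X u) A = distribution P0 X0 A).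

Definition cascade_density X n (w : Omega) (x : S) : R :=
  (\prod_(1 <= k < n.+1) X (restr x k) w)%R.

(* [Qnu] is (a version of) the random measure Q.nu: a random finite measure
   that is almost surely the weak limit of the measures with density
   [cascade_density X n w] with respect to nu. *)
Definition is_cascade_measure X (nu : {measure set S -> \bar R})
    (Qnu : R.-ftker Omega ~> S) :=
  {ae P, forall w, forall f : S -> R, continuous f -> bounded_fun f ->
    (\int[nu]_x (f x * cascade_density X n w x)%:E) @[n --> \oo] -->
    \int[Qnu w]_x (f x)%:E}.

Definition Q_regular (nu : {measure set S -> \bar R})
    (Qnu : R.-ftker Omega ~> S) :=
  \int[P]_w Qnu w [set: S] = nu [set: S].

Definition Q_singular (Qnu : R.-ftker Omega ~> S) :=
  {ae P, forall w, zero_measure (Qnu w)}.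

End cascade.

Definition entropy (R : realType) (d0 : measure_display)
    (T0 : measurableType d0) (P0 : probability T0 R) (X0 : {RV P0 >-> R})
    : \bar R :=
  \int[P0]_t (X0 t * ln (X0 t))%:E.

(* Main.v *)
(* Under the measure Q_n(w,x) P(dw) nu(dx) the point x is the spine: it still has
   law nu, the weights along it become independent with the law of X tilted by X,
   so that ln X has mean h = h_X along the spine, while the weights off the spine
   keep their law and have mean 1.

   If H < h, Chernoff's bound shows that Q_n >= exp (H n) on the spine up to an
   exponentially small probability. If h < c, the barrier Q_n <= exp (c n + L)
   holds for all n with probability close to 1 when L is large; as the tilted
   ln X may have no exponential moments, this combines Chernoff's bound for a
   truncation with Garsia's maximal inequality for the rest.

   Given the spine, the Q_m-mass of [x|n] has mean at most the sum over k >= n of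
   Q_k(x) nu[x|k]. Hence, if nu[x|k] <= C exp (- al k) with c < al, the masses
   below the barrier are bounded in mean, which gives the uniform integrability
   behind (a), and decay like exp (- (al - c) n), which gives the lower bound in
   (c). For (b), nu[x|n] >= exp (- H' n) with H' < H < h would force the total
   mass of Q_n nu, of mean 1, to exceed exp (n (H - H')). The upper bound in (c)
   holds because the cylinders on which Q.nu is less than exp (- de n) times
   Q_n nu carry a Q.nu-mass of mean at most exp (- de n).

   Statements about nu-almost all x are transferred to Q.nu-almost all x using
   that E Q.nu(A) <= nu(A), and spine estimates to Q.nu by Fatou's lemma and the
   Borel-Cantelli lemma. *)

From HB Require Import structures.
Require Import Defs.
From mathcomp Require Import all_boot all_order all_algebra.
From mathcomp Require Import all_classical all_reals all_analysis ess_sup_inf.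
From mathcomp Require Import measurable_realfun ring lra.

Set Implicit Arguments.
Unset Strict Implicit.
Unset Printing Implicit Defensive.

Import Order.TTheory GRing.Theory Num.Theory.
Import numFieldNormedType.Exports.

Local Open Scope classical_set_scope.
Local Open Scope ring_scope.
Local Open Scope ereal_scope.

(** * Integrating out one weight *)

(** The obstacle behind the barrier is that no moment of X beyond h_X is assumed: Q_k on the spine
    has mean (E X^2)^k, possibly infinite, so the conditional mean of the masses cannot be averaged
    over the spine before Q_k is capped by exp (c k + L).

    The spine measure is never built. It appears as integrals over [P] of [weight u] times an
    indicator, summed over the words [u] of one length with their masses under nu. Conditional
    expectations are avoided too: [freezing] integrates out one weight against anything determined
    by the others, and weights are removed one at a time.

    Events at stage m involve only finitely many weights, whereas [Qnu] is known through its values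
    on cylinders as a limit in m. This is why lower limits of events in m, with Fatou's lemma for
    sets, stand between the spine estimates and Borel-Cantelli. *)

Section freezing.
Context (R : realType) (b : nat) (d : measure_display) (Omega : measurableType d)
  (P : probability Omega R) (Xs : seq 'I_b -> {RV P >-> R})
  (d0 : measure_display) (T0 : measurableType d0) (P0 : probability T0 R)
  (X : {RV P0 >-> R}).
Hypothesis Xs_iid : iid_copies Xs X.

(* Every event determined by the weights other than those of [v] and of the
   empty word, the latter being unconstrained by [iid_copies]. *)
Definition away_gen (v : seq 'I_b) : set (set Omega) :=
  [set A | exists s (B : seq 'I_b -> set R),
    [/\ uniq s, [::] \notin s, v \notin s, forall u, measurable (B u) &
        A = \bigcap_(u in [set` s]) (Xs u @^-1` B u)]].

Definition away (v : seq 'I_b) := g_sigma_algebraType (away_gen v).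

HB.instance Definition _ v :=
  Measurable.copy (away v) (g_sigma_algebraType (away_gen v)).

Lemma away_gen_setI v : setI_closed (away_gen v).
Proof.
move=> _ _ [s [B [us s0 sv mB ->]]] [t [C [ut t0 tv mC ->]]].
exists (undup (s ++ t)), (fun u => (if u \in s then B u else setT) `&`
  (if u \in t then C u else setT)); split.
- exact: undup_uniq.
- by rewrite mem_undup mem_cat negb_or s0.
- by rewrite mem_undup mem_cat negb_or sv.
- by move=> u; apply: measurableI; case: ifP.
apply/seteqP; split => [w [sw tw] u|w stw].
  rewrite /= mem_undup mem_cat => ust; split; case: ifPn => //.
    exact: sw.
  exact: tw.
split=> u /= ut'; have := stw u; rewrite /= mem_undup mem_cat ut' ?orbT => /(_ isT) [].
  by [].
by [].
Qed.

Lemma away_genT v : away_gen v setT.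
Proof.
exists [::], (fun=> setT); split => //; rewrite (_ : [set` [::]] = set0) ?bigcap_set0//.
by apply/seteqP; split.
Qed.

Lemma away_gen_measurable v : away_gen v `<=` measurable.
Proof.
move=> _ [s [B [us s0 sv mB ->]]].
rewrite bigcap_seq; apply: bigsetI_measurable => u _.
exact: measurable_funPTI.
Qed.

Lemma measurable_away v (A : set Omega) :
  measurable (A : set (away v)) -> measurable A.
Proof.
apply: smallest_sub; first exact: sigma_algebra_measurable.
exact: away_gen_measurable.
Qed.

(** As functions of [A], both sides are finite measures, a restriction of [P] and a multiple of [P].
    Independence of finite families makes them agree on [away_gen v], which is closed under
    intersection, hence on all of [away v]. *)
Lemma away_indep v (B : set R) (A : set Omega) : v != [::] -> measurable B ->
  measurable (A : set (away v)) ->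
  P (Xs v @^-1` B `&` A) = P (Xs v @^-1` B) * P A.
Proof.
move=> v0 mB; have mXB : measurable (Xs v @^-1` B) by exact: measurable_funPTI.
pose c : {nonneg R} := NngNum (fine_ge0 (measure_ge0 P (Xs v @^-1` B))).
have cE : c%:num%:E = P (Xs v @^-1` B) by rewrite /= fineK// fin_num_measure.
have H := @g_sigma_algebra_measure_unique _ _ _ (away_gen v)
  (@away_gen_measurable v) (fun=> setT) (fun=> away_genT v) _
  (mrestr P mXB) (mscale c P) (@away_gen_setI v).
rewrite -cE => mA; rewrite setIC.
apply: H => //.
- by rewrite bigcup_const.
- move=> _ [s [C [us s0 sv mC ->]]].
  rewrite /= /mrestr /mscale /= fineK ?fin_num_measure//.
  have [indep _] := Xs_iid.
  pose D u := if u == v then B else C u.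
  have DE u : u \in s -> D u = C u.
    by rewrite /D; case: eqP => // ->; rewrite (negbTE sv).
  have E1 : \bigcap_(u in [set` s]) (Xs u @^-1` C u) `&` Xs v @^-1` B =
     \bigcap_(u in [set` v :: s]) (Xs u @^-1` D u).
    apply/seteqP; split=> [w [sw vw] u /=|w sw].
      by rewrite inE /D; case: eqP => [->//|_ /= us']; exact: sw.
    split=> [u /= us'|].
      by have /= := sw u; rewrite inE us' orbT => /(_ isT); rewrite DE.
    by have /= := sw v; rewrite inE eqxx => /(_ isT); rewrite /D eqxx.
  rewrite E1 indep/=; last 3 first.
  - by rewrite sv.
  - by rewrite inE negb_or eq_sym v0.
  - by move=> u; rewrite /D; case: eqP.
  rewrite big_cons {1}/D eqxx; congr (_ * _).
  by rewrite (indep s C)//; apply: eq_big_seq => u us'; rewrite DE.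
- by move=> _; rewrite /= /mrestr (le_lt_trans (probability_le1 _ _)) ?ltry//; exact: measurableI.
Qed.

Lemma measurable_Xs_away u v : u != [::] -> u != v ->
  measurable_fun [set: away v] (Xs u : away v -> R).
Proof.
move=> u0 uv _ B mB; rewrite setTI; apply: sub_sigma_algebra.
exists [:: u], (fun=> B); split => //.
- by rewrite inE eq_sym.
- by rewrite inE eq_sym.
- by rewrite bigcap_seq big_seq1.
Qed.

Lemma measurable_id_away v : measurable_fun [set: Omega] (id : Omega -> away v).
Proof. by move=> _ A mA; rewrite setTI; exact: (@measurable_away v). Qed.

Lemma measurable_fun_away d' (T' : measurableType d') v (f : Omega -> T') :
  measurable_fun [set: away v] (f : away v -> T') -> measurable_fun setT f.
Proof.
move=> mf _ B mB; rewrite setTI; apply: (@measurable_away v).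
by rewrite -[X in measurable X]setTI; exact: mf.
Qed.

(** By [away_indep] the pair formed by the weight of [v] and the identity, read as a map into the
    coarser space [away v], has a product law; Tonelli's theorem applies. *)
Lemma freezing v (phi : R * away v -> \bar R) : v != [::] ->
  measurable_fun [set: (R * away v)%type] phi -> (forall z, 0 <= phi z) ->
  \int[P]_w phi (Xs v w, w) = \int[P]_w \int[P0]_t phi (X t, w).
Proof.
move=> v0 mphi phi0.
have mid := @measurable_id_away v.
pose id' := [the {mfun Omega >-> away v} of mfun_Sub (mem_set mid)].
pose j (w : Omega) : R * away v := (Xs v w, id' w).
have mj : measurable_fun setT j by exact/measurable_fun_pair.
transitivity (\int[pushforward P j]_z phi z).
  by rewrite ge0_integral_pushforward.
rewrite (eq_measure_integral (distribution P0 X \x distribution P id')); last first.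
  move=> A mA _; symmetry; apply: product_measure_unique => // A1 A2 mA1 mA2.
  rewrite /distribution /= /pushforward /=.
  rewrite (_ : j @^-1` (A1 `*` A2) = Xs v @^-1` A1 `&` A2); last by apply/seteqP; split.
  rewrite away_indep//.
  have [_ law] := Xs_iid.
  by have := law v v0 A1 mA1; rewrite /distribution /pushforward /= => ->.
rewrite fubini_tonelli2//.
rewrite ge0_integral_distribution.
- apply: eq_integral => w _ /=.
  rewrite /fubini_G ge0_integral_distribution//.
  exact: measurableT_comp mphi _.
- exact: measurable_fun_fubini_tonelli_G.
- by move=> w; exact: integral_ge0.
Qed.
End freezing.

(** * Products of weights under the tilted measure *)

Section exp_small.
Context (R : realType) d (T : measurableType d) (mu : probability T R).
Context (W Y : T -> R).
Hypotheses (mW : measurable_fun setT W) (mY : measurable_fun setT Y).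
Hypothesis W0 : forall t, (0 <= W t)%R.
Hypothesis W1 : \int[mu]_t (W t)%:E = 1.
Hypothesis WY : \int[mu]_t (W t * expR (Y t))%:E < +oo.

(** Used with a = exp (Y / (n + 1)), to make [f n] below nonnegative. *)
Lemma bernoulli_ineq (a : R) n : (0 <= a)%R -> (n%:R * (a - 1) <= a ^+ n - 1)%R.
Proof.
move=> a0; elim: n => [|n IH]; first by rewrite expr0 subrr mul0r.
rewrite exprS -natr1 mulrDl mul1r.
have h : (0 <= (a - 1) * (a ^+ n - 1))%R.
  have [a1|a1] := leP 1%R a.
    by rewrite mulr_ge0 ?subr_ge0// exprn_ege1.
  by rewrite mulr_le0 ?subr_le0 ?(ltW a1)// exprn_ile1// ltW.
nra.
Qed.

Lemma exp_le_mulexp (x : R) : (expR x - 1 <= x * expR x)%R.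
Proof.
have := expR_ge1Dx (- x); rewrite expRN => h.
have e0 := expR_gt0 x.
have : ((1 - x) * expR x <= 1)%R by rewrite -ler_pdivlMr// div1r.
lra.
Qed.

Let f n t := (W t * (expR (Y t) - 1 - n.+1%:R * (expR (Y t / n.+1%:R) - 1)))%R.

Let f_ge0 n t : (0 <= f n t)%R.
Proof.
rewrite /f mulr_ge0// subr_ge0.
have := @bernoulli_ineq (expR (Y t / n.+1%:R)) n.+1 (expR_ge0 _).
by rewrite -expRM_natl mulrCA divff ?mulr1.
Qed.

Let cvgf t : (f n t)%:E @[n --> \oo] --> (W t * (expR (Y t) - 1 - Y t))%:E.
Proof.
apply: cvg_EFin; first exact: nearW.
rewrite /f; apply: cvgM; first exact: cvg_cst.
apply: cvgB; first exact: cvg_cst.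
(* With N = n + 1, the bounds are Y <= N (exp (Y / N) - 1) <= Y exp (Y / N). *)
apply: (@squeeze_cvgr _ _ _ _ (fun=> Y t) (fun n => Y t * expR (Y t / n.+1%:R))%R).
- apply: nearW => n; apply/andP; split.
    have := expR_ge1Dx (Y t / n.+1%:R).
    rewrite -lerBrDl ler_pdivrMr// => h; first by rewrite mulrC.
  have := exp_le_mulexp (Y t / n.+1%:R).
  rewrite mulrAC ler_pdivlMr// => h; first by rewrite mulrC.
- exact: cvg_cst.
- rewrite -[X in _ --> X]mulr1; apply: cvgM; first exact: cvg_cst.
  rewrite -[X in _ --> X](@expR0 R); apply: continuous_cvg; first exact: continuous_expR.
  rewrite -(mulr0 (Y t)); apply: cvgM; first exact: cvg_cst.
  exact: cvg_harmonic.
Qed.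

(* n (exp (Y / n) - 1) decreases to Y, so if no small multiple of Y had a tilted
   exponential moment below 1, Fatou's lemma applied to
   W (exp Y - 1 - n (exp (Y / n) - 1)) >= 0 would give E (W Y) >= 0. *)
Lemma exp_small :
  ~ (mu.-integrable setT (fun t => (W t * Y t)%:E) /\
     0 <= \int[mu]_t (W t * Y t)%:E) ->
  exists n, \int[mu]_t (W t * expR (Y t / n.+1%:R))%:E < 1.
Proof.
move=> H; apply: contrapT => /forallNP K; apply: H.
have mWE : measurable_fun setT (fun t => (W t * expR (Y t))%:E).
  apply/measurable_EFinP/measurable_funM => //; exact: measurableT_comp.
have iWE : mu.-integrable setT (fun t => (W t * expR (Y t))%:E).
  apply/integrableP; split => //; under eq_integral.
    by move=> t _; rewrite gee0_abs ?lee_fin ?mulr_ge0 ?expR_ge0//; over.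
  by [].
have iW : mu.-integrable setT (fun t => (W t)%:E).
  apply/integrableP; split; first exact/measurable_EFinP.
  under eq_integral.
    by move=> t _; rewrite gee0_abs ?lee_fin//; over.
  by rewrite W1 ltry.
have mWn n : measurable_fun setT (fun t => (W t * expR (Y t / n.+1%:R))%:E).
  apply/measurable_EFinP/measurable_funM => //; apply: measurableT_comp => //.
  exact: measurable_funM.
have iWn n : mu.-integrable setT (fun t => (W t * expR (Y t / n.+1%:R))%:E).
  apply: (@le_integrable _ _ _ mu setT measurableT _
    ((fun t => (W t)%:E) \+ (fun t => (W t * expR (Y t))%:E)) (mWn n)).
    move=> t _ /=; rewrite lee_fin !ger0_norm ?addr_ge0 ?mulr_ge0 ?expR_ge0//.
    rewrite -{2}(mulr1 (W t)) -mulrDr ler_wpM2l//.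
    have [Yt|Yt] := leP 0%R (Y t).
      rewrite ler_wpDl// ler_expR ler_pdivrMr// ler_peMr//.
      by rewrite ler1n.
    rewrite ler_wpDr ?expR_ge0// -(@expR0 R) ler_expR.
    by rewrite mulr_le0_ge0// ltW.
  exact: integrableD.
(* Expanding [f n] leaves a subtracted N (E (W exp (Y / N)) - 1), with N = n + 1, which is
   nonnegative by [K]. *)
have intf n : \int[mu]_t (f n t)%:E <= \int[mu]_t (W t * expR (Y t))%:E - 1.
  have -> : \int[mu]_t (f n t)%:E = \int[mu]_t ((W t * expR (Y t))%:E
     - ((W t)%:E + (n.+1%:R)%:E * ((W t * expR (Y t / n.+1%:R))%:E - (W t)%:E))).
    apply: eq_integral => t _; rewrite /f.
    transitivity (W t * expR (Y t) -
      (W t + n.+1%:R * (W t * expR (Y t / n.+1%:R) - W t)))%R%:E => //.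
    by congr EFin; ring.
  rewrite integralB//; last first.
    by apply: integrableD => //; apply: integrableZl => //; exact: integrableB.
  apply: leeB => //.
  rewrite integralD//; last by apply: integrableZl => //; exact: integrableB.
  rewrite W1 leeDl// integralZl//; last exact: integrableB.
  rewrite mule_ge0// ?lee_fin// integralB// W1 sube_ge0//.
  by rewrite leNgt; apply/negP; exact: K.
have mf n : measurable_fun setT (fun t => (f n t)%:E).
  apply/measurable_EFinP; rewrite /f; apply: measurable_funM => //.
  apply: measurable_funB; first by apply: measurable_funB => //; exact: measurableT_comp.
  apply: measurable_funM => //; apply: measurable_funB => //.
  by apply: measurableT_comp => //; exact: measurable_funM.
have F := @fatou _ _ _ mu setT measurableT (fun n t => (f n t)%:E) (fun n => mf n)
  (fun n t _ => f_ge0 n t).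
set g := fun t => (W t * (expR (Y t) - 1 - Y t))%:E.
have gE : (fun t => limn_einf (fun n => (f n t)%:E)) = g.
  by apply/funext => t; rewrite is_cvg_limn_einfE; [exact: cvg_lim|apply: cvgP; exact: cvgf].
rewrite gE in F.
have Fg : \int[mu]_t g t <= \int[mu]_t (W t * expR (Y t))%:E - 1.
  apply: (le_trans F); rewrite limn_einf_lim.
  apply: lime_le; first exact: is_cvg_einfs.
  apply: nearW => n; apply: ge_ereal_inf; exists (\int[mu]_t (f n t)%:E) => //.
  by exists n => /=.
have g0 t : 0 <= g t.
  rewrite lee_fin mulr_ge0// subr_ge0.
  by have := expR_ge1Dx (Y t); lra.
have mg : measurable_fun setT g.
  apply/measurable_EFinP/measurable_funM => //; apply: measurable_funB => //.
  by apply: measurable_funB => //; exact: measurableT_comp.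
have ig : mu.-integrable setT g.
  apply/integrableP; split => //; under eq_integral do rewrite gee0_abs//.
  apply: (le_lt_trans Fg); by rewrite lteBlDr.
(* This recovers W Y from integrable functions: Fatou's lemma bounded the mean of [g] by E (W exp Y)
   - 1, so that of W Y is nonnegative. *)
have E : (fun t => (W t * Y t)%:E) = ((fun t => (W t * expR (Y t))%:E) \- (fun t => (W t)%:E)) \- g.
  apply/funext => t /=.
  transitivity (W t * expR (Y t) - W t - W t * (expR (Y t) - 1 - Y t))%R%:E => //.
  by congr EFin; ring.
have iWY : mu.-integrable setT (fun t => (W t * Y t)%:E).
  rewrite E; apply: integrableB => //; exact: integrableB.
split => //.
rewrite E integralB//; last exact: integrableB.
rewrite integralB// W1 sube_ge0//.
by rewrite integrable_fin_num.
Qed.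

End exp_small.

Section excess.
Context (R : realType).
Implicit Types (psi : R -> R) (l : seq R).

(* The maximum of 0 and of the sums of [psi] over the nonempty prefixes of [l]. *)
Fixpoint excess psi l : R :=
  if l is a :: l' then Num.max 0%R (psi a + excess psi l')%R else 0%R.

Lemma excess_ge0 psi l : (0 <= excess psi l)%R.
Proof. by case: l => //= a l; rewrite le_max lexx. Qed.

Lemma sum_le_excess psi l k :
  (\sum_(a <- take k l) psi a <= excess psi l)%R.
Proof.
elim: l k => [|a l IH] [|k] /=; rewrite ?big_nil ?le_max ?lexx//.
by rewrite big_cons lerD2l IH orbT.
Qed.

End excess.

Section walk.
Context (R : realType) (b : nat) (d : measure_display) (Omega : measurableType d)
  (P : probability Omega R) (Xs : seq 'I_b -> {RV P >-> R})
  (d0 : measure_display) (T0 : measurableType d0) (P0 : probability T0 R)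
  (X : {RV P0 >-> R}).
Hypothesis Xs_iid : iid_copies Xs X.
Hypothesis X_ge0 : forall t, (0 <= X t)%R.
Hypothesis Xs_ge0 : forall u w, (0 <= Xs u w)%R.
Hypothesis X_mean : \int[P0]_t (X t)%:E = 1.
Implicit Types (vs : seq (seq 'I_b)) (psi : R -> R).

Definition wprod vs (w : Omega) : R := (\prod_(v <- vs) Xs v w)%R.
Definition wvals vs (w : Omega) : seq R := [seq Xs v w | v <- vs].

Lemma wprod_ge0 vs w : (0 <= wprod vs w)%R.
Proof. by apply: prodr_ge0 => v _; exact: Xs_ge0. Qed.

Section meas.
Context d' (T' : measurableType d') (j : T' -> Omega).

Lemma measurable_wprod_gen vs :
  (forall v, v \in vs -> measurable_fun setT (fun t => Xs v (j t))) ->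
  measurable_fun setT (fun t => wprod vs (j t)).
Proof.
by move=> h; apply: measurable_prod => v; exact: h.
Qed.

Lemma measurable_excess_gen psi vs : measurable_fun setT psi ->
  (forall v, v \in vs -> measurable_fun setT (fun t => Xs v (j t))) ->
  measurable_fun setT (fun t => excess psi (wvals vs (j t))).
Proof.
move=> mpsi; elim: vs => [|v vs IH] h; first exact: measurable_cst.
apply: measurable_maxr; first exact: measurable_cst.
apply: measurable_funD; last by apply: IH => u us; apply: h; rewrite inE us orbT.
by apply: measurableT_comp => //; apply: h; rewrite mem_head.
Qed.

End meas.

Lemma measurable_wprod vs : measurable_fun setT (wprod vs).
Proof. exact: (@measurable_wprod_gen _ _ id). Qed.

Lemma measurable_excess psi vs : measurable_fun setT psi ->
  measurable_fun setT (fun w => excess psi (wvals vs w)).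
Proof. by move=> mpsi; exact: (@measurable_excess_gen _ _ id). Qed.

Lemma measurable_Xs_in v vs u : v \notin vs -> [::] \notin vs -> u \in vs ->
  measurable_fun [set: away Xs v] (Xs u : away Xs v -> R).
Proof.
move=> vvs v0 uvs; apply: measurable_Xs_away.
  by apply: contraNneq v0 => <-.
by apply: contraNneq vvs => <-.
Qed.

Lemma measurable_wprod_away v vs : v \notin vs -> [::] \notin vs ->
  measurable_fun [set: away Xs v] (wprod vs : away Xs v -> R).
Proof.
move=> h1 h2; apply: (@measurable_wprod_gen _ (away Xs v) id) => u.
exact: measurable_Xs_in.
Qed.

Lemma measurable_excess_away psi v vs : measurable_fun setT psi ->
  v \notin vs -> [::] \notin vs ->
  measurable_fun [set: away Xs v] (fun w : away Xs v => excess psi (wvals vs w)).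
Proof.
move=> mpsi h1 h2; apply: (@measurable_excess_gen _ (away Xs v) id) => // u.
exact: measurable_Xs_in.
Qed.

Lemma freezing_prod (g : R -> R) v (Z : Omega -> R) : v != [::] ->
  measurable_fun setT g -> (forall x, 0 <= g x)%R ->
  measurable_fun [set: away Xs v] (Z : away Xs v -> R) ->
  (forall w, 0 <= Z w)%R ->
  \int[P]_w (g (Xs v w) * Z w)%:E =
  \int[P0]_t (g (X t))%:E * \int[P]_w (Z w)%:E.
Proof.
move=> v0 mg g0 mZ Z0.
pose phi (z : R * away Xs v) : \bar R := (g z.1 * Z z.2)%:E.
have mphi : measurable_fun [set: (R * away Xs v)%type] phi.
  apply/measurable_EFinP/measurable_funM.
    exact: measurableT_comp.
  exact: (measurableT_comp mZ).
rewrite (freezing Xs_iid v0 mphi); last by move=> z; rewrite lee_fin mulr_ge0.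
rewrite /phi /=.
under eq_integral => w _.
  under eq_integral do rewrite mulrC EFinM.
  rewrite ge0_integralZl//; [|by apply/measurable_EFinP; exact: measurableT_comp
    |by move=> *; rewrite lee_fin|by rewrite lee_fin].
  over.
rewrite /= ge0_integralZr//.
- by rewrite muleC.
- apply/measurable_EFinP; exact: (measurable_fun_away mZ).
- by move=> *; rewrite lee_fin.
- by apply: integral_ge0 => *; rewrite lee_fin.
Qed.

Lemma freezing_mean v (Z : Omega -> R) : v != [::] ->
  measurable_fun [set: away Xs v] (Z : away Xs v -> R) ->
  (forall w, 0 <= Z w)%R ->
  \int[P]_w (Xs v w * Z w)%:E = \int[P]_w (Z w)%:E.
Proof.
move=> v0 mZ Z0.
(* [freezing_prod] wants a function nonnegative on the whole real line; on the weights the absolute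
   value changes nothing. The same device recurs below. *)
transitivity (\int[P]_w (`|Xs v w| * Z w)%:E).
  by apply: eq_integral => w _; rewrite ger0_norm.
rewrite (@freezing_prod Num.norm)//.
rewrite (_ : \int[P0]_t _ = 1) ?mul1e// -X_mean.
by apply: eq_integral => t _; rewrite ger0_norm.
Qed.

(* The transition operator of the excess of a random word under the measure
   tilted by the product of its weights, as letters are added in front. *)
Definition step psi (f : R -> \bar R) (m : R) : \bar R :=
  \int[P0]_t ((X t)%:E * f (Num.max 0%R (psi (X t) + m)%R)).

Lemma step_ge0 psi f : (forall x, 0 <= f x) -> forall m, 0 <= step psi f m.
Proof. by move=> f0 m; apply: integral_ge0 => t _; rewrite mule_ge0 ?lee_fin. Qed.

Lemma measurable_step psi f : measurable_fun setT psi ->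
  measurable_fun setT f -> (forall x, 0 <= f x) ->
  measurable_fun setT (step psi f).
Proof.
move=> mpsi mf f0.
apply: (@measurable_fun_fubini_tonelli_G _ _ T0 _ _ P0
  (fun z => (X z.1)%:E * f (Num.max 0%R (psi (X z.1) + z.2)%R))).
  apply: emeasurable_funM.
    by apply/measurable_EFinP; exact: measurableT_comp.
  apply: measurableT_comp => //; apply: measurable_maxr => //.
  apply: measurable_funD => //; apply: measurableT_comp => //.
  exact: measurableT_comp.
by move=> z; rewrite mule_ge0 ?lee_fin.
Qed.

(** Freezing the first weight turns [f] into [step psi f] evaluated at the excess of the tail, so
    the induction must run over all [f]. *)
Lemma excess_law psi vs f : measurable_fun setT psi ->
  measurable_fun setT f -> (forall x, 0 <= f x) ->
  uniq vs -> [::] \notin vs ->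
  \int[P]_w ((wprod vs w)%:E * f (excess psi (wvals vs w))) =
  iter (size vs) (step psi) f 0%R.
Proof.
move=> mpsi; elim: vs f => [|v vs IH] f mf f0 /=.
  move=> _ _; under eq_integral do rewrite /wprod big_nil mul1e.
  by rewrite integral_cst//= probability_setT mule1.
move=> /andP[vvs uvs]; rewrite inE negb_or eq_sym => /andP[v0 vs0].
rewrite -iterS iterSr -IH//; last 2 first.
- exact: measurable_step.
- exact: step_ge0.
pose phi (z : R * away Xs v) : \bar R :=
  (`|z.1| * wprod vs z.2)%:E * f (Num.max 0%R (psi z.1 + excess psi (wvals vs z.2)))%R.
have mphi : measurable_fun [set: (R * away Xs v)%type] phi.
  apply: emeasurable_funM.
    apply/measurable_EFinP/measurable_funM; first exact: measurableT_comp.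
    exact: (measurableT_comp (measurable_wprod_away vvs vs0)).
  apply: measurableT_comp => //; apply: measurable_maxr => //.
  apply: measurable_funD; first exact: measurableT_comp.
  exact: (measurableT_comp (measurable_excess_away mpsi vvs vs0)).
transitivity (\int[P]_w phi (Xs v w, w)).
  by apply: eq_integral => w _; rewrite /phi /= ger0_norm// /wprod big_cons.
rewrite (freezing Xs_iid v0 mphi); last first.
  by move=> z; rewrite mule_ge0// lee_fin mulr_ge0// wprod_ge0.
apply: eq_integral => w _; rewrite /phi /step /=.
under eq_integral do rewrite ger0_norm// mulrC EFinM -muleA.
rewrite ge0_integralZl//; last 2 first.
- by move=> t _; rewrite mule_ge0 ?lee_fin.
- by rewrite lee_fin wprod_ge0.
apply: emeasurable_funM; first exact/measurable_EFinP.
apply: measurableT_comp => //; apply: measurable_maxr => //.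
apply: measurable_funD => //; exact: measurableT_comp.
Qed.

Lemma wprod_mean vs (g : R -> R) : measurable_fun setT g -> (forall x, 0 <= g x)%R ->
  uniq vs -> [::] \notin vs ->
  \int[P]_w (\prod_(v <- vs) g (Xs v w))%:E =
  (\int[P0]_t (g (X t))%:E) ^+ size vs.
Proof.
move=> mg g0; elim: vs => [|v vs IH].
  move=> _ _; under eq_integral do rewrite big_nil.
  by rewrite integral_cst//= probability_setT mule1.
move=> /andP[vvs uvs]; rewrite inE negb_or eq_sym => /andP[v0 vs0].
rewrite [size _]/= expeS -IH// -(@freezing_prod g v (fun w => \prod_(u <- vs) g (Xs u w))%R)//.
- by apply: eq_integral => w _; rewrite big_cons.
- apply: measurable_prod => u us.
  apply: measurableT_comp => //; exact: (measurable_Xs_in vvs vs0 us).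
- by move=> w; apply: prodr_ge0.
Qed.

Lemma wprod1 vs : uniq vs -> [::] \notin vs -> \int[P]_w (wprod vs w)%:E = 1.
Proof.
elim: vs => [|v vs IH] /=.
  move=> _ _; under eq_integral do rewrite /wprod big_nil.
  by rewrite integral_cst//= probability_setT mule1.
move=> /andP[vvs uvs]; rewrite inE negb_or eq_sym => /andP[v0 vs0].
rewrite -(IH uvs vs0) -(@freezing_mean v (wprod vs))//.
- by apply: eq_integral => w _; rewrite /wprod big_cons.
- exact: (measurable_wprod_away vvs vs0).
- exact: wprod_ge0.
Qed.

End walk.

Section tilted_walk.
Context (R : realType) (b : nat) (d : measure_display) (Omega : measurableType d)
  (P : probability Omega R) (Xs : seq 'I_b -> {RV P >-> R})
  (d0 : measure_display) (T0 : measurableType d0) (P0 : probability T0 R)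
  (X : {RV P0 >-> R}).
Hypothesis Xs_iid : iid_copies Xs X.
Hypothesis X_ge0 : forall t, (0 <= X t)%R.
Hypothesis Xs_ge0 : forall u w, (0 <= Xs u w)%R.
Hypothesis X_mean : \int[P0]_t (X t)%:E = 1.
Implicit Types (vs : seq (seq 'I_b)) (psi : R -> R).

Let wprod0 vs w : (0 <= wprod Xs vs w)%R := wprod_ge0 Xs_ge0 vs w.
Let mwprod vs : measurable_fun setT (wprod Xs vs) := @measurable_wprod _ _ _ _ _ Xs vs.

Let wp1 vs : uniq vs -> [::] \notin vs -> \int[P]_w (wprod Xs vs w)%:E = 1.
Proof. exact: (wprod1 Xs_iid). Qed.

(** Since exp (s max (0, a)) <= 1 + exp (s a), a letter added in front changes a bound m into 1 +
    theta m, whose fixed point is 1 / (1 - theta). *)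
Lemma excess_chernoff psi (s theta : R) : measurable_fun setT psi ->
  (0 <= s)%R -> (0 <= theta)%R -> (theta < 1)%R ->
  \int[P0]_t (X t * expR (s * psi (X t)))%:E <= theta%:E ->
  forall vs, uniq vs -> [::] \notin vs ->
  \int[P]_w (wprod Xs vs w * expR (s * excess psi (wvals Xs vs w)))%:E <=
    ((1 - theta)^-1)%:E.
Proof.
move=> mpsi s0 t0 t1 H; elim=> [_ _|v vs IH].
  under eq_integral do rewrite /wprod big_nil /= mulr0 expR0 mulr1.
  rewrite integral_cst//= probability_setT mule1 lee_fin.
  by rewrite invf_ge1 ?subr_gt0// gerBl.
move=> /= /andP[vvs uvs]; rewrite inE negb_or eq_sym => /andP[v0 vs0].
have mS := @measurable_excess_away _ _ _ _ _ Xs psi v vs mpsi vvs vs0.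
have mW := @measurable_wprod_away _ _ _ _ _ Xs v vs vvs vs0.
pose g (x : R) := (`|x| * expR (s * psi x))%R.
have mg : measurable_fun setT g.
  apply: measurable_funM => //; apply: measurableT_comp => //; exact: measurable_funM.
pose Z (w : Omega) := (wprod Xs vs w * expR (s * excess psi (wvals Xs vs w)))%R.
have mZ : measurable_fun [set: away Xs v] (Z : away Xs v -> R).
  apply: measurable_funM => //; apply: measurableT_comp => //; exact: measurable_funM.
have Z0 w : (0 <= Z w)%R by rewrite mulr_ge0 ?expR_ge0.
have mZ' := measurable_fun_away mZ.
apply: (@le_trans _ _ (\int[P]_w ((Xs v w * wprod Xs vs w)%:E + (g (Xs v w) * Z w)%:E))).
  apply: ge0_le_integral => //.
  - by move=> w _; rewrite lee_fin mulr_ge0 ?expR_ge0.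
  - apply/measurable_EFinP/measurable_funM => //; apply: measurableT_comp => //.
    by apply: measurable_funM => //; exact: (@measurable_excess _ _ _ _ _ Xs psi (v :: vs)).
  - apply/measurable_EFinP/measurable_funD.
      exact: measurable_funM.
    by apply: measurable_funM => //; exact: measurableT_comp.
  - move=> w _; rewrite -EFinD lee_fin /Z /g /= ger0_norm// /wprod big_cons.
    rewrite [leRHS](_ : _ = Xs v w * (\prod_(j <- vs) Xs j w) *
      (1 + expR (s * (psi (Xs v w) + excess psi (wvals Xs vs w)))))%R; last first.
      by rewrite (mulrDr s) expRD; ring.
    rewrite ler_wpM2l ?mulr_ge0//; first exact: wprod0.
    rewrite maxEle; case: ifPn => _; first by rewrite lerDr.
    by rewrite mulr0 expR0 lerDl expR_ge0.
rewrite ge0_integralD//; last 4 first.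
- by move=> w _; rewrite lee_fin mulr_ge0.
- by apply/measurable_EFinP/measurable_funM.
- by move=> w _; rewrite lee_fin !mulr_ge0// expR_ge0.
- by apply/measurable_EFinP/measurable_funM => //; exact: measurableT_comp.
rewrite (freezing_mean Xs_iid X_ge0 Xs_ge0 X_mean v0 mW)// wp1//.
rewrite (freezing_prod Xs_iid v0 mg)//; last by move=> x; rewrite mulr_ge0 ?expR_ge0.
apply: (@le_trans _ _ (1%:E + theta%:E * ((1 - theta)^-1)%:E)).
  rewrite leeD2l//; apply: lee_pmul.
  - by apply: integral_ge0 => t _; rewrite lee_fin mulr_ge0 ?expR_ge0.
  - by apply: integral_ge0 => t _; rewrite lee_fin Z0.
  - by apply: le_trans H; under eq_integral do rewrite /g ger0_norm//.
  - exact: IH.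
rewrite -EFinM -EFinD lee_fin le_eqVlt; apply/orP; left; apply/eqP.
by field; lra.
Qed.

(* Garsia's proof of the maximal ergodic inequality: adding a letter in front
   changes the excess [e] into at most [e + r x - lam] when it is positive, and
   the tilted mean [a n] of the excess is nondecreasing in the length. *)
Section garsia.
Variables (r : R -> R) (lam rho : R).
Hypotheses (mr : measurable_fun setT r) (r0 : forall x, (0 <= r x)%R) (lam0 : (0 < lam)%R).
Hypothesis rhoE : \int[P0]_t (X t * r (X t))%:E = rho%:E.
Let psi x := (r x - lam)%R.
Let mpsi : measurable_fun setT psi.
Proof. exact: measurable_funB. Qed.
Let pos (x : R) : \bar R := (Num.max 0%R x)%:E.
Let a n := iter n (step X psi) pos 0%R.

Let pos0 x : 0 <= pos x. Proof. by rewrite lee_fin le_max lexx. Qed.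
Let mpos : measurable_fun setT pos.
Proof. by apply/measurable_EFinP/measurable_maxr. Qed.

Let step_iter n : [/\ measurable_fun setT (iter n (step X psi) pos),
  forall x, 0 <= iter n (step X psi) pos x &
  {homo iter n (step X psi) pos : x y / (x <= y)%R >-> x <= y}].
Proof.
elim: n => [|n [m1 p1 h1]] /=.
  split => // x y xy; rewrite lee_fin ge_max le_max lexx/= le_max xy orbT//.
split; [exact: measurable_step|exact: step_ge0|].
move=> x y xy; apply: ge0_le_integral => //.
- by move=> t _; rewrite mule_ge0 ?lee_fin.
- apply: emeasurable_funM; first exact/measurable_EFinP.
  apply: measurableT_comp => //; apply: measurable_maxr => //.
  apply: measurable_funD => //; exact: measurableT_comp.
- apply: emeasurable_funM; first exact/measurable_EFinP.
  apply: measurableT_comp => //; apply: measurable_maxr => //.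
  apply: measurable_funD => //; exact: measurableT_comp.
- move=> t _; rewrite lee_wpmul2l ?lee_fin//; apply: h1.
  by rewrite ge_max !le_max lexx/= lerD2l xy orbT.
Qed.

(** The iterates are nondecreasing functions and one more step evaluates them at points at least 0;
    E X = 1 then gives the comparison. *)
Let a_nd n : a n <= a n.+1.
Proof.
have [m1 p1 h1] := step_iter n.
rewrite /a /= {2}/step.
rewrite -[leLHS]mul1e -X_mean -ge0_integralZr//; last 2 first.
- exact/measurable_EFinP.
- by move=> t _; rewrite lee_fin.
apply: ge0_le_integral => //.
- by move=> t _; rewrite mule_ge0 ?lee_fin.
- by apply: emeasurable_funM => //; exact/measurable_EFinP.
- apply: emeasurable_funM; first exact/measurable_EFinP.
  apply: measurableT_comp => //; apply: measurable_maxr => //.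
  apply: measurable_funD => //; exact: measurableT_comp.
- by move=> t _; rewrite lee_wpmul2l ?lee_fin//; apply: h1; rewrite le_max lexx.
Qed.

Let aE vs : uniq vs -> [::] \notin vs ->
  \int[P]_w (wprod Xs vs w * excess psi (wvals Xs vs w))%:E = a (size vs).
Proof.
move=> uvs vs0; rewrite /a -(excess_law Xs_iid)//.
by apply: eq_integral => w _; rewrite EFinM /pos max_r// excess_ge0.
Qed.

Definition excess_pos vs : set Omega := [set w | (0 < excess psi (wvals Xs vs w))%R].

Lemma measurable_excess_pos vs : measurable (excess_pos vs).
Proof.
rewrite /excess_pos -[X in measurable X]setTI.
rewrite (_ : [set w | _] = (fun w => excess psi (wvals Xs vs w)) @^-1` `]0%R, +oo[); last first.
  by apply/seteqP; split => w /=; rewrite in_itv/= andbT.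
by apply: measurable_excess.
Qed.

Let incr v vs : uniq (v :: vs) -> [::] \notin v :: vs ->
  lam%:E * \int[P]_w (wprod Xs (v :: vs) w * \1_(excess_pos (v :: vs)) w)%:E + a (size vs).+1
   <= a (size vs) + rho%:E.
Proof.
move=> uvvs vvs0.
have mI := measurable_excess_pos (v :: vs).
have mS' := @measurable_excess _ _ _ _ _ Xs psi (v :: vs) mpsi.
have mS'' := @measurable_excess _ _ _ _ _ Xs psi vs mpsi.
rewrite -(aE uvvs vvs0).
have /andP[vvs uvs] := uvvs; have := vvs0.
rewrite inE negb_or eq_sym => /andP[v0 vs0].
have mS := @measurable_excess_away _ _ _ _ _ Xs psi v vs mpsi vvs vs0.
have mW := @measurable_wprod_away _ _ _ _ _ Xs v vs vvs vs0.
have m1 : measurable_fun setT (fun w => wprod Xs (v :: vs) w * \1_(excess_pos (v :: vs)) w)%R.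
  by apply: measurable_funM => //; exact: measurable_indic.
rewrite -ge0_integralZl//; last 3 first.
- exact/measurable_EFinP.
- by move=> w _; rewrite lee_fin mulr_ge0.
- by rewrite lee_fin ltW.
rewrite -ge0_integralD//; last 4 first.
- by move=> w _; rewrite -EFinM lee_fin !mulr_ge0// ltW.
- by apply/measurable_EFinP/measurable_funM.
- by move=> w _; rewrite lee_fin mulr_ge0 ?excess_ge0.
- by apply/measurable_EFinP/measurable_funM.
rewrite -(aE uvs vs0) -(mul1e rho%:E) muleC -(wp1 uvs vs0).
pose g (x : R) := (`|x| * r x)%R.
have mg : measurable_fun setT g by exact: measurable_funM.
have -> : rho%:E = \int[P0]_t (g (X t))%:E.
  by rewrite -rhoE; apply: eq_integral => t _; rewrite /g ger0_norm.
rewrite -(freezing_prod Xs_iid v0 mg)//; last by move=> x; rewrite mulr_ge0.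
rewrite -(@freezing_mean _ _ _ _ _ _ _ _ _ _ Xs_iid X_ge0 Xs_ge0 X_mean v
   (fun w => wprod Xs vs w * excess psi (wvals Xs vs w))%R)//; last 2 first.
- exact: measurable_funM.
- by move=> w; rewrite mulr_ge0 ?excess_ge0.
have mm : measurable_fun [set: Omega] (fun x => g (Xs v x) * wprod Xs vs x)%R.
  by apply: measurable_funM => //; exact: measurableT_comp.
rewrite -ge0_integralD//; last 4 first.
- by move=> w _; rewrite lee_fin !mulr_ge0 ?excess_ge0.
- by apply/measurable_EFinP/measurable_funM => //; exact: measurable_funM.
- by move=> w _; rewrite lee_fin !mulr_ge0.
- exact/measurable_EFinP.
apply: ge0_le_integral => //.
- by move=> w _; rewrite adde_ge0// -?EFinM lee_fin !mulr_ge0 ?excess_ge0// ltW.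
- by apply/measurable_EFinP/measurable_funD; apply: measurable_funM => //.
- apply/measurable_EFinP/measurable_funD => //.
  by apply: measurable_funM => //; exact: measurable_funM.
move=> w _; rewrite -EFinM -!EFinD lee_fin.
rewrite /g ger0_norm// /wprod !big_cons.
set p := (\prod_(j <- vs) _)%R; set e := excess psi (wvals Xs vs w).
rewrite [leLHS](_ : _ = (Xs v w * p) *
  (lam * \1_(excess_pos (v :: vs)) w + excess psi (wvals Xs (v :: vs) w)))%R; last by ring.
rewrite [leRHS](_ : _ = (Xs v w * p) * (e + r (Xs v w)))%R; last by ring.
rewrite ler_wpM2l ?mulr_ge0//; first exact: wprod0.
have e0 : (0 <= e)%R by exact: excess_ge0.
have -> : \1_(excess_pos (v :: vs)) w = (0 < excess psi (wvals Xs (v :: vs) w))%R%:R :> R.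
  by rewrite indicE; congr ((nat_of_bool _)%:R); apply/idP/idP; rewrite inE.
rewrite /= -/e /psi maxEle.
have := r0 (Xs v w).
case: (leP 0%R (r (Xs v w) - lam + e)%R) => h1 rv.
  case: (ltP 0%R (r (Xs v w) - lam + e)%R) => h2.
    by rewrite mulr1; lra.
  by rewrite mulr0 add0r; lra.
by rewrite ltxx mulr0 addr0 addr_ge0.
Qed.

Let rho0 : (0 <= rho)%R.
Proof.
by rewrite -lee_fin -rhoE; apply: integral_ge0 => t _; rewrite lee_fin mulr_ge0.
Qed.

Lemma excess_maximal vs : uniq vs -> [::] \notin vs ->
  lam%:E * \int[P]_w (wprod Xs vs w * \1_(excess_pos vs) w)%:E <= rho%:E.
Proof.
have pI vs' : 0 <= \int[P]_w (wprod Xs vs' w * \1_(excess_pos vs') w)%:E.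
  by apply: integral_ge0 => w _; rewrite lee_fin mulr_ge0.
(* The tilted means [a n] must be finite to be cancelled below; [incr] bounds each by the previous
   one plus [rho]. *)
have fin n vs' : size vs' = n -> uniq vs' -> [::] \notin vs' -> a n < +oo.
  elim: n vs' => [|n IH] [|v vs']//=.
    by rewrite /a /= /pos ltry.
  move=> [sz] uv v0; have := incr uv v0.
  move: uv v0 => /andP[vvs uvs]; rewrite inE negb_or => /andP[v0 vs0].
  have h := IH _ sz uvs vs0; rewrite sz => H.
  apply: (@le_lt_trans _ _ (a n + rho%:E)); last by rewrite lte_add_pinfty// ltry.
  apply: le_trans H; rewrite leeDr// mule_ge0// lee_fin ltW//.
case: vs => [|v vs] uvs vs0.
  have -> : excess_pos [::] = set0 by apply/seteqP; split => w //=; rewrite /excess_pos /= ltxx.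
  under eq_integral do rewrite indic0 mulr0.
  by rewrite integral0 mule0 lee_fin.
have fa : a (size vs).+1 < +oo by exact: (fin _ (v :: vs)).
have fina : a (size vs).+1 \is a fin_num.
  rewrite ge0_fin_numE//; have [_ h _] := step_iter (size vs).+1; exact: h.
have := incr uvs vs0.
have := a_nd (size vs).
move=> h1 h2.
have : lam%:E * \int[P]_w (wprod Xs (v :: vs) w * \1_(excess_pos (v :: vs)) w)%:E + a (size vs).+1
   <= a (size vs).+1 + rho%:E by apply: (le_trans h2); rewrite leeD2r.
by rewrite addeC leeD2lE.
Qed.

End garsia.
End tilted_walk.

(** * Sign and integrability of X ln X *)

Section entropy.
Context (R : realType) (d0 : measure_display) (T0 : measurableType d0)
  (P0 : probability T0 R) (X : {RV P0 >-> R}).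
Hypothesis X_ge0 : forall t, (0 <= X t)%R.
Hypothesis X_mean : \int[P0]_t (X t)%:E = 1.

(** The tangent of x ln x at 1. It bounds the negative part of X ln X by 1 and, once integrated,
    gives h_X >= 0 because E X = 1. *)
Lemma mul_ln_ge (x : R) : (0 <= x)%R -> (x - 1 <= x * ln x)%R.
Proof.
rewrite le_eqVlt => /predU1P[<-|x0]; first by rewrite mul0r; lra.
have := expR_ge1Dx (- ln x); rewrite expRN lnK// => h.
have : (x * (1 - ln x) <= x * x^-1)%R by rewrite ler_pM2l.
by rewrite divff ?gt_eqF// mulrBr mulr1; lra.
Qed.

Lemma integrable_X : P0.-integrable setT (fun t => (X t)%:E).
Proof.
apply/integrableP; split; first exact/measurable_EFinP.
by under eq_integral do rewrite gee0_abs ?lee_fin//; rewrite X_mean ltry.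
Qed.

Lemma measurable_entropy : measurable_fun setT (fun t => (X t * ln (X t))%:E).
Proof.
apply/measurable_EFinP/measurable_funM => //.
exact: (measurableT_comp (@measurable_ln R)).
Qed.

Lemma integrable_entropy : entropy X < +oo ->
  P0.-integrable setT (fun t => (X t * ln (X t))%:E).
Proof.
move=> h; have mf := measurable_entropy.
have neg : \int[P0]_t ((fun t => (X t * ln (X t))%:E)^\- t) <= 1.
  rewrite -(@probability_setT _ _ _ P0) -[leRHS]mul1e -integral_cst//.
  apply: ge0_le_integral => //.
    exact: measurable_funeneg.
  move=> t _; rewrite funenegE ge_max; apply/andP; split; last exact: lee01.
  by rewrite -EFinN lee_fin; have := mul_ln_ge (X_ge0 t); have := X_ge0 t; lra.
have pos : \int[P0]_t ((fun t => (X t * ln (X t))%:E)^\+ t) < +oo.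
  move: h; rewrite /entropy integralE lteBlDr.
    move=> /lt_le_trans; apply; rewrite ?leey//.
  rewrite ge0_fin_numE; first exact: le_lt_trans neg (ltry _).
  by apply: integral_ge0.
apply/integrableP; split => //.
set f := fun t => (X t * ln (X t))%:E in mf neg pos *.
have -> : \int[P0]_t `|f t| = \int[P0]_t (f^\+ t + f^\- t).
  by apply: eq_integral => t _; rewrite -[RHS]/((f^\+ \+ f^\-) t) -fune_abse.
rewrite ge0_integralD//; last 2 first.
- exact: measurable_funepos.
- exact: measurable_funeneg.
by rewrite lte_add_pinfty// (le_lt_trans neg)// ltry.
Qed.

Lemma entropy_ge0 : 0 <= entropy X.
Proof.
have [h|] := ltP (entropy X) +oo; last by move/(le_trans _); apply; rewrite leey.
have iX := integrable_X; have iE := integrable_entropy h.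
have i1 : P0.-integrable setT (fun=> 1%:E : \bar R) by exact: finite_measure_integrable_cst.
have : \int[P0]_t ((X t)%:E - 1%:E) <= entropy X.
  apply: le_integral => //; first exact: integrableB.
  by move=> t _; rewrite lee_fin; exact: mul_ln_ge.
by rewrite integralB// X_mean integral_cst//= probability_setT mul1e subee.
Qed.

End entropy.

(** * Lower and upper tails of the tilted products *)

Section exponential_tilt.
Context (R : realType) (b : nat) (d : measure_display) (Omega : measurableType d)
  (P : probability Omega R) (Xs : seq 'I_b -> {RV P >-> R})
  (d0 : measure_display) (T0 : measurableType d0) (P0 : probability T0 R)
  (X : {RV P0 >-> R}).
Hypothesis Xs_iid : iid_copies Xs X.
Hypothesis X_ge0 : forall t, (0 <= X t)%R.
Hypothesis Xs_ge0 : forall u w, (0 <= Xs u w)%R.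
Hypothesis X_mean : \int[P0]_t (X t)%:E = 1.
Implicit Types (vs : seq (seq 'I_b)).

Let wprod0 vs w : (0 <= wprod Xs vs w)%R := wprod_ge0 Xs_ge0 vs w.
Let mwprod vs : measurable_fun setT (wprod Xs vs) := @measurable_wprod _ _ _ _ _ Xs vs.

Lemma prod_expR_ln (l : seq R) : (forall a, a \in l -> 0 < a)%R ->
  (\prod_(a <- l) a = expR (\sum_(a <- l) ln a))%R.
Proof.
move=> l0; rewrite expR_sum big_seq [RHS]big_seq; apply: eq_bigr => a al.
by rewrite lnK// posrE l0.
Qed.

Lemma wprod_gt0 vs w : (0 < wprod Xs vs w)%R -> forall a, a \in wvals Xs vs w -> (0 < a)%R.
Proof.
move=> h a /mapP[v vvs ->]; rewrite lt_neqAle Xs_ge0 andbT eq_sym.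
apply: contraTneq h => v0; rewrite -leNgt /wprod.
by rewrite (big_rem v vvs)/= v0 mul0r.
Qed.

Lemma wprodE vs w : wprod Xs vs w = (\prod_(a <- wvals Xs vs w) a)%R.
Proof. by rewrite /wprod /wvals big_map. Qed.

(* Chernoff's bound under the tilted measure, where ln X has mean [entropy X]. *)
Lemma lower_tail (H : R) : H%:E < entropy X ->
  exists2 r : R, (0 <= r < 1)%R & forall vs, uniq vs -> [::] \notin vs ->
  \int[P]_w (wprod Xs vs w * \1_[set w | wprod Xs vs w < expR (H * (size vs)%:R)]%R w)%:E
     <= (r ^+ size vs)%:E.
Proof.
move=> hH.
pose Y t := (H - ln (X t))%R.
have mlnX : measurable_fun setT (fun t => ln (X t)) by exact: (measurableT_comp (@measurable_ln R)).
have mY : measurable_fun setT Y by exact: measurable_funB.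
have [||n nth] := @exp_small _ _ _ P0 X Y (@measurable_funPT _ _ _ _ X) mY X_ge0 X_mean.
(* X exp (H - ln X) equals exp H where X > 0 and vanishes where X = 0. *)
- apply: (@le_lt_trans _ _ (expR H)%:E); last by rewrite ltry.
  rewrite -[leRHS]mule1 -(@probability_setT _ _ _ P0) -integral_cst//.
  apply: ge0_le_integral => //.
  + by move=> t _; rewrite lee_fin mulr_ge0 ?expR_ge0.
  + by apply/measurable_EFinP/measurable_funM => //; exact: measurableT_comp.
  + move=> t _; rewrite lee_fin /Y expRD expRN.
    have := X_ge0 t; rewrite le_eqVlt => /predU1P[<-|Xt]; first by rewrite mul0r expR_ge0.
    by rewrite lnK// mulrCA divff ?mulr1// gt_eqF.
(* An integrable X Y with nonnegative mean would make h_X finite and at most [H]; this covers h_X =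
   +oo as well. *)
- move=> [iXY XY0].
  have iE : entropy X = \int[P0]_t (H%:E * (X t)%:E - (X t * Y t)%:E).
    by apply: eq_integral => t _; rewrite -EFinM -EFinB /Y; congr EFin; ring.
  have iX := integrable_X X_ge0 X_mean.
  move: hH; rewrite iE integralB//; last exact: integrableZl.
  rewrite integralZl// X_mean mule1 ltNge => /negP; apply.
  by rewrite leeBlDr ?integrable_fin_num// leeDl.
set g := fun x : R => (`|x| * expR ((H - ln x) / n.+1%:R))%R.
have mg : measurable_fun setT g.
  apply: measurable_funM => //; apply: measurableT_comp => //; apply: measurable_funM => //.
  by apply: measurable_funB => //; exact: measurable_ln.
have g0 x : (0 <= g x)%R by rewrite mulr_ge0 ?expR_ge0.
pose th := \int[P0]_t (g (X t))%:E.
have th1 : th < 1.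
  rewrite /th; under eq_integral do rewrite /g ger0_norm//.
  exact: nth.
have th0 : 0 <= th by apply: integral_ge0 => t _; rewrite lee_fin.
have thf : th \is a fin_num by rewrite ge0_fin_numE// (lt_trans th1)// ltry.
exists (fine th); first by rewrite fine_ge0//= -lte_fin fineK.
move=> vs uvs vs0.
rewrite EFin_expe fineK// -(wprod_mean Xs_iid)//.
apply: ge0_le_integral => //.
- by move=> w _; rewrite lee_fin mulr_ge0.
- apply/measurable_EFinP/measurable_funM => //; apply: measurable_indic.
  have := measurable_fun_ltr (mwprod vs) (@measurable_cst _ _ _ _ setT (expR (H * (size vs)%:R))).
  by move=> /(_ measurableT [set true]); rewrite setTI; apply.
- apply/measurable_EFinP; apply: measurable_prod => v _.
  exact: measurableT_comp.
move=> w _; rewrite lee_fin.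
have := wprod0 vs w; rewrite le_eqVlt => /predU1P[<-|wp].
  by rewrite mul0r; apply: prodr_ge0 => v _.
rewrite indicE; case: (boolP (w \in _)) => /= ; rewrite ?mulr0 ?mulr1; last first.
  by move=> _; apply: prodr_ge0 => v _.
rewrite inE /= => hlt.
have pos := wprod_gt0 wp.
(* Chernoff's step: on the event, the exponent H (size vs) - ln (wprod) is nonnegative, so the
   product of the [g] dominates the weight; its mean is a power of [th]. *)
rewrite (_ : \prod_(v <- vs) g (Xs v w) =
    wprod Xs vs w * expR ((H * (size vs)%:R - ln (wprod Xs vs w)) / n.+1%:R))%R.
  rewrite ler_peMr//.
  rewrite -[leLHS](@expR0 R) ler_expR divr_ge0// subr_ge0.
  by rewrite -ler_expR lnK ?posrE//; exact: ltW hlt.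
rewrite big_split /=; congr (_ * _)%R.
  by apply: eq_bigr => v _; rewrite ger0_norm.
rewrite -expR_sum -mulr_suml; congr (expR (_ / _)).
rewrite sumrB; congr (_ - _)%R.
  by rewrite big_const_seq count_predT iter_addr_0 mulr_natr.
by rewrite wprodE prod_expR_ln// expRK big_map.
Qed.

End exponential_tilt.

Section upper_tail.
Context (R : realType) (b : nat) (d : measure_display) (Omega : measurableType d)
  (P : probability Omega R) (Xs : seq 'I_b -> {RV P >-> R})
  (d0 : measure_display) (T0 : measurableType d0) (P0 : probability T0 R)
  (X : {RV P0 >-> R}).
Hypothesis Xs_iid : iid_copies Xs X.
Hypothesis X_ge0 : forall t, (0 <= X t)%R.
Hypothesis Xs_ge0 : forall u w, (0 <= Xs u w)%R.
Hypothesis X_mean : \int[P0]_t (X t)%:E = 1.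
Implicit Types (vs : seq (seq 'I_b)).

Let wprod0 vs w : (0 <= wprod Xs vs w)%R := wprod_ge0 Xs_ge0 vs w.
Let mwprod vs : measurable_fun setT (wprod Xs vs) := @measurable_wprod _ _ _ _ _ Xs vs.

Definition escape (c L : R) vs : set Omega :=
  \bigcup_(k in `I_(size vs).+1)
    [set w | (expR (c * k%:R + L) < wprod Xs (take k vs) w)%R].

Lemma measurable_escape c L vs : measurable (escape c L vs).
Proof.
apply: bigcup_measurable => k _.
have := measurable_fun_ltr (@measurable_cst _ _ _ _ setT (expR (c * k%:R + L)))
  (mwprod (take k vs)).
by move=> /(_ measurableT [set true]); rewrite setTI; apply.
Qed.

(** When the product crosses the barrier at [k], the first [k] values of ln x - c sum to more than
    [L]. If the [r] parts sum to at most 0, the [y] parts carry all of it. *)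
Lemma excess_of_escape c L (r y : R -> R) vs w :
  (forall x, r x + y x = ln x - c)%R -> (0 <= L)%R ->
  (0 < wprod Xs vs w)%R -> escape c L vs w ->
  (0 < excess r (wvals Xs vs w))%R \/ (L < excess y (wvals Xs vs w))%R.
Proof.
move=> ry L0 wp [k /= kvs]; rewrite wprodE /wvals map_take -/(wvals Xs vs w).
have pos := wprod_gt0 Xs_ge0 wp.
rewrite prod_expR_ln; last by move=> a /mem_take; exact: pos.
rewrite ltr_expR => h.
have := sum_le_excess r (wvals Xs vs w) k.
have := sum_le_excess y (wvals Xs vs w) k.
have : (\sum_(a <- take k (wvals Xs vs w)) r a + \sum_(a <- take k (wvals Xs vs w)) y a
   = \sum_(a <- take k (wvals Xs vs w)) ln a - c * k%:R)%R.
  rewrite -big_split /= (eq_bigr _ (fun a _ => ry a)) sumrB; congr (_ - _)%R.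
  rewrite big_const_seq count_predT iter_addr_0 mulr_natr size_take size_map.
  by rewrite ltnS in kvs; case: ltnP => // kk; congr (_ *+ _)%R; apply/eqP; rewrite eqn_leq kk kvs.
set s1 := (\sum_(a <- _) r a)%R; set s2 := (\sum_(a <- _) y a)%R => e h2 h1.
have [h3|h3] := ltP 0%R s1; first by left; exact: lt_le_trans h1.
by right; apply: lt_le_trans h2; lra.
Qed.

Lemma integrable_excess_ln (h A : R) : entropy X = h%:E -> (0 <= A)%R ->
  P0.-integrable setT (fun t => (X t * Num.max 0 (ln (X t) - A))%:E).
Proof.
move=> hE A0.
have iE := integrable_entropy X_ge0 (ltac:(by rewrite hE ltry) : entropy X < +oo).
have mlnX : measurable_fun setT (fun t => ln (X t)) by exact: (measurableT_comp (@measurable_ln R)).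
apply: (le_integrable measurableT _ _ iE).
  apply/measurable_EFinP/measurable_funM => //; apply: measurable_maxr => //.
  exact: measurable_funB.
move=> t _; rewrite lee_fin !normrM ler_wpM2l// ger0_norm ?le_max ?lexx//.
by rewrite ge_max normr_ge0/= (le_trans _ (ler_norm _))// gerBl.
Qed.

(** Dominated convergence as the truncation level grows, with the absolute value of X ln X as
    majorant: here a finite h_X is essential. *)
Lemma excess_ln_small (h e : R) : entropy X = h%:E -> (0 < e)%R ->
  exists2 A : R, (0 <= A)%R &
    \int[P0]_t (X t * Num.max 0 (ln (X t) - A))%:E <= e%:E.
Proof.
move=> hE e0.
have iE := integrable_entropy X_ge0 (ltac:(by rewrite hE ltry) : entropy X < +oo).
have mlnX : measurable_fun setT (fun t => ln (X t)) by exact: (measurableT_comp (@measurable_ln R)).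
pose f n t := (X t * Num.max 0 (ln (X t) - n%:R))%:E.
have mf n : measurable_fun setT (f n).
  apply/measurable_EFinP/measurable_funM => //; apply: measurable_maxr => //.
  exact: measurable_funB.
have cf t : f n t @[n --> \oo] --> 0.
  apply: cvg_near_cst; near=> n; rewrite /f.
  rewrite (_ : Num.max _ _ = 0%R) ?mulr0//.
  apply/max_idPl; rewrite subr_le0; near: n.
  exact: nbhs_infty_ger.
have dom : \forall t \ae P0, forall n, setT t -> `|f n t| <= `|(X t * ln (X t))%:E|.
  apply: aeW => t n _ /=; rewrite lee_fin !normrM ler_wpM2l// ger0_norm ?le_max ?lexx//.
  by rewrite ge_max normr_ge0/= (le_trans _ (ler_norm _))// gerBl.
have cae : \forall t \ae P0, setT t -> f n t @[n --> \oo] --> (fun=> 0) t.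
  by apply: aeW => t _; exact: cf.
have [_ _] := dominated_convergence measurableT mf (measurable_cst _) cae
  (integrable_abse iE) dom.
rewrite integral0 => cv.
have /fine_cvgP[[N1 _ fin] cvr] := cv.
have [N2 _ HN] : \forall n \near \oo, (fine (\int[P0]_t f n t) <= e)%R.
  by apply: cvgr_le cvr _ _.
exists (maxn N1 N2)%:R => //.
have /= h1 := fin (maxn N1 N2) (leq_maxl _ _).
have /= h2 := HN (maxn N1 N2) (leq_maxr _ _).
by rewrite -/(f _ _) -[leLHS]fineK// lee_fin.
Unshelve. all: by end_near. Qed.

(* ln X may have no exponential moment under the tilted measure. We write
   ln x - c as the sum of [y], bounded above with negative tilted mean, which
   Chernoff's bound handles, and [r], whose positive part has a tiny tilted
   mean, which the maximal inequality handles. *)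
Lemma upper_tail (h c eps : R) : entropy X = h%:E -> (h < c)%R -> (0 < eps)%R ->
  exists2 L : R, (0 <= L)%R & forall vs, uniq vs -> [::] \notin vs ->
  \int[P]_w (wprod Xs vs w * \1_(escape c L vs) w)%:E <= eps%:E.
Proof.
move=> hE hc eps0.
(* The gap is halved: [y] gets tilted mean at most h - c + e = - e, while [r] is [r0] lowered by
   [e], which becomes [lam] in the maximal inequality. The truncation [A] makes the tilted mean of
   [r0] at most e eps / 2, hence a probability of at most eps / 2. *)
pose e := ((c - h) / 2)%R.
have e0 : (0 < e)%R by rewrite /e; lra.
have ee0 : (0 < e * (eps / 2))%R by rewrite mulr_gt0// divr_gt0.
have [A A0 HA] := excess_ln_small hE ee0.
have iE := integrable_entropy X_ge0 (ltac:(by rewrite hE ltry) : entropy X < +oo).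
have iX := integrable_X X_ge0 X_mean.
have mlnX : measurable_fun setT (fun t => ln (X t)) by exact: (measurableT_comp (@measurable_ln R)).
have mln := @measurable_ln R.
pose r0 x := Num.max 0%R (ln x - A)%R.
pose r x := (r0 x - e)%R.
pose y x := (Num.min (ln x) A - c + e)%R.
have mr0 : measurable_fun setT r0 by apply: measurable_maxr => //; exact: measurable_funB.
have my : measurable_fun setT y.
  by apply: measurable_funD => //; apply: measurable_funB => //; exact: measurable_minr.
have myX : measurable_fun setT (y \o X) by exact: measurableT_comp.
have [||n nth] := @exp_small _ _ _ P0 X (y \o X) (@measurable_funPT _ _ _ _ X) myX X_ge0 X_mean.
- apply: (@le_lt_trans _ _ (expR (A - c + e))%:E); last by rewrite ltry.
  rewrite -[leRHS]mule1 -X_mean -ge0_integralZl_EFin ?expR_ge0//; last 2 first.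
  + by move=> t _; rewrite lee_fin.
  + exact/measurable_EFinP.
  apply: ge0_le_integral => //.
  + by move=> t _; rewrite lee_fin mulr_ge0 ?expR_ge0.
  + by apply/measurable_EFinP/measurable_funM => //; exact: measurableT_comp.
  + by apply/measurable_EFinP/measurable_funM.
  + move=> t _; rewrite lee_fin mulrC ler_wpM2r// ler_expR /= /y.
    by rewrite lerD2r lerD2r ge_min lexx orbT.
- move=> [iXY XY0].
  have : \int[P0]_t (X t * y (X t))%:E <=
     \int[P0]_t ((X t * ln (X t))%:E + (e - c)%:E * (X t)%:E).
    apply: le_integral => //.
      by apply: integrableD => //; exact: integrableZl.
    move=> t _; rewrite -EFinM -EFinD lee_fin mulrC (mulrC (X t)) -mulrDl ler_wpM2r//.
    by rewrite /y -addrA [(- c + e)%R]addrC lerD2r ge_min lexx.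
  rewrite integralD//; last exact: integrableZl.
  rewrite integralZl// X_mean mule1 -/(entropy X) hE -EFinD.
  apply/negP; rewrite -ltNge; apply: lt_le_trans XY0.
  by rewrite lte_fin /e; lra.
pose th := \int[P0]_t (X t * expR (n.+1%:R^-1 * y (X t)))%:E.
have th1 : th < 1.
  by rewrite /th; under eq_integral do rewrite (mulrC _ (y _)).
have th0 : 0 <= th by apply: integral_ge0 => t _; rewrite lee_fin mulr_ge0 ?expR_ge0.
have thf : th \is a fin_num by rewrite ge0_fin_numE// (lt_trans th1)// ltry.
have thr1 : (fine th < 1)%R by rewrite -lte_fin fineK.
have n0 : (0 <= n.+1%:R^-1 :> R)%R by [].
have thle : th <= (fine th)%:E by rewrite fineK.
have cher := excess_chernoff Xs_iid X_ge0 Xs_ge0 X_mean my n0 (fine_ge0 th0) thr1 thle.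
pose C := ((1 - fine th)^-1)%R.
have C0 : (0 < C)%R by rewrite invr_gt0 subr_gt0.
(* Solves C exp (- L / (n + 1)) <= eps / 2, the other half of the budget, where [C] bounds the
   exponential moment of the excess of [y]. *)
pose L := (Num.max 0 (n.+1%:R * ln (C / (eps / 2))))%R.
exists L; first by rewrite le_max lexx.
have CL : (C * expR (- (n.+1%:R^-1 * L)) <= eps / 2)%R.
  rewrite expRN ler_pdivrMr ?expR_gt0// mulrC -ler_pdivrMr ?divr_gt0//.
  rewrite -[leLHS]lnK ?posrE ?divr_gt0// ler_expR.
  by rewrite [leRHS]mulrC ler_pdivlMr// [leLHS]mulrC /L le_max lexx orbT.
move=> vs uvs vs0.
pose Er : set Omega := excess_pos Xs r0 e vs.
have mEr : measurable Er by exact: measurable_excess_pos.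
have mesc := measurable_escape c L vs.
have mex := @measurable_excess _ _ _ _ _ Xs y vs my.
apply: (@le_trans _ _ (\int[P]_w ((wprod Xs vs w * \1_Er w)%:E +
  (expR (- (n.+1%:R^-1 * L)))%:E *
    (wprod Xs vs w * expR (n.+1%:R^-1 * excess y (wvals Xs vs w)))%:E))).
  apply: ge0_le_integral => //.
  - by move=> w _; rewrite lee_fin mulr_ge0.
  - by apply/measurable_EFinP/measurable_funM => //; exact: measurable_indic.
  - apply/measurable_EFinP/measurable_funD.
      by apply: measurable_funM => //; exact: measurable_indic.
    apply: measurable_funM => //; apply: measurable_funM => //.
    by apply: measurableT_comp => //; exact: measurable_funM.
  - move=> w _; rewrite -EFinM -EFinD lee_fin mulrCA -mulrDr -expRD.
    have := wprod0 vs w; rewrite le_eqVlt => /predU1P[<-|wp]; first by rewrite !mul0r.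
    rewrite ler_pM2l//.
    have [/set_mem esc|/negPf wesc] := boolP (w \in escape c L vs); last first.
      by rewrite indicE wesc addr_ge0 ?expR_ge0.
    rewrite indicE mem_set//.
    have [||h1|h1] := @excess_of_escape c L r y vs w _ _ wp esc.
    + move=> x; rewrite /r /y /r0 maxEle minEle subr_ge0.
      by case: (leP A (ln x)) => h1; case: (leP (ln x) A) => h2; lra.
    + by rewrite le_max lexx.
    + by rewrite indicE mem_set// lerDl expR_ge0.
    + rewrite ler_wpDl// -[leLHS](@expR0 R) ler_expR addrC subr_ge0.
      by rewrite ler_pM2l ?invr_gt0// ltW.
rewrite ge0_integralD//; last 4 first.
- by move=> w _; rewrite lee_fin mulr_ge0.
- by apply/measurable_EFinP/measurable_funM => //; exact: measurable_indic.
- by move=> w _; rewrite -EFinM lee_fin !mulr_ge0 ?expR_ge0.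
- apply/measurable_EFinP; apply: measurable_funM => //.
  apply: measurable_funM => //; apply: measurableT_comp => //.
  exact: measurable_funM.
rewrite [eps]splitr EFinD; apply: leeD.
  rewrite -(@lee_pmul2l _ e%:E)// -EFinM.
  have iR := integrable_excess_ln hE A0.
  have rf := integrable_fin_num measurableT iR.
  apply: le_trans HA; rewrite -[leRHS]fineK//.
  apply: (excess_maximal Xs_iid X_ge0 Xs_ge0 X_mean mr0) => //.
    by move=> x; rewrite le_max lexx.
  by rewrite fineK.
rewrite ge0_integralZl//; last 2 first.
- apply/measurable_EFinP/measurable_funM => //; apply: measurableT_comp => //.
  exact: measurable_funM.
- by move=> w _; rewrite lee_fin mulr_ge0 ?expR_ge0.
apply: (@le_trans _ _ (C * expR (- (n.+1%:R^-1 * L)))%:E); last by rewrite lee_fin.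
rewrite (mulrC C) EFinM; apply: lee_wpmul2l; first by rewrite lee_fin expR_ge0.
exact: cher.
Qed.

End upper_tail.

(** * Masses seen from the spine *)

Section prefixes.
Context (T : eqType).
Implicit Types (u v s : seq T).

(** The empty prefix is left out because [iid_copies] says nothing about its weight. *)
Definition prefixes u := [seq take k u | k <- iota 1 (size u)].

Lemma size_prefixes u : size (prefixes u) = size u.
Proof. by rewrite size_map size_iota. Qed.

Lemma prefixesP u v : reflect (exists k, [/\ (0 < k)%N, (k <= size u)%N & v = take k u])
  (v \in prefixes u).
Proof.
apply: (iffP mapP) => [[k]|[k [k0 ku ->]]].
  by rewrite mem_iota add1n ltnS => /andP[k0 ku] ->; exists k.
by exists k => //; rewrite mem_iota add1n ltnS k0.
Qed.

Lemma size_mem_prefixes u v : v \in prefixes u -> (size v <= size u)%N.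
Proof. by move=> /prefixesP[k [_ ku ->]]; rewrite size_takel. Qed.

Lemma nil_prefixes u : [::] \notin prefixes u.
Proof.
apply/prefixesP => -[k [k0 ku /(congr1 size)]].
by rewrite size_takel//= => k0'; rewrite -k0' in k0.
Qed.

Lemma uniq_prefixes u : uniq (prefixes u).
Proof.
rewrite map_inj_in_uniq ?iota_uniq// => i j.
rewrite !mem_iota !add1n !ltnS => /andP[_ iu] /andP[_ ju] /(congr1 size).
by rewrite !size_takel.
Qed.

Lemma take_prefixes u k : take k (prefixes u) = prefixes (take k u).
Proof.
rewrite /prefixes -map_take take_iota size_take_min.
apply/eq_in_map => i; rewrite mem_iota add1n ltnS => /andP[_ ik].
by rewrite take_takel// (leq_trans ik)// geq_minl.
Qed.

Lemma prefixes_rcons v a : prefixes (rcons v a) = rcons (prefixes v) (rcons v a).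
Proof.
rewrite /prefixes size_rcons -(addn1 (size v)) iotaD map_cat cats1 add1n /=.
rewrite take_oversize ?size_rcons//.
congr rcons; apply/eq_in_map => i; rewrite mem_iota add1n ltnS => /andP[_ iv].
by rewrite -cats1 takel_cat.
Qed.

End prefixes.

Section tree.
Context (R : realType) (b : nat) (d : measure_display) (Omega : measurableType d)
  (P : probability Omega R) (Xs : seq 'I_b -> {RV P >-> R})
  (d0 : measure_display) (T0 : measurableType d0) (P0 : probability T0 R)
  (X : {RV P0 >-> R}).
Hypothesis Xs_iid : iid_copies Xs X.
Hypothesis X_ge0 : forall t, (0 <= X t)%R.
Hypothesis Xs_ge0 : forall u w, (0 <= Xs u w)%R.
Hypothesis X_mean : \int[P0]_t (X t)%:E = 1.
Hypothesis hb : (1 < b)%N.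
Context (N : seq 'I_b -> R).
Hypothesis N_ge0 : forall u, (0 <= N u)%R.
Hypothesis N_sum : forall m (p : seq 'I_b), (size p <= m)%N ->
  (\sum_(v : m.-tuple 'I_b | take (size p) v == p) N v)%R = N p.
Implicit Types (u v p s : seq 'I_b).

Definition weight u := wprod Xs (prefixes u).

Lemma weight_ge0 u w : (0 <= weight u w)%R.
Proof. exact: wprod_ge0. Qed.

Lemma weight_rcons v a w : weight (rcons v a) w = (Xs (rcons v a) w * weight v w)%R.
Proof. by rewrite /weight /wprod prefixes_rcons big_rcons/= mulrC. Qed.

Lemma weight1 u : \int[P]_w (weight u w)%:E = 1.
Proof. by apply: (wprod1 Xs_iid) => //; [exact: uniq_prefixes|exact: nil_prefixes]. Qed.

(* Weaker than measurability with respect to the weights of the words of length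
   at most [n], but all that [freezing] uses. *)
Definition adapted n (f : Omega -> R) :=
  forall v, (n < size v)%N -> measurable_fun [set: away Xs v] (f : away Xs v -> R).

Definition adapted_set n (A : set Omega) :=
  forall v, (n < size v)%N -> measurable (A : set (away Xs v)).

Lemma weight_away u v : v \notin prefixes u ->
  measurable_fun [set: away Xs v] (weight u : away Xs v -> R).
Proof. by move=> vu; apply: measurable_wprod_away => //; exact: nil_prefixes. Qed.

Lemma adapted_weight n u : (size u <= n)%N -> adapted n (weight u).
Proof.
move=> un v nv; apply: weight_away; apply/negP => /size_mem_prefixes.
by rewrite leqNgt (leq_ltn_trans un nv).
Qed.

Lemma adapted_lt n f g : adapted n f -> adapted n g ->
  adapted_set n [set w | (f w < g w)%R].
Proof.
move=> af ag v nv; have := measurable_fun_ltr (af v nv) (ag v nv).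
by move=> /(_ measurableT [set true]); rewrite setTI; apply.
Qed.

Lemma adapted_indic n A : adapted_set n A -> adapted n (\1_A).
Proof. by move=> aA v nv; apply: measurable_indic; exact: aA. Qed.

Lemma long_word n : exists v : seq 'I_b, (n < size v)%N.
Proof. by exists (nseq n.+1 (Ordinal (ltnW hb))); rewrite size_nseq. Qed.

Lemma adapted_measurable n f : adapted n f -> measurable_fun setT f.
Proof. by move=> af; have [v nv] := long_word n; exact: measurable_fun_away (af v nv). Qed.

Lemma adapted_set_measurable n A : adapted_set n A -> measurable A.
Proof. by move=> aA; have [v nv] := long_word n; exact: measurable_away (aA v nv). Qed.

Lemma adapted_cst n c : adapted n (fun=> c).
Proof. by move=> v _; exact: measurable_cst. Qed.

Lemma measurable_weight u : measurable_fun setT (weight u).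
Proof. exact: measurable_wprod. Qed.

(** The weights of the letters beyond [p] have mean 1 and are independent of [Z] and of the shorter
    prefixes; they are integrated out from the last one. *)
Lemma weight_cat p s (Z : Omega -> R) : adapted (size p) Z -> (forall w, 0 <= Z w)%R ->
  \int[P]_w (weight (p ++ s) w * Z w)%:E = \int[P]_w (weight p w * Z w)%:E.
Proof.
move=> aZ Z0; elim/last_ind: s => [|s a IH]; first by rewrite cats0.
rewrite -IH -rcons_cat.
have v0 : rcons (p ++ s) a != [::] by rewrite -size_eq0 size_rcons.
rewrite -[RHS](freezing_mean Xs_iid X_ge0 Xs_ge0 X_mean v0).
- by apply: eq_integral => w _; rewrite weight_rcons mulrA.
- have sz : (size p <= size (p ++ s) < size (rcons (p ++ s) a))%N.
    by rewrite size_rcons ltnS leqnn andbT size_cat leq_addr.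
  apply: measurable_funM.
    apply: (@adapted_weight (size (p ++ s))) => //.
    by case/andP : sz.
  by apply: aZ; case/andP : sz => /leq_ltn_trans; apply.
- by move=> w; rewrite mulr_ge0// weight_ge0.
Qed.

(* The mass of the cylinder [p] under the m-th approximation of the cascade of
   a measure giving mass [N v] to the cylinder of [v]. *)
Definition mass m p w : R :=
  (\sum_(v : m.-tuple 'I_b | take (size p) v == p) weight v w * N v)%R.

Lemma mass_ge0 m p w : (0 <= mass m p w)%R.
Proof. by apply: sumr_ge0 => v _; rewrite mulr_ge0 ?weight_ge0. Qed.

Lemma adapted_mass m p : adapted m (mass m p).
Proof.
move=> v mv; rewrite /mass; under eq_fun do rewrite -big_filter.
apply: (@measurable_sum _ (away Xs v)) => u; apply: measurable_funM => //.
by apply: (@adapted_weight m) => //; rewrite size_tuple.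
Qed.

Lemma integral_mass m p (Z : Omega -> R) : measurable_fun setT Z -> (forall w, 0 <= Z w)%R ->
  \int[P]_w (mass m p w * Z w)%:E =
  \sum_(v : m.-tuple 'I_b | take (size p) v == p) (N v)%:E * \int[P]_w (weight v w * Z w)%:E.
Proof.
move=> mZ Z0.
transitivity (\int[P]_w (\sum_(v : m.-tuple 'I_b | take (size p) v == p)
   ((N v)%:E * (weight v w * Z w)%:E))).
  apply: eq_integral => w _; rewrite /mass mulr_suml -sumEFin.
  by apply: eq_bigr => v _; rewrite -EFinM mulrAC mulrC.
under eq_integral do rewrite -big_filter.
rewrite ge0_integral_sum//.
- rewrite big_filter; apply: eq_bigr => v _; rewrite ge0_integralZl//.
  + by apply/measurable_EFinP/measurable_funM => //; exact: measurable_weight.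
  + by move=> w _; rewrite lee_fin mulr_ge0 ?weight_ge0.
  + by rewrite lee_fin.
- move=> v; apply: emeasurable_funM => //.
  by apply/measurable_EFinP/measurable_funM => //; exact: measurable_weight.
- by move=> v w _; rewrite -EFinM lee_fin !mulr_ge0 ?weight_ge0.
Qed.

Lemma mass_mean m p (Z : Omega -> R) : (size p <= m)%N ->
  adapted (size p) Z -> (forall w, 0 <= Z w)%R ->
  \int[P]_w (mass m p w * Z w)%:E = (N p)%:E * \int[P]_w (weight p w * Z w)%:E.
Proof.
move=> pm aZ Z0; rewrite integral_mass//; last exact: adapted_measurable aZ.
rewrite (eq_bigr (fun v : m.-tuple 'I_b => (N v)%:E * \int[P]_w (weight p w * Z w)%:E)).
  rewrite -ge0_sume_distrl; last by move=> v _; rewrite lee_fin.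
  by rewrite sumEFin N_sum.
move=> v /eqP vp; rewrite -[tval v](cat_take_drop (size p)) vp.
by rewrite weight_cat.
Qed.

(* The weights of the prefixes of [u] stay below the barrier exp (c k + L). *)
Definition good c L u : set Omega := ~` escape Xs c L (prefixes u).

Lemma goodP c L u w : good c L u w <->
  forall k, (k <= size u)%N -> (weight (take k u) w <= expR (c * k%:R + L))%R.
Proof.
rewrite /good /escape /weight; split=> [h k ku|h [k /= ku]].
  rewrite leNgt; apply/negP => hlt; apply: h; exists k; first by rewrite /= size_prefixes ltnS.
  by rewrite /= take_prefixes.
rewrite size_prefixes ltnS in ku; rewrite take_prefixes.
by apply/negP; rewrite -leNgt; exact: h.
Qed.

Lemma adapted_good c L u : adapted_set (size u) (good c L u).
Proof.
move=> v uv; apply: measurableC; apply: bigcup_measurable => k _.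
apply: (@adapted_lt (size u) (fun=> _) (wprod Xs (take k (prefixes u))) _ _ v uv).
  exact: adapted_cst.
by rewrite take_prefixes; apply: adapted_weight; rewrite size_take_min geq_minr.
Qed.

Lemma measurable_good c L u : measurable (good c L u).
Proof. exact: adapted_set_measurable (@adapted_good c L u). Qed.

(* Integrating out the letters of the first word beyond its longest common prefix
   with [u] leaves the weight of that prefix, which the barrier bounds. *)
Lemma weight_pair c L u j s : (j <= size u)%N ->
  exists k, [/\ (j <= k)%N, (k <= size (take j u ++ s))%N, (k <= size u)%N,
     take k (take j u ++ s) = take k u &
  \int[P]_w (weight (take j u ++ s) w * (weight u w * \1_(good c L u) w))%:E
    <= (expR (c * k%:R + L))%:E].
Proof.
move=> ju.
have base v : v = take (size v) u -> (size v <= size u)%N ->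
  \int[P]_w (weight v w * (weight u w * \1_(good c L u) w))%:E
    <= (expR (c * (size v)%:R + L))%:E.
  move=> vu su; rewrite -[leRHS]mule1 -(weight1 u) -ge0_integralZl_EFin ?expR_ge0//; last 2 first.
  - by move=> w _; rewrite lee_fin weight_ge0.
  - apply/measurable_EFinP; exact: measurable_weight.
  apply: ge0_le_integral => //.
  - by move=> w _; rewrite lee_fin !mulr_ge0 ?weight_ge0.
  - apply/measurable_EFinP/measurable_funM; first exact: measurable_weight.
    apply: measurable_funM; first exact: measurable_weight.
    by apply: measurable_indic; exact: measurable_good.
  - apply: emeasurable_funM => //; apply/measurable_EFinP; exact: measurable_weight.
  - move=> w _; rewrite lee_fin.
    have [/set_mem/goodP g|/negPf wg] := boolP (w \in good c L u); last first.
      by rewrite indicE wg !mulr0 mulr_ge0 ?expR_ge0 ?weight_ge0.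
    rewrite indicE mem_set ?mulr1; last exact/goodP.
    by rewrite ler_wpM2r ?weight_ge0// {1}vu g.
elim/last_ind: s => [|s a [k [jk ks ku E IH]]].
  exists j; split => //; rewrite ?cats0 ?take_takel ?size_takel//.
  have := base (take j u); rewrite size_takel//; exact.
set v' := rcons (take j u ++ s) a.
have -> : take j u ++ rcons s a = v' by rewrite /v' -rcons_cat.
have sv' : size v' = (size (take j u ++ s)).+1 by rewrite size_rcons.
(* A new letter either extends the common prefix, and the barrier at its level applies directly, or
   brings a weight found nowhere else in the integrand, which integrates to 1. *)
have [/prefixesP[i [i0 iu vE]]|nv] := boolP (v' \in prefixes u).
  have iE : i = size v' by rewrite vE size_takel.
  exists (size v'); split => //.
  - by rewrite sv' (leq_trans jk)// (leq_trans ks).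
  - by rewrite -iE.
  - by rewrite take_size -iE -vE.
  - by apply: base; rewrite -iE.
exists k; split => //.
- by rewrite sv' (leq_trans ks).
- by rewrite /v' -cats1 takel_cat.
apply: le_trans IH.
have v'0 : v' != [::] by rewrite -size_eq0 sv'.
rewrite -[leRHS](freezing_mean Xs_iid X_ge0 Xs_ge0 X_mean v'0).
- by under eq_integral do rewrite weight_rcons -mulrA.
- apply: measurable_funM.
    by apply: (@adapted_weight (size (take j u ++ s))) => //; rewrite sv'.
  apply: measurable_funM; first exact: weight_away.
  apply: measurable_indic; apply: measurableC; apply: bigcup_measurable => i _.
  have mw : measurable_fun [set: away Xs v'] (wprod Xs (take i (prefixes u)) : away Xs v' -> R).
    apply: measurable_wprod_away; first by apply: contra nv; exact: mem_take.
    by apply/negP => /mem_take; apply/negP; exact: nil_prefixes.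
  have := measurable_fun_ltr (@measurable_cst _ _ (away Xs v') _ setT (expR (c * i%:R + L))) mw.
  by move=> /(_ measurableT [set true]); rewrite setTI; apply.
- by move=> w; rewrite !mulr_ge0 ?weight_ge0.
Qed.

Lemma geometric_tail (q : R) n m : (0 <= q < 1)%R ->
  (\sum_(n <= k < m) q ^+ k <= q ^+ n / (1 - q))%R.
Proof.
move=> /andP[q0 q1]; rewrite ler_pdivlMr ?subr_gt0//.
have [mn|nm] := leqP m n; first by rewrite big_geq// mul0r exprn_ge0.
rewrite mulrC mulr_sumr; under eq_bigr do rewrite mulrBl mul1r -exprS.
rewrite (@telescope_sumr_eq _ n m (fun k => - q ^+ k)%R) ?(ltnW nm)//.
  by rewrite opprK gerDr oppr_le0 exprn_ge0.
by move=> k _; rewrite opprK addrC.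
Qed.

(** A boolean test on a finite word, so that the points passing it up to a given level form a finite
    union of cylinders. *)
Definition spread (al C : R) u :=
  all (fun k => N (take k u) <= C * expR (- (al * k%:R)))%R (iota 0 (size u).+1).

(** For each [v], [weight_pair] gives a level at which [v] and [u] still agree. Summing over all
    such levels k >= n is an overcount, but lets the sums be exchanged: the [N v] with v|k = u|k add
    up to N(u|k). *)
Lemma spine_mass c L m n u : size u = m -> (n <= m)%N ->
  \int[P]_w (mass m (take n u) w * (weight u w * \1_(good c L u) w))%:E <=
  (\sum_(n <= k < m.+1) expR (c * k%:R + L) * N (take k u))%:E.
Proof.
move=> um nm; have sp : size (take n u) = n by rewrite size_takel// um.
have mg := measurable_good c L u.
rewrite integral_mass; last 2 first.
- by apply: measurable_funM; [exact: measurable_weight|exact: measurable_indic].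
- by move=> w; rewrite mulr_ge0 ?weight_ge0.
rewrite sp.
apply: (@le_trans _ _ (\sum_(v : m.-tuple 'I_b | take n v == take n u)
  (N v * \sum_(n <= k < m.+1 | take k v == take k u) expR (c * k%:R + L))%:E)).
  apply: lee_sum => v /eqP vu; rewrite EFinM lee_wpmul2l ?lee_fin//.
  have nu : (n <= size u)%N by rewrite um.
  have [k [nk km _ E]] := @weight_pair c L u n (drop n v) nu.
  have vE : take n u ++ drop n v = v by rewrite -vu cat_take_drop.
  rewrite vE in km E *; move=> /le_trans; apply; rewrite lee_fin.
  have kI : k \in index_iota n m.+1 by rewrite mem_index_iota nk ltnS -(size_tuple v).
  rewrite (big_rem k kI)/= E eqxx lerDl.
  by apply: sumr_ge0 => i _; exact: expR_ge0.
rewrite sumEFin lee_fin.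
under eq_bigr do rewrite big_mkcond mulr_sumr.
rewrite exchange_big /= [leLHS]big_nat_cond [leRHS]big_nat_cond.
apply: ler_sum => k /andP[/andP[nk km] _].
have su : size (take k u) = k by rewrite size_takel// um.
have km' : (size (take k u) <= m)%N by rewrite su.
rewrite -(N_sum km') su mulr_sumr [leLHS]big_mkcond [leRHS]big_mkcond.
apply: ler_sum => v _; case: ifPn => _; case: ifPn => _; rewrite ?mulr0//.
- by rewrite mulrC.
- by rewrite mulr_ge0 ?expR_ge0.
Qed.

(** Markov's inequality at [t]; under [spread] the k-th term of [spine_mass] is at most exp L times
    C exp ((c - al) k), a convergent geometric series. *)
Lemma spine_tail c L al C m n u t : (c < al)%R -> (0 <= C)%R -> (0 < t)%R ->
  size u = m -> (n <= m)%N -> spread al C u ->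
  \int[P]_w (weight u w * \1_(good c L u `&` [set w | t < mass m (take n u) w]%R) w)%:E <=
  (expR L * C / (1 - expR (c - al)) * expR (c - al) ^+ n / t)%:E.
Proof.
move=> cal C0 t0 um nm /allP sE.
have mg := measurable_good c L u.
have mY := adapted_measurable (@adapted_mass m (take n u)).
have mt : measurable [set w | t < mass m (take n u) w]%R.
  by apply: (@adapted_set_measurable m); apply: adapted_lt;
    [exact: adapted_cst|exact: adapted_mass].
apply: (@le_trans _ _ ((t^-1)%:E *
  \int[P]_w (mass m (take n u) w * (weight u w * \1_(good c L u) w))%:E)).
  rewrite -ge0_integralZl_EFin ?invr_ge0 ?(ltW t0)//; last 2 first.
  - by move=> w _; rewrite lee_fin !mulr_ge0 ?weight_ge0 ?mass_ge0.
  - apply/measurable_EFinP; apply: measurable_funM => //.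
    by apply: measurable_funM; [exact: measurable_weight|exact: measurable_indic].
  apply: ge0_le_integral => //.
  - by move=> w _; rewrite lee_fin !mulr_ge0 ?weight_ge0.
  - apply/measurable_EFinP/measurable_funM; first exact: measurable_weight.
    by apply: measurable_indic; exact: measurableI.
  - apply: emeasurable_funM => //; apply/measurable_EFinP/measurable_funM => //.
    by apply: measurable_funM; [exact: measurable_weight|exact: measurable_indic].
  - move=> w _; rewrite -EFinM lee_fin.
    rewrite [leRHS](_ : _ = weight u w * ((t^-1 * mass m (take n u) w) * \1_(good c L u) w))%R;
      last by ring.
    rewrite ler_wpM2l ?weight_ge0//.
    rewrite indicI /= mulrC; apply: ler_pM => //.
    rewrite indicE; have [/set_mem /= h|_] := boolP (w \in _).
      by rewrite mulrC ler_pdivlMr// mul1r ltW.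
    by rewrite mulr_ge0 ?mass_ge0// invr_ge0 ltW.
rewrite [leRHS]EFinM muleC lee_pmul2r// ?lte_fin ?invr_gt0//.
apply: (le_trans (spine_mass c L um nm)); rewrite lee_fin.
have q01 : (0 <= expR (c - al) < 1)%R.
  by rewrite expR_ge0/= -[ltRHS]expR0 ltr_expR subr_lt0.
apply: (@le_trans _ _ (\sum_(n <= k < m.+1) expR L * C * expR (c - al) ^+ k)%R).
  rewrite [leLHS]big_nat_cond [leRHS]big_nat_cond.
  apply: ler_sum => k /andP[/andP[_ km] _].
  have /sE h : k \in iota 0 (size u).+1 by rewrite mem_iota um.
  apply: (le_trans (ler_wpM2l (expR_ge0 _) h)).
  rewrite -expRM_natl (mulrC (expR L)) -mulrA -expRD mulrCA -expRD.
  by rewrite (_ : c * k%:R + L + - (al * k%:R) = L + k%:R * (c - al))%R//; ring.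
rewrite -mulr_sumr -[leRHS]mulrA ler_wpM2l ?mulr_ge0 ?expR_ge0//.
by rewrite mulrC; exact: geometric_tail.
Qed.

End tree.

(** * Functions and sets depending on finitely many letters *)

Section cylinders.
Context (R : realType) (b : nat) (hb : (1 < b)%N).
Local Notation S := (seqspace R hb).
Implicit Types (x y : S) (u v p : seq 'I_b) (mu : {measure set S -> \bar R}).

Lemma size_restr x n : size (restr x n) = n.
Proof. by rewrite size_mkseq. Qed.

Lemma take_restr x k n : (k <= n)%N -> take k (restr x n) = restr x k.
Proof.
by move=> kn; rewrite /restr /mkseq -map_take take_iota; move/minn_idPl : kn => ->.
Qed.

Lemma restr_eq x y n : (forall k, (k < n)%N -> x k = y k) -> restr x n = restr y n.
Proof. by move=> xy; apply/eq_in_map => k; rewrite mem_iota add0n => /xy. Qed.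

(** A ball of radius exp (- (n + 1)) lies in a cylinder of length n, so functions of the first n
    letters are continuous and the sets they define are Borel. *)
Lemma near_restr x n : \forall y \near x, restr (y : S) n = restr x n.
Proof.
apply/nbhs_ballP; exists (expR (- n.+1%:R)) => /=; first exact: expR_gt0.
move=> y; rewrite ballEmdist /= => /ltW /seqdist_leP xy.
by apply/esym/restr_eq.
Qed.

Lemma open_level (D : set (seq 'I_b)) n : open [set x : S | D (restr x n)].
Proof.
rewrite openE => x Dx.
have this : nbhs x [set y : S | restr y n = restr x n] by exact: near_restr.
suff : nbhs x [set y : S | D (restr y n)] by [].
move: this; apply: filterS => y /= ->; exact: Dx.
Qed.

Lemma measurable_level (D : set (seq 'I_b)) n : measurable [set x : S | D (restr x n)].
Proof. by apply: sub_sigma_algebra; exact: open_level. Qed.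

Lemma measurable_cylinder u : measurable (@cylinder R b hb u).
Proof. exact: (@measurable_level (fun v => v = u)). Qed.

Lemma continuous_level (F : seq 'I_b -> R) n : continuous (fun x : S => F (restr x n)).
Proof.
move=> x; apply: (@cvg_near_cst _ _ (F (restr x n)) (fun y : S => F (restr y n)) (nbhs x)).
have : nbhs x [set y : S | restr y n = restr x n] by exact: near_restr.
by apply: (@filterS S (nbhs x) _ [set y : S | restr y n = restr x n]) => y /= ->.
Qed.

Lemma integral_level mu (F : seq 'I_b -> R) m : (forall u, 0 <= F u)%R ->
  \int[mu]_x (F (restr x m))%:E =
  \sum_(v : m.-tuple 'I_b) (F v)%:E * mu (@cylinder R b hb v).
Proof.
move=> F0; have mc := measurable_cylinder.
transitivity (\int[mu]_x \sum_(v : m.-tuple 'I_b) ((F v)%:E * (\1_(@cylinder R b hb v) x)%:E)).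
  apply: eq_integral => x _.
  have sx : size (restr x m) == m by rewrite size_restr.
  rewrite (bigD1 (Tuple sx))//= big1 ?adde0.
    by rewrite indicE mem_set ?mule1// /cylinder /= size_restr.
  move=> v vx; rewrite indicE memNset ?mule0// /cylinder /= size_tuple => xv.
  by move/eqP : vx; apply; apply: val_inj.
rewrite ge0_integral_sum//.
- apply: eq_bigr => v _; rewrite ge0_integralZl_EFin//.
    by rewrite integral_indic// setIT.
  by apply/measurable_EFinP; exact: measurable_indic.
- move=> v; apply: emeasurable_funM => //.
  by apply/measurable_EFinP; exact: measurable_indic.
- by move=> v x _; rewrite mule_ge0 ?lee_fin.
Qed.

Lemma measure_level mu (D : pred (seq 'I_b)) m :
  mu [set x : S | D (restr x m)] = \sum_(v : m.-tuple 'I_b | D v) mu (@cylinder R b hb v).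
Proof.
have mD := @measurable_level D m.
rewrite -[X in mu X]setIT -integral_indic//.
have E := @integral_level mu (fun u => (D u)%:R) m (fun u => ler0n _ _).
rewrite [RHS]big_mkcond.
transitivity (\int[mu]_x ((D (restr x m))%:R)%:E).
  apply: eq_integral => x _; rewrite indicE; congr ((nat_of_bool _)%:R%:E).
  by apply/idP/idP; rewrite inE.
by rewrite E; apply: eq_bigr => v _; case: (D v); rewrite ?mul1e ?mul0e.
Qed.

Section prob.
Variable nu : probability S R.

Definition cylmass u : R := fine (nu (@cylinder R b hb u)).

Lemma cylmassE u : (cylmass u)%:E = nu (@cylinder R b hb u).
Proof.
by rewrite fineK// fin_num_measure//; exact: measurable_cylinder.
Qed.

Lemma cylmass_ge0 u : (0 <= cylmass u)%R.
Proof. exact: fine_ge0. Qed.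

Lemma cylmass_sum m p : (size p <= m)%N ->
  (\sum_(v : m.-tuple 'I_b | take (size p) v == p) cylmass v)%R = cylmass p.
Proof.
move=> pm; apply: EFin_inj; rewrite cylmassE -sumEFin.
under eq_bigr do rewrite cylmassE.
rewrite -(measure_level nu (fun v => take (size p) v == p)).
congr (nu _); apply/seteqP; split => x /=; rewrite take_restr//.
  by move/eqP.
by move=> ->; rewrite eqxx.
Qed.

Lemma cylmass_nil : cylmass [::] = 1%R.
Proof.
apply: EFin_inj; rewrite cylmassE -(@probability_setT _ _ _ nu); congr (nu _).
by apply/seteqP; split => x.
Qed.

End prob.
End cylinders.

Section cascade_limit.
Context (R : realType) (b : nat) (hb : (1 < b)%N) (d : measure_display)
  (Omega : measurableType d) (P : probability Omega R) (Xs : seq 'I_b -> {RV P >-> R})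
  (nu : probability (seqspace R hb) R) (Qnu : R.-ftker Omega ~> seqspace R hb).
Hypothesis Xs_ge0 : forall u w, (0 <= Xs u w)%R.
Local Notation S := (seqspace R hb).

Lemma cascade_densityE n w (x : S) : cascade_density Xs n w x = weight Xs (restr x n) w.
Proof.
rewrite /cascade_density /weight /wprod /prefixes big_map size_restr.
rewrite /index_iota subn1 /= big_seq [RHS]big_seq; apply: eq_bigr => k.
by rewrite mem_iota add1n ltnS => /andP[_ kn]; rewrite take_restr.
Qed.

Lemma integral_cascade m p w : (size p <= m)%N ->
  \int[nu]_x (\1_(@cylinder R b hb p) x * cascade_density Xs m w x)%:E =
  (mass Xs (cylmass nu) m p w)%:E.
Proof.
move=> pm.
pose F v := ((take (size p) v == p)%:R * weight Xs v w)%R.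
transitivity (\int[nu]_x (F (restr x m))%:E).
  apply: eq_integral => x _; rewrite cascade_densityE /F take_restr// indicE.
  congr ((nat_of_bool _)%:R * _)%:E.
  apply/idP/eqP; first by rewrite inE.
  by move=> h; rewrite inE.
rewrite integral_level; last by move=> u; rewrite mulr_ge0 ?weight_ge0.
rewrite /mass -sumEFin [RHS]big_mkcond; apply: eq_bigr => v _.
transitivity ((F v)%:E * (cylmass nu v)%:E); first by rewrite cylmassE.
by rewrite /F; case: ifPn => _; rewrite ?mul0r ?mul0e// mul1r EFinM.
Qed.

(** Cylinders are open and closed, so their indicators are admissible test functions; one null set
    of [w] serves all words. *)
Lemma cascade_limit : is_cascade_measure Xs nu Qnu ->
  {ae P, forall w, forall p,
    (mass Xs (cylmass nu) n p w)%:E @[n --> \oo] --> Qnu w (@cylinder R b hb p)}.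
Proof.
apply: filterS => w H p.
have mp := @measurable_cylinder R b hb p.
have := H (\1_(@cylinder R b hb p)); rewrite integral_indic// setIT.
move=> h; apply: cvg_trans (h _ _).
- apply: near_eq_cvg; near=> n.
  by rewrite integral_cascade//; near: n; exact: nbhs_infty_ge.
- have -> : \1_(@cylinder R b hb p) = (fun x : S => (restr x (size p) == p)%:R) :> (S -> R).
    apply/funext => x; rewrite indicE; congr ((nat_of_bool _)%:R).
    by apply/idP/eqP; [rewrite inE|move=> ?; rewrite inE].
  exact: (@continuous_level _ _ _ (fun u => (u == p)%:R)).
- exists 1%R; split => // M M1 x _ /=.
  rewrite ger0_norm// indicE (le_trans _ (ltW M1))//.
  by case: (_ \in _).
Unshelve. all: by end_near. Qed.

End cascade_limit.

(** * Passing to the limit measure *)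

Lemma measurable_fun_limn_einf d (T : measurableType d) (R : realType)
    (f : (T -> \bar R)^nat) : (forall n, measurable_fun setT (f n)) ->
  measurable_fun setT (fun x => limn_einf (f^~ x)).
Proof.
move=> mf; apply: measurableT_comp; first exact: oppe_measurable.
by apply: measurable_fun_limn_esup => n; apply: measurableT_comp.
Qed.

Section random_measure.
Context (R : realType) (b : nat) (hb : (1 < b)%N).
Context (d : measure_display) (Omega : measurableType d)
  (P : probability Omega R) (Xs : seq 'I_b -> {RV P >-> R})
  (d0 : measure_display) (T0 : measurableType d0) (P0 : probability T0 R)
  (X : {RV P0 >-> R}).
Local Notation S := (seqspace R hb).
Local Notation cyl u := (@cylinder R b hb u).
Context (nu : probability S R) (Qnu : R.-ftker Omega ~> S).
Hypothesis Xs_iid : iid_copies Xs X.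
Hypothesis X_ge0 : forall t, (0 <= X t)%R.
Hypothesis Xs_ge0 : forall u w, (0 <= Xs u w)%R.
Hypothesis X_mean : \int[P0]_t (X t)%:E = 1.
Hypothesis Qnu_cascade : is_cascade_measure Xs nu Qnu.
Implicit Types (u v p : seq 'I_b).
Local Notation N := (cylmass nu).

Let mcyl u : measurable (cyl u) := @measurable_cylinder R b hb u.
Let mQ A : measurable A -> measurable_fun setT (fun w => Qnu w A) :=
  @measurable_kernel _ _ _ _ _ Qnu A.
Let N0 u : (0 <= N u)%R := cylmass_ge0 nu u.
Let Nsum := @cylmass_sum R b hb nu.

(* An inequality only: Fatou's lemma for the martingale of approximations. It is
   all that is needed to pass from spine estimates to the limit measure. *)
Lemma kernel_cylinder_le p (Z : Omega -> R) : adapted Xs (size p) Z ->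
  (forall w, 0 <= Z w)%R ->
  \int[P]_w (Qnu w (cyl p) * (Z w)%:E) <=
  (N p)%:E * \int[P]_w (weight Xs p w * Z w)%:E.
Proof.
move=> aZ Z0.
have mZ := adapted_measurable hb aZ.
(* The shift keeps the stage at least [size p], as [mass_mean] requires. *)
pose f n w := (mass Xs N (n + size p)%N p w * Z w)%:E.
have mf n : measurable_fun setT (f n).
  apply/measurable_EFinP; apply: measurable_funM => //.
  exact: (adapted_measurable hb (@adapted_mass _ _ _ _ _ Xs N _ _)).
have f0 n w : 0 <= f n w by rewrite lee_fin mulr_ge0// mass_ge0.
apply: (@le_trans _ _ (\int[P]_w limn_einf (f^~ w))).
  apply: ae_ge0_le_integral => //.
  - by move=> w _; rewrite mule_ge0// lee_fin.
  - by apply: emeasurable_funM; [exact: mQ|exact/measurable_EFinP].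
  - move=> w _; rewrite limn_einf_lim; apply: lime_ge; first exact: is_cvg_einfs.
    by apply: nearW => n; apply/ereal_infP => _ [k _ <-].
  - by apply: measurable_fun_limn_einf.
  - have := cascade_limit Xs_ge0 Qnu_cascade.
    apply: filterS => w /(_ p) cv _.
    suff -> : limn_einf (f^~ w) = Qnu w (cyl p) * (Z w)%:E by [].
    apply: (cvg_limn_einf_sup _).1.
    rewrite /f; under eq_fun do rewrite EFinM.
    apply: cvgeZr => //.
    by move: cv; rewrite -(cvg_shiftn (size p)).
apply: (le_trans (fatou P measurableT mf (fun n w _ => f0 n w))).
under [X in limn_einf X]eq_fun.
  move=> n; rewrite /f (mass_mean Xs_iid X_ge0 Xs_ge0 X_mean hb N0 Nsum)//; last exact: leq_addl.
  over.
by rewrite (cvg_limn_einf_sup (@cvg_cst _ _ _ _ _)).1.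
Qed.

Definition level m (A : seq 'I_b -> set Omega) (w : Omega) : set S :=
  [set x | A (restr x m) w].

(* The measure of [level m A] under the spine measure Q_m(w,x) P(dw) nu(dx). *)
Definition level_weight m (A : seq 'I_b -> set Omega) : \bar R :=
  \sum_(u : m.-tuple 'I_b) (N u)%:E * \int[P]_w (weight Xs u w * \1_(A u) w)%:E.

Lemma measurable_level_set m A w : measurable (level m A w).
Proof. exact: (@measurable_level _ _ _ (fun u => A u w)). Qed.

Lemma kernel_levelE m A w :
  Qnu w (level m A w) = \sum_(u : m.-tuple 'I_b) Qnu w (cyl u) * (\1_(A u) w)%:E.
Proof.
have -> : level m A w = [set x | (w \in A (restr x m))].
  by apply/seteqP; split => x; rewrite /level /= inE.
rewrite (measure_level (Qnu w) (fun u => w \in A u)) big_mkcond.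
by apply: eq_bigr => u _; rewrite indicE; case: (w \in A u); rewrite ?mule1 ?mule0.
Qed.

Lemma measurable_kernel_level m A : (forall u, size u = m -> measurable (A u)) ->
  measurable_fun setT (fun w => Qnu w (level m A w)).
Proof.
move=> mA; under eq_fun do rewrite kernel_levelE.
apply: emeasurable_sum => u; apply: emeasurable_funM; first exact: mQ.
by apply/measurable_EFinP/measurable_indic/mA; rewrite size_tuple.
Qed.

Lemma kernel_level_le m A : (forall u, size u = m -> adapted_set Xs m (A u)) ->
  \int[P]_w Qnu w (level m A w) <= level_weight m A.
Proof.
move=> aA.
have mA u : size u = m -> measurable (A u).
  by move=> um; exact: (adapted_set_measurable hb (aA u um)).
under eq_integral do rewrite kernel_levelE.
rewrite ge0_integral_sum//; last first.
  move=> u; apply: emeasurable_funM; first exact: mQ.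
  by apply/measurable_EFinP/measurable_indic/mA; rewrite size_tuple.
apply: lee_sum => u _; apply: kernel_cylinder_le => //.
by apply: adapted_indic; rewrite size_tuple; apply: aA; rewrite size_tuple.
Qed.

(** On such sets a nu-null set is almost surely Q.nu-null. The property is proved for finite unions
    of cylinders of one length and kept by monotone limits, which reaches every set of points
    transferred below. *)
Definition dominated A :=
  measurable A /\ \int[P]_w Qnu w A <= nu A.

Lemma dominated_level (D : pred (seq 'I_b)) m : dominated [set x : S | D (restr x m)].
Proof.
split; first exact: (@measurable_level R b hb (fun u => D u) m).
pose A u : set Omega := if D u then setT else set0.
have -> : \int[P]_w Qnu w [set x : S | D (restr x m)] = \int[P]_w Qnu w (level m A w).
  apply: eq_integral => w _; congr (Qnu w _).
  by apply/seteqP; split => x; rewrite /level /A /=; case: ifPn.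
apply: (@le_trans _ _ (level_weight m A)).
  by apply: kernel_level_le => u _ v _; rewrite /A; case: ifPn.
rewrite (measure_level nu D) big_mkcond; apply: lee_sum => u _.
rewrite /A; case: ifPn => Du.
  under eq_integral do rewrite indicT mulr1.
  by rewrite (weight1 Xs_iid)// mule1 cylmassE.
by under eq_integral do rewrite indic0 mulr0; rewrite integral0 mule0.
Qed.

Lemma kernel_finite w : Qnu w setT < +oo.
Proof. by rewrite -ge0_fin_numE//; exact: (kernel_finite_transition w). Qed.

Lemma dominated_bigcup (F : (set S)^nat) : nondecreasing_seq F ->
  (forall n, dominated (F n)) -> dominated (\bigcup_n F n).
Proof.
move=> ndF dF; have mF n : measurable (F n) := (dF n).1.
have mU : measurable (\bigcup_n F n) by exact: bigcup_measurable.
split => //.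
have H : \int[P]_w Qnu w (F n) @[n --> \oo] --> \int[P]_w Qnu w (\bigcup_n F n).
  rewrite (_ : \int[P]_w Qnu w (\bigcup_n F n) = \int[P]_w limn (fun n => Qnu w (F n))); last first.
    apply: eq_integral => w _; apply/esym/cvg_lim => //.
    exact: nondecreasing_cvg_mu.
  apply: cvg_monotone_convergence => //.
  - by move=> n; exact: mQ.
  - move=> w _ m n mn; apply: le_measure; rewrite ?inE//.
    by apply/subsetPset; exact: ndF.
rewrite -(cvg_lim _ H)//; apply: lime_le; first exact: cvgP H.
apply: nearW => n; apply: (le_trans (dF n).2).
by apply: le_measure; rewrite ?inE//; exact: bigcup_sup.
Qed.

Lemma dominated_bigcap (F : (set S)^nat) : nonincreasing_seq F ->
  (forall n, dominated (F n)) -> dominated (\bigcap_n F n).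
Proof.
move=> niF dF; have mF n : measurable (F n) := (dF n).1.
have mI : measurable (\bigcap_n F n) by exact: bigcap_measurable.
split => //.
have H : nu (F n) @[n --> \oo] --> nu (\bigcap_n F n).
  apply: nonincreasing_cvg_mu => //.
  by rewrite (le_lt_trans (probability_le1 _ _)) ?ltry.
rewrite -(cvg_lim _ H)//; apply: lime_ge; first exact: cvgP H.
apply: nearW => n; apply: le_trans (dF n).2.
apply: ge0_le_integral => //.
- exact: mQ.
- exact: mQ.
- by move=> w _; apply: le_measure; rewrite ?inE//; exact: bigcap_inf.
Qed.

Lemma dominated_null A : dominated A -> nu A = 0 -> {ae P, forall w, Qnu w A = 0}.
Proof.
move=> [mA dA] A0.
have : \int[P]_w `|Qnu w A| = 0.
  apply/eqP; rewrite eq_le integral_ge0// andbT.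
  by under eq_integral do rewrite gee0_abs//; rewrite -A0.
move/(ae_eq_integral_abs P measurableT (mQ mA)).
by apply: filterS => w /(_ I).
Qed.

(** The means of the majorants [g] are summable, so for almost every [w] their sum is finite and
    Borel-Cantelli applies to [Qnu w]. Measurability in [w] is asked of [g] only, because below
    [E n w] may be a lower limit of sets or depend on [Qnu w] itself. *)
Lemma kernel_borel_cantelli (E : nat -> Omega -> set S) (g : nat -> Omega -> \bar R) (C r : R) :
  (forall n w, measurable (E n w)) ->
  (forall n, measurable_fun setT (g n)) -> (forall n w, 0 <= g n w) ->
  (forall n w, Qnu w (E n w) <= g n w) ->
  (0 <= r < 1)%R -> (forall n, \int[P]_w g n w <= (C * r ^+ n)%:E) ->
  {ae P, forall w, Qnu w (lim_sup_set (E ^~ w)) = 0}.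
Proof.
move=> mE mg g0 Eg r01 Ig.
have mS : measurable_fun setT (fun w => \sum_(n <oo) g n w).
  by apply: ge0_emeasurable_sum => // n _.
have S0 w : 0 <= \sum_(n <oo) g n w by exact: nneseries_ge0.
have iS : P.-integrable setT (fun w => \sum_(n <oo) g n w).
  apply/integrableP; split => //.
  under eq_integral do rewrite gee0_abs//.
  rewrite integral_nneseries//.
  apply: (@le_lt_trans _ _ (`|C| / (1 - r))%:E); last exact: ltry.
  apply: lime_le.
    by apply: is_cvg_nneseries => n _ _; exact: integral_ge0.
  apply: nearW => n; apply: (@le_trans _ _ (\sum_(0 <= i < n) (`|C| * r ^+ i))%R%:E).
    rewrite -sumEFin; apply: lee_sum => i _; apply: (le_trans (Ig i)).
    by rewrite lee_fin ler_wpM2r ?ler_norm// exprn_ge0//; case/andP: r01.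
  rewrite lee_fin -mulr_sumr ler_wpM2l//.
  by have := geometric_tail 0 n r01; rewrite expr0 div1r.
have := integrable_ae measurableT iS.
apply: filterS => w /(_ I) fw.
apply: lim_sup_set_cvg0 => //.
rewrite (@le_lt_trans _ _ (\sum_(n <oo) g n w))//; last by rewrite ltey_eq fw.
by apply: lee_nneseries => // n _.
Qed.

Lemma level_borel_cantelli (A : seq 'I_b -> set Omega) (C r : R) :
  (forall u, adapted_set Xs (size u) (A u)) ->
  (0 <= r < 1)%R -> (forall n, level_weight n A <= (C * r ^+ n)%:E) ->
  {ae P, forall w, Qnu w (lim_sup_set (fun n => level n A w)) = 0}.
Proof.
move=> aA r01 H.
apply: (@kernel_borel_cantelli _ (fun n w => Qnu w (level n A w)) C r) => //.
- by move=> n w; exact: measurable_level_set.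
- move=> n; apply: measurable_kernel_level => u un.
  exact: (adapted_set_measurable hb (aA u)).
- move=> n; apply: le_trans (H n); apply: kernel_level_le => u <-; exact: aA.
Qed.

End random_measure.

(** * Local dimensions *)

Section limits.
Context (R : realType).
Implicit Types (u : (\bar R)^nat) (a x : \bar R).

Lemma limn_einfE u : limn_einf u = ereal_sup (range (einfs u)).
Proof. by rewrite limn_einf_lim; apply/cvg_lim => //; exact: cvg_einfs_sup. Qed.

Lemma limn_einf_gt u a : a < limn_einf u -> exists n0, forall n, (n0 <= n)%N -> a < u n.
Proof.
rewrite limn_einfE => /ereal_sup_gt[_ [n0 _ <-] h]; exists n0 => n n0n.
by apply: (lt_le_trans h); apply: ereal_inf_lbound; exists n.
Qed.

Lemma limn_einf_ge u a : (exists n0, forall n, (n0 <= n)%N -> a <= u n) -> a <= limn_einf u.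
Proof.
move=> [n0 h]; rewrite limn_einfE; apply: (@le_trans _ _ (einfs u n0)).
  by apply/ereal_infP => _ [k /= n0k <-]; exact: h.
by apply: ereal_sup_ubound; exists n0.
Qed.

Lemma limn_einf_lt u a : limn_einf u < a ->
  forall n0, exists2 n, (n0 <= n)%N & u n < a.
Proof.
move=> h n0; apply: contrapT => /forall2NP H.
have : a <= limn_einf u.
  apply: limn_einf_ge; exists n0 => n n0n; rewrite leNgt; apply/negP => un.
  by case: (H n).
by rewrite leNgt h.
Qed.

Lemma limn_esup_lt u a : limn_esup u < a -> exists n0, forall n, (n0 <= n)%N -> u n < a.
Proof.
move=> h; have := @limn_einf_gt (-%E \o u) (- a).
rewrite limn_einfN lteN2 => /(_ h)[n0 H]; exists n0 => n /H.
by rewrite /= lteN2.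
Qed.

Lemma limn_esup_le u a : (exists n0, forall n, (n0 <= n)%N -> u n <= a) -> limn_esup u <= a.
Proof.
move=> [n0 h]; rewrite -leeN2 -limn_einfN; apply: limn_einf_ge; exists n0 => n /h.
by rewrite /= leeN2.
Qed.

Lemma rate_ge (a : R) n x : (0 < n)%N -> 0 <= x ->
  (a%:E <= (n%:R^-1)%:E * - lne x) = (x <= (expR (- (a * n%:R)))%:E).
Proof.
move=> n0 x0; rewrite lee_pdivlMl ?ltr0n// -EFinM leeNr -EFinN mulrC.
rewrite -[in RHS](@lee_lne R)//; last 2 first.
- by rewrite in_itv/= leey x0.
- by rewrite in_itv/= leey lee_fin expR_ge0.
by rewrite lne_EFin ?expR_gt0// expRK.
Qed.

Lemma rate_le (a : R) n x : (0 < n)%N -> 0 <= x ->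
  ((n%:R^-1)%:E * - lne x <= a%:E) = ((expR (- (a * n%:R)))%:E <= x).
Proof.
move=> n0 x0; rewrite lee_pdivrMl ?ltr0n// -EFinM leeNl -EFinN mulrC.
rewrite -[in RHS](@lee_lne R)//; last 2 first.
- by rewrite in_itv/= leey lee_fin expR_ge0.
- by rewrite in_itv/= leey x0.
by rewrite lne_EFin ?expR_gt0// expRK.
Qed.

End limits.

Section local_dimension_rates.
Context (R : realType) (b : nat) (hb : (1 < b)%N).
Local Notation S := (seqspace R hb).
Local Notation cyl u := (@cylinder R b hb u).
Implicit Types (mu : {measure set S -> \bar R}) (x : S).

Lemma lower_dim_loc_gt mu x (a : R) : a%:E < lower_dim_loc mu x ->
  exists n0, forall n, (n0 <= n)%N -> mu (cyl (restr x n)) <= (expR (- (a * n%:R)))%:E.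
Proof.
move=> /limn_einf_gt[n0 H]; exists n0.+1 => n n0n.
(* Starting at [n0.+1] avoids n = 0, where the rate is 0 whatever the mass. *)
have n_gt0 : (0 < n)%N by exact: leq_trans n0n.
by rewrite -rate_ge// ltW// H// ltnW.
Qed.

Lemma lower_dim_loc_ge mu x (a : R) :
  (exists n0, forall n, (n0 <= n)%N -> mu (cyl (restr x n)) <= (expR (- (a * n%:R)))%:E) ->
  a%:E <= lower_dim_loc mu x.
Proof.
move=> [n0 H]; apply: limn_einf_ge; exists n0.+1 => n n0n.
have n_gt0 : (0 < n)%N by exact: leq_trans n0n.
by rewrite rate_ge//; apply: H; exact: ltnW.
Qed.

Lemma lower_dim_loc_lt mu x (a : R) : lower_dim_loc mu x < a%:E ->
  forall n0, exists2 n, (n0 <= n)%N & (expR (- (a * n%:R)))%:E <= mu (cyl (restr x n)).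
Proof.
move=> /limn_einf_lt H n0; have [n n0n h] := H n0.+1; exists n; first exact: ltnW.
have n_gt0 : (0 < n)%N by exact: leq_trans n0n.
by rewrite -rate_le// ltW.
Qed.

Lemma upper_dim_loc_lt mu x (a : R) : upper_dim_loc mu x < a%:E ->
  exists n0, forall n, (n0 <= n)%N -> (expR (- (a * n%:R)))%:E <= mu (cyl (restr x n)).
Proof.
move=> /limn_esup_lt[n0 H]; exists n0.+1 => n n0n.
have n_gt0 : (0 < n)%N by exact: leq_trans n0n.
by rewrite -rate_le// ltW// H// ltnW.
Qed.

Lemma upper_dim_loc_le mu x (a : R) :
  (exists n0, forall n, (n0 <= n)%N -> (expR (- (a * n%:R)))%:E <= mu (cyl (restr x n))) ->
  upper_dim_loc mu x <= a%:E.
Proof.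
move=> [n0 H]; apply: limn_esup_le; exists n0.+1 => n n0n.
have n_gt0 : (0 < n)%N by exact: leq_trans n0n.
by rewrite rate_le//; apply: H; exact: ltnW.
Qed.

Lemma lower_le_upper_dim_loc mu x : lower_dim_loc mu x <= upper_dim_loc mu x.
Proof. exact: limn_einf_sup. Qed.

End local_dimension_rates.

(** * Regularity *)

Section regularity.
Context (R : realType) (b : nat) (hb : (1 < b)%N).
Context (d : measure_display) (Omega : measurableType d)
  (P : probability Omega R) (Xs : seq 'I_b -> {RV P >-> R})
  (d0 : measure_display) (T0 : measurableType d0) (P0 : probability T0 R)
  (X : {RV P0 >-> R}).
Local Notation S := (seqspace R hb).
Local Notation cyl u := (@cylinder R b hb u).
Context (nu : probability S R) (Qnu : R.-ftker Omega ~> S).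
Hypothesis Xs_iid : iid_copies Xs X.
Hypothesis X_ge0 : forall t, (0 <= X t)%R.
Hypothesis Xs_ge0 : forall u w, (0 <= Xs u w)%R.
Hypothesis X_mean : \int[P0]_t (X t)%:E = 1.
Hypothesis Qnu_cascade : is_cascade_measure Xs nu Qnu.
Implicit Types (u v p : seq 'I_b) (x : S).
Local Notation N := (cylmass nu).

Let N0 u : (0 <= N u)%R := cylmass_ge0 nu u.
Let Nsum := @cylmass_sum R b hb nu.
Let w0 u w : (0 <= weight Xs u w)%R := weight_ge0 Xs_ge0 u w.

Lemma spreadP al C x n : spread N al C (restr x n) <->
  forall k, (k <= n)%N -> (N (restr x k) <= C * expR (- (al * k%:R)))%R.
Proof.
split=> [/allP h k kn|h].
  have := h k; rewrite mem_iota size_restr ltnS kn => /(_ isT).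
  by rewrite take_restr.
by apply/allP => k; rewrite mem_iota size_restr ltnS => /= kn; rewrite take_restr// h.
Qed.

Lemma spread_mono (al al' C C' : R) u : (al' <= al)%R -> (0 <= C)%R -> (C <= C')%R ->
  spread N al C u -> spread N al' C' u.
Proof.
move=> al_ C0 CC /allP h; apply/allP => k /h /le_trans; apply.
by apply: ler_pM; rewrite ?expR_ge0// ler_expR lerN2 ler_wpM2r.
Qed.

Lemma eventually_spread x (be al : R) : (al <= be)%R -> be%:E < lower_dim_loc nu x ->
  exists C : nat, forall n, spread N al C.+1%:R (restr x n).
Proof.
move=> albe /lower_dim_loc_gt[n0 H].
have Ndec k : (N (restr x k) <= 1)%R.
  by rewrite -lee_fin cylmassE; exact: probability_le1 (@measurable_cylinder _ _ _ _).
(* The constant absorbs the levels k < n0, where only nu[x|k] <= 1 is known. *)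
pose C := Num.bound (expR (`|al| * n0%:R)).
have HC : (expR (`|al| * n0%:R) <= C.+1%:R)%R.
  have := archi_boundP (expR_ge0 (`|al| * n0%:R)); rewrite -/C => /ltW /le_trans; apply.
  by rewrite ler_nat.
exists C => n; apply/spreadP => k kn.
have [n0k|kn0] := leqP n0 k.
  apply: (@le_trans _ _ (expR (- (be * k%:R)))).
    by rewrite -lee_fin cylmassE; exact: H.
  apply: (@le_trans _ _ (expR (- (al * k%:R)))).
    by rewrite ler_expR lerN2 ler_wpM2r.
  by rewrite ler_peMl ?expR_ge0// ler1n.
apply: (le_trans (Ndec _)); apply: (@le_trans _ _ (expR (`|al| * n0%:R) * expR (- (al * k%:R)))%R).
  rewrite -expRD -[leLHS](@expR0 R) ler_expR subr_ge0.
  apply: (@le_trans _ _ (`|al| * k%:R)%R); first by rewrite ler_wpM2r// ler_norm.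
  by rewrite ler_wpM2l// ler_nat ltnW.
by rewrite ler_wpM2r ?expR_ge0.
Qed.

Let total n w := mass Xs N n [::] w.

Let mtotal n : measurable_fun setT (total n).
Proof. exact: (adapted_measurable hb (@adapted_mass _ _ _ _ _ Xs N n [::])). Qed.

Let total0 n w : (0 <= total n w)%R.
Proof. exact: mass_ge0. Qed.

Let mover n (K : R) : adapted_set Xs n [set w | K < total n w]%R.
Proof. by apply: adapted_lt; [exact: adapted_cst|exact: adapted_mass]. Qed.

Lemma total_mean n : \int[P]_w (total n w)%:E = 1.
Proof.
have := @mass_mean _ _ _ _ _ _ _ _ _ _ Xs_iid X_ge0 Xs_ge0 X_mean hb N N0 Nsum n [::]
  (fun=> 1%R) (leq0n n) (@adapted_cst _ _ _ _ _ _ _ _) (fun=> ler01).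
rewrite cylmass_nil mul1e.
under eq_integral do rewrite mulr1.
by under [RHS]eq_integral do rewrite mulr1; rewrite (weight1 Xs_iid).
Qed.

(* The left-hand side is the probability, under the spine measure, that the total
   mass exceeds K. While the spine x stays below the barrier, the conditional mean
   of the total mass is at most the sum over k of exp (c k + L) nu[x|k], and
   nu[x|k] <= C exp (- al k) when [spread] holds. *)
Lemma total_tail (c al C L e K : R) n : (c < al)%R -> (0 <= C)%R -> (0 < K)%R -> (0 <= e)%R ->
  (forall u, \int[P]_w (weight Xs u w * \1_(~` good Xs c L u) w)%:E <= e%:E) ->
  \int[P]_w (total n w * \1_[set w | K < total n w]%R w)%:E <=
  nu (~` [set x | forall k, spread N al C (restr x k)]) +
    (e + expR L * C / (1 - expR (c - al)) / K)%:E.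
Proof.
move=> cal C0 K0 e0 esc.
have mK : measurable [set w | K < total n w]%R := adapted_set_measurable hb (@mover n K).
have q1 : (expR (c - al) < 1)%R by rewrite -[ltRHS](@expR0 R) ltr_expR subr_lt0.
rewrite (integral_mass Xs_ge0 N0)//.
pose D := (e + expR L * C / (1 - expR (c - al)) / K)%R.
have D0 : (0 <= D)%R.
  rewrite addr_ge0// !mulr_ge0 ?expR_ge0// ?invr_ge0 ?(ltW K0)// subr_ge0 ltW//.
(* A word that is not spread is charged its whole mass, the tilted probability being at most 1; a
   spread word is charged [D], for leaving the barrier or for a large mass below it. *)
apply: (@le_trans _ _ (\sum_(v : n.-tuple 'I_b) ((~~ spread N al C v)%:R * N v + N v * D)%:E)).
  rewrite (eq_bigl xpredT); last by move=> v; rewrite take0 eqxx.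
  apply: lee_sum => v _; rewrite EFinD.
  have mw := @measurable_weight _ _ _ _ _ Xs v.
  have mg := measurable_good Xs hb c L v.
  have [sp|nsp] := boolP (spread N al C v).
    rewrite mul0r add0e EFinM lee_wpmul2l ?lee_fin//.
    have T := @spine_tail _ _ _ _ _ _ _ _ _ _ Xs_iid X_ge0 Xs_ge0 X_mean hb N N0 Nsum
      c L al C n 0 v K cal C0 K0 (size_tuple v) (leq0n n) sp.
    rewrite take0 expr0 mulr1 in T.
    rewrite /D EFinD; apply: le_trans (leeD (esc v) T).
    rewrite -ge0_integralD//; last 4 first.
    - by move=> w _; rewrite lee_fin mulr_ge0.
    - apply/measurable_EFinP/measurable_funM => //; apply: measurable_indic.
      exact: measurableC.
    - by move=> w _; rewrite lee_fin mulr_ge0.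
    - apply/measurable_EFinP/measurable_funM => //; apply: measurable_indic.
      exact: measurableI.
    apply: ge0_le_integral => //.
    - by move=> w _; rewrite lee_fin mulr_ge0.
    - by apply/measurable_EFinP/measurable_funM => //; exact: measurable_indic.
    - apply/measurable_EFinP/measurable_funD; apply: measurable_funM => //;
        apply: measurable_indic; [exact: measurableC|exact: measurableI].
    - move=> w _; rewrite -EFinD lee_fin -mulrDr ler_wpM2l//.
      rewrite !indicE in_setI in_setC.
      by case: (w \in good _ _ _ _) => /=; case: (w \in _) => /=; rewrite ?addr0 ?add0r.
  rewrite /= mul1r; apply: (@le_trans _ _ (N v)%:E); last first.
    by rewrite leeDl// lee_fin mulr_ge0.
  rewrite -[leRHS]mule1 lee_wpmul2l ?lee_fin// -(weight1 Xs_iid X_ge0 Xs_ge0 X_mean v).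
  apply: ge0_le_integral => //.
  - by move=> w _; rewrite lee_fin mulr_ge0.
  - by apply/measurable_EFinP/measurable_funM => //; exact: measurable_indic.
  - exact/measurable_EFinP.
  - by move=> w _; rewrite lee_fin ler_piMr// indicE; case: (_ \in _).
rewrite sumEFin big_split /= EFinD; apply: leeD; last first.
  rewrite lee_fin -mulr_suml.
  have := @Nsum n [::] (leq0n n).
  rewrite (eq_bigl xpredT); last by move=> v; rewrite take0 eqxx.
  by move=> ->; rewrite cylmass_nil mul1r.
rewrite -sumEFin.
rewrite [leLHS](_ : _ = nu [set x : S | ~~ spread N al C (restr x n)]).
  apply: le_measure; rewrite ?inE.
  - exact: (@measurable_level _ _ _ (fun u => ~~ spread N al C u)).
  - apply: measurableC.
    rewrite (_ : [set x | _] = \bigcap_k [set x : S | spread N al C (restr x k)]).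
      apply: bigcap_measurable => // k _.
      exact: (@measurable_level _ _ _ (fun u => spread N al C u)).
    by apply/seteqP; split => [x h k _|x h k]; apply: h.
  - by move=> x /= /negP nsp h; apply: nsp.
rewrite (measure_level nu (fun u => ~~ spread N al C u)) [RHS]big_mkcond.
apply: eq_bigr => v _; case: (spread _ _ _ _) => /=; first by rewrite mul0r.
by rewrite mul1r cylmassE.
Qed.

Lemma small_complement (F : (set S)^nat) (e : R) : (0 < e)%R ->
  (forall j, measurable (F j)) -> nondecreasing_seq F ->
  {ae nu, forall x, exists j, F j x} -> exists j, nu (~` F j) <= e%:E.
Proof.
move=> e0 mF ndF aeF; apply: contrapT => /forallNP H.
have cF : nonincreasing_seq (fun j => ~` F j).
  by move=> m n mn; apply/subsetPset/subsetC/subsetPset/ndF.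
have mC j : measurable (~` F j) by exact: measurableC.
have mI : measurable (\bigcap_j ~` F j) by exact: bigcap_measurable.
have cv : nu (~` F n) @[n --> \oo] --> nu (\bigcap_j ~` F j).
  apply: nonincreasing_cvg_mu => //.
  by rewrite (le_lt_trans (probability_le1 _ _)) ?ltry.
have I0 : nu (\bigcap_j ~` F j) = 0.
  apply: measure_negligible => //; case: aeF => A [mA A0 FA].
  exists A; split => //; apply: subset_trans FA => x Fx /=.
  by move=> [j Fjx]; exact: (Fx j).
have : e%:E <= nu (\bigcap_j ~` F j).
  rewrite -(cvg_lim _ cv)//; apply: lime_ge; first exact: cvgP cv.
  apply: nearW => n; rewrite leNgt; apply/negP => /ltW; exact: H.
by rewrite I0 lee_fin leNgt e0.
Qed.

Lemma measurable_spread al C : measurable [set x : S | forall k, spread N al C (restr x k)].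
Proof.
rewrite (_ : [set x | _] = \bigcap_k [set x : S | spread N al C (restr x k)]).
  apply: bigcap_measurable => // k _.
  exact: (@measurable_level _ _ _ (fun u => spread N al C u)).
by apply/seteqP; split => [x H k _|x H k]; apply: H.
Qed.

Lemma uniformly_integrable (h e : R) : entropy X = h%:E -> (0 < e)%R ->
  {ae nu, forall x, h%:E < lower_dim_loc nu x} ->
  exists2 K : R, (0 < K)%R & forall n,
    \int[P]_w (total n w * \1_[set w | K < total n w]%R w)%:E <= e%:E.
Proof.
move=> hE e0 aeh.
(* One index moves the exponent down to h and the constant up, so [F] is nondecreasing; the excess 2
   / (j + 1) leaves room for c = h + 1 / (j + 1) strictly between h and [al j]. *)
pose al (j : nat) := (h + 2 / j.+1%:R)%R.
pose F j := [set x : S | forall k, spread N (al j) j.+1%:R (restr x k)].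
have al_mono i j : (i <= j)%N -> (al j <= al i)%R.
  by move=> ij; rewrite lerD2l ler_wpM2l// lef_pV2 ?posrE// ler_nat ltnS.
have ndF : nondecreasing_seq F.
  move=> i j ij; apply/subsetPset => x Fx k.
  by apply: spread_mono (Fx k) => //; [exact: al_mono|rewrite ler_nat ltnS].
have e3 : (0 < e / 3)%R by rewrite divr_gt0.
have [|j Fj] := @small_complement F (e / 3) e3 (fun j => measurable_spread _ _) ndF.
  apply: filterS aeh => x hx.
  have [be hbe bex] : exists2 be : R, (h < be)%R & be%:E < lower_dim_loc nu x.
    case: (lower_dim_loc nu x) hx => [r| |]//.
      rewrite lte_fin => hr; exists ((h + r) / 2)%R; rewrite ?lte_fin; lra.
    by move=> _; exists (h + 1)%R; rewrite ?ltry// ltrDl.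
  pose i := Num.bound (2 / (be - h))%R.
  have ihbe : (al i <= be)%R.
    rewrite /al -lerBrDl ler_pdivrMr// mulrC -ler_pdivrMr ?subr_gt0//.
    have : (0 <= 2 / (be - h))%R by rewrite divr_ge0// subr_ge0 ltW.
    by move=> /archi_boundP /ltW /le_trans; apply; rewrite ler_nat.
  have [C HC] := eventually_spread ihbe bex.
  exists (maxn i C) => k; apply: spread_mono (HC k) => //.
    by apply: al_mono; exact: leq_maxl.
  by rewrite ler_nat ltnS leq_maxr.
pose c := (h + 1 / j.+1%:R)%R.
have hc : (h < c)%R by rewrite ltrDl divr_gt0.
have cal : (c < al j)%R by rewrite ltrD2l ltr_pM2r ?invr_gt0// ltr1n.
have [L L0 HL] := upper_tail Xs_iid X_ge0 Xs_ge0 X_mean hE hc e3.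
pose D := (expR L * j.+1%:R / (1 - expR (c - al j)))%R.
have q1 : (expR (c - al j) < 1)%R by rewrite -[ltRHS](@expR0 R) ltr_expR subr_lt0.
have D0 : (0 < D)%R by rewrite divr_gt0 ?mulr_gt0 ?expR_gt0 ?subr_gt0.
(* The Markov term D / K is then e / 3; the other two thirds pay for the complement of [F j] and for
   leaving the barrier. *)
exists (D / (e / 3))%R; first by rewrite divr_gt0.
move=> n.
have K0 : (0 < D / (e / 3))%R by rewrite divr_gt0.
apply: le_trans (@total_tail c (al j) j.+1%:R L (e / 3) _ n cal _ K0 (ltW e3) _) _ => //.
  move=> u; rewrite /good setCK; apply: HL; [exact: uniq_prefixes|exact: nil_prefixes].
apply: (@le_trans _ _ ((e / 3)%:E + (e / 3 + e / 3)%:E)); last first.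
  by rewrite -EFinD lee_fin; lra.
apply: leeD => //; rewrite lee_fin lerD2l -/D.
by rewrite invfM invrK mulrA divff ?gt_eqF// mul1r.
Qed.

Lemma cyl_nil : cyl [::] = setT.
Proof. by apply/seteqP; split => x. Qed.

Lemma kernel_mean_le1 : \int[P]_w Qnu w setT <= 1.
Proof.
have := @kernel_cylinder_le _ _ hb _ _ _ _ _ _ _ _ nu Qnu Xs_iid X_ge0 Xs_ge0 X_mean
  Qnu_cascade [::] (fun=> 1%R) (@adapted_cst _ _ _ _ _ _ _ _) (fun=> ler01).
rewrite cylmass_nil mul1e cyl_nil.
under eq_integral do rewrite mule1.
under [X in _ <= X -> _]eq_integral do rewrite mulr1.
by rewrite (weight1 Xs_iid).
Qed.

(** The total masses truncated at [K] converge in mean by dominated convergence and, by uniform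
    integrability, lose at most [e] of the mean 1. The bound from above is Fatou's. *)
Lemma regular (h : R) : entropy X = h%:E ->
  {ae nu, forall x, h%:E < lower_dim_loc nu x} -> \int[P]_w Qnu w setT = 1.
Proof.
move=> hE aeh; apply/eqP; rewrite eq_le kernel_mean_le1/=.
apply/lee_addgt0Pr => e e0.
have [K K0 HK] := uniformly_integrable hE e0 aeh.
pose f n w := (Num.min (total n w) K)%:E.
pose Y w := (Num.min (fine (Qnu w setT)) K)%:E.
have mQ : measurable_fun setT (fun w => Qnu w setT) by exact: measurable_kernel.
have mf n : measurable_fun setT (f n) by apply/measurable_EFinP/measurable_minr.
have mY : measurable_fun setT Y.
  by apply/measurable_EFinP/measurable_minr => //; exact: measurableT_comp.
have cv : {ae P, forall w, setT w -> f n w @[n --> \oo] --> Y w}.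
  have := cascade_limit Xs_ge0 Qnu_cascade.
  apply: filterS => w /(_ [::]); rewrite cyl_nil -[X in _ --> X]fineK; last first.
    by rewrite ge0_fin_numE//; exact: kernel_finite.
  move=> /fine_cvgP[_ cw] _.
  apply: cvg_EFin; first exact: nearW.
  have cm : continuous (fun r : R => Num.min r K).
    move=> r; apply: (@continuous_min R R id (cst K)); first exact: cvg_id.
    exact: cvg_cst.
  exact: (@continuous_cvg _ _ _ _ _ _ (fun r => Num.min r K) _ (cm _) cw).
have iK : P.-integrable setT (fun=> K%:E) by exact: finite_measure_integrable_cst.
have fK : {ae P, forall w n, setT w -> `|f n w| <= K%:E}.
  apply: aeW => w n _; rewrite lee_fin ger0_norm ?ge_min ?lexx ?orbT//.
  by rewrite le_min total0 ltW.
have [_ _ cvI] := dominated_convergence measurableT mf mY cv iK fK.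
have If n : 1 <= \int[P]_w f n w + e%:E.
  rewrite -(total_mean n).
  have mK : measurable [set w | K < total n w]%R := adapted_set_measurable hb (@mover n K).
  apply: (@le_trans _ _ (\int[P]_w (f n w + (total n w * \1_[set w | K < total n w]%R w)%:E))).
    apply: ge0_le_integral => //.
    - by move=> w _; rewrite lee_fin.
    - exact/measurable_EFinP.
    - apply: emeasurable_funD; first exact: mf.
      by apply/measurable_EFinP/measurable_funM; [exact: mtotal|exact: measurable_indic].
    - move=> w _; rewrite -EFinD lee_fin indicE.
      have [_|] := boolP (w \in _); first by rewrite mulr1 lerDr le_min total0 ltW.
      by rewrite mulr0 addr0 notin_setE /= => /negP; rewrite -leNgt le_min lexx.
  rewrite ge0_integralD//.
  - exact: leeD2l.
  - by move=> w _; rewrite lee_fin le_min total0 ltW.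
  - by move=> w _; rewrite lee_fin mulr_ge0.
  - by apply/measurable_EFinP/measurable_funM => //; exact: measurable_indic.
have IY : 1 - e%:E <= \int[P]_w Y w.
  rewrite -(cvg_lim _ cvI)//; apply: lime_ge; first exact: cvgP cvI.
  by apply: nearW => n; rewrite leeBlDr//; exact: If.
have YQ : \int[P]_w Y w <= \int[P]_w Qnu w setT.
  apply: ge0_le_integral => //.
  - by move=> w _; rewrite lee_fin le_min fine_ge0//= ltW.
  - move=> w _; rewrite /Y -[leRHS]fineK; first by rewrite lee_fin ge_min lexx.
    by rewrite ge0_fin_numE//; exact: kernel_finite.
by rewrite -leeBlDr// (le_trans IY).
Qed.

End regularity.

(** * Singularity *)

Section transfer.
Context (R : realType) (b : nat) (hb : (1 < b)%N).
Context (d : measure_display) (Omega : measurableType d)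
  (P : probability Omega R) (Xs : seq 'I_b -> {RV P >-> R})
  (d0 : measure_display) (T0 : measurableType d0) (P0 : probability T0 R)
  (X : {RV P0 >-> R}).
Local Notation S := (seqspace R hb).
Local Notation cyl u := (@cylinder R b hb u).
Context (nu : probability S R) (Qnu : R.-ftker Omega ~> S).
Hypothesis Xs_iid : iid_copies Xs X.
Hypothesis X_ge0 : forall t, (0 <= X t)%R.
Hypothesis Xs_ge0 : forall u w, (0 <= Xs u w)%R.
Hypothesis X_mean : \int[P0]_t (X t)%:E = 1.
Hypothesis Qnu_cascade : is_cascade_measure Xs nu Qnu.
Implicit Types (u v p : seq 'I_b) (x : S).
Local Notation N := (cylmass nu).

Let N0 u : (0 <= N u)%R := cylmass_ge0 nu u.
Let Nsum := @cylmass_sum R b hb nu.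
Let w0 u w : (0 <= weight Xs u w)%R := weight_ge0 Xs_ge0 u w.

Definition hereditary (q : nat -> R -> bool) u :=
  all (fun k => q k (N (take k u))) (iota 0 (size u).+1).

(* Both this set and its complement are monotone limits of unions of cylinders,
   hence [dominated]. *)
Definition always (q : nat -> R -> bool) : set S := [set x | forall k, q k (N (restr x k))].

Lemma hereditaryP q x n :
  hereditary q (restr x n) <-> forall k, (k <= n)%N -> q k (N (restr x k)).
Proof.
split=> [/allP h k kn|h].
  have := h k; rewrite mem_iota size_restr ltnS kn => /(_ isT).
  by rewrite take_restr.
by apply/allP => k; rewrite mem_iota size_restr ltnS => /= kn; rewrite take_restr// h.
Qed.

Lemma alwaysE q : always q = \bigcap_n [set x : S | hereditary q (restr x n)].
Proof.
apply/seteqP; split => [x qx n _|x qx k].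
  by apply/hereditaryP => k _; exact: qx.
by have /hereditaryP := qx k I; apply.
Qed.

Let hereditary_ni q : nonincreasing_seq (fun n => [set x : S | hereditary q (restr x n)]).
Proof.
move=> m n mn; apply/subsetPset => x /= /hereditaryP h; apply/hereditaryP => k km.
by apply: h; exact: leq_trans mn.
Qed.

Lemma dominated_always q : dominated P nu Qnu (always q).
Proof.
rewrite alwaysE; apply: dominated_bigcap; first exact: hereditary_ni.
move=> n; exact: (@dominated_level _ _ _ _ _ _ _ _ _ _ _ _ _ Xs_iid X_ge0 Xs_ge0 X_mean
  Qnu_cascade (hereditary q) n).
Qed.

Lemma dominated_alwaysC q : dominated P nu Qnu (~` always q).
Proof.
rewrite alwaysE setC_bigcap; apply: dominated_bigcup.
  by move=> m n mn; apply/subsetPset/subsetC/subsetPset/hereditary_ni.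
move=> n; rewrite (_ : ~` _ = [set x : S | ~~ hereditary q (restr x n)]); last first.
  by apply/seteqP; split => x /= /negP.
exact: (@dominated_level _ _ _ _ _ _ _ _ _ _ _ _ _ Xs_iid X_ge0 Xs_ge0 X_mean Qnu_cascade
  (fun u => ~~ hereditary q u) n).
Qed.

Lemma negligible_setC (mu : {measure set S -> \bar R}) (A : set S) : measurable A ->
  {ae mu, forall x, A x} -> mu (~` A) = 0.
Proof.
by move=> mA [B [mB B0 AB]]; apply: measure_negligible; [exact: measurableC|exists B].
Qed.

(** The points with no suitable [j] form a decreasing intersection of complements of [always] sets:
    it is dominated and nu-null. *)
Lemma always_transfer (q : nat -> nat -> R -> bool) :
  (forall i j k r, (i <= j)%N -> q i k r -> q j k r) ->
  {ae nu, forall x, exists j, forall k, q j k (N (restr x k))} ->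
  {ae P, forall w, Qnu w (~` \bigcup_j always (q j)) = 0}.
Proof.
move=> qmono aeq; rewrite setC_bigcup.
apply: (@dominated_null _ _ _ _ _ _ nu).
  apply: dominated_bigcap; last by move=> j; exact: dominated_alwaysC.
  move=> i j ij; apply/subsetPset/subsetC => x /= qx k; exact: qmono ij (qx k).
rewrite -setC_bigcup; apply: negligible_setC.
  apply: bigcup_measurable => j _; exact: (dominated_always (q j)).1.
by apply: filterS aeq => x [j qx]; exists j.
Qed.

Let total n w := mass Xs N n [::] w.
Let total0 n w : (0 <= total n w)%R.
Proof. exact: mass_ge0. Qed.
Let mtotal n : measurable_fun setT (total n).
Proof. exact: (adapted_measurable hb (@adapted_mass _ _ _ _ _ Xs N n [::])). Qed.
Let total_mean' n : \int[P]_w (total n w)%:E = 1.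
Proof. exact: (total_mean nu Xs_iid X_ge0 Xs_ge0 X_mean). Qed.

Lemma total_ge u n w : size u = n -> (weight Xs u w * N u <= total n w)%R.
Proof.
move=> un; have su : size u == n by apply/eqP.
rewrite /total /mass (bigD1 (Tuple su)) ?take0//= lerDl.
by apply: sumr_ge0 => v _; rewrite mulr_ge0.
Qed.

Lemma total_growth (de : R) : (0 < de)%R ->
  {ae P, forall w, exists n0, forall n, (n0 <= n)%N -> (total n w < expR (de * n%:R))%R}.
Proof.
move=> de0.
pose T n := [set w | (expR (de * n%:R) <= total n w)%R].
have mT n : measurable (T n).
  have := measurable_fun_ler (@measurable_cst _ _ _ _ setT (expR (de * n%:R))) (mtotal n).
  by move=> /(_ measurableT [set true]); rewrite setTI; apply.
have r01 : (0 <= expR (- de) < 1)%R.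
  by rewrite expR_ge0/= -[ltRHS](@expR0 R) ltr_expR oppr_lt0.
have PT n : P (T n) <= (expR (- de) ^+ n)%:E.
  rewrite -[leRHS]mule1 -(total_mean' n) -ge0_integralZl_EFin ?exprn_ge0 ?expR_ge0//; last 2 first.
  - by move=> w _; rewrite lee_fin.
  - exact/measurable_EFinP.
  rewrite -[X in P X]setIT -integral_indic//.
  apply: ge0_le_integral => //.
  - by apply/measurable_EFinP/measurable_indic.
  - by apply: emeasurable_funM => //; exact/measurable_EFinP.
  - move=> w _; rewrite -EFinM lee_fin indicE.
    have [/set_mem /= Tw|_] := boolP (w \in T n); last by rewrite mulr_ge0// exprn_ge0 ?expR_ge0.
    rewrite -expRM_natl mulrN expRN -ler_pdivrMl ?invr_gt0 ?expR_gt0// invrK mulr1.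
    by rewrite mulrC.
have sumT : \sum_(n <oo) P (T n) < +oo.
  apply: (@le_lt_trans _ _ (1 / (1 - expR (- de)))%:E); last exact: ltry.
  apply: lime_le; first by apply: is_cvg_nneseries.
  apply: nearW => n; apply: (@le_trans _ _ (\sum_(0 <= i < n) expR (- de) ^+ i)%R%:E).
    by rewrite -sumEFin; apply: lee_sum => i _; exact: PT.
  by rewrite lee_fin; have := geometric_tail 0 n r01; rewrite expr0.
exists (lim_sup_set T); split.
- by apply: bigcap_measurable => // n _; apply: bigcup_measurable => k _; exact: mT.
- exact: lim_sup_set_cvg0.
- move=> w /= nw n _; apply: contrapT => H; apply: nw; exists n => k nk.
  rewrite ltNge; apply/negP => Tk; apply: H; exists k => //.
Qed.

Lemma level_weightE n (A : seq 'I_b -> set Omega) (e : R) : (0 <= e)%R ->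
  (forall u, size u = n -> \int[P]_w (weight Xs u w * \1_(A u) w)%:E <= e%:E) ->
  level_weight Xs nu n A <= e%:E.
Proof.
move=> e0 He; apply: (@le_trans _ _ (\sum_(u : n.-tuple 'I_b) (N u * e)%:E)).
  apply: lee_sum => u _; rewrite EFinM lee_wpmul2l ?lee_fin//.
  by apply: He; rewrite size_tuple.
rewrite sumEFin -mulr_suml lee_fin.
have := @Nsum n [::] (leq0n n).
rewrite (eq_bigl xpredT); last by move=> v; rewrite take0 eqxx.
by move=> ->; rewrite cylmass_nil mul1r.
Qed.

Lemma light_levels (H : R) : H%:E < entropy X ->
  {ae P, forall w, Qnu w (lim_sup_set (fun n =>
     [set x | weight Xs (restr x n) w < expR (H * n%:R)]%R)) = 0}.
Proof.
move=> hH; have [r r01 Hr] := lower_tail Xs_iid X_ge0 Xs_ge0 X_mean hH.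
pose A u := [set w | weight Xs u w < expR (H * (size u)%:R)]%R.
have aA u : adapted_set Xs (size u) (A u).
  by apply: adapted_lt; [exact: adapted_weight|exact: adapted_cst].
have := @level_borel_cantelli _ _ hb _ _ _ _ _ _ _ _ nu Qnu Xs_iid X_ge0 Xs_ge0 X_mean
  Qnu_cascade A 1 r aA r01.
have HA n : level_weight Xs nu n A <= (1 * r ^+ n)%:E.
  rewrite mul1r; apply: level_weightE; first by rewrite exprn_ge0//; case/andP : r01.
  move=> u <-; have := Hr _ (uniq_prefixes u) (nil_prefixes u).
  by rewrite size_prefixes.
move=> /(_ HA); apply: filterS => w H0.
rewrite (_ : (fun n => [set x | _]) = (fun n => level n A w))//.
by apply/funext => n; apply/seteqP; split => x; rewrite /level /A /= size_restr.
Qed.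

(* For such x the total mass would exceed Q_n(w,x) nu[x|n] >= exp (n (H - H')),
   but it has mean 1. *)
Lemma heavy_points_null (H H' : R) : (H' < H)%R -> H%:E < entropy X ->
  {ae P, forall w, Qnu w (lim_sup_set (fun n =>
     [set x | expR (- (H' * n%:R)) <= N (restr x n)]%R)) = 0}.
Proof.
move=> HH hH; have de0 : (0 < H - H')%R by rewrite subr_gt0.
have := total_growth de0; apply: filterS2 (light_levels hH) => w H0 [n0 Hn0].
have mD n : measurable [set x : S | expR (- (H' * n%:R)) <= N (restr x n)]%R.
  exact: (@measurable_level _ _ _ (fun u => expR (- (H' * n%:R)) <= N u)%R).
have mE n : measurable [set x : S | weight Xs (restr x n) w < expR (H * n%:R)]%R.
  exact: (@measurable_level _ _ _ (fun u => weight Xs u w < expR (H * n%:R))%R).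
have mls F : (forall n, measurable (F n)) -> measurable (lim_sup_set F : set S).
  by move=> mF; apply: bigcap_measurable => // n _; apply: bigcup_measurable => k _.
apply/eqP; rewrite -measure_le0 -H0; apply: le_measure; rewrite ?inE; [exact: mls|exact: mls|].
move=> x Dx n _; have [k /= nk Dk] := Dx (maxn n n0) I.
have [nk1 nk2] : (n <= k)%N /\ (n0 <= k)%N by move: nk; rewrite geq_max => /andP.
exists k => //=.
rewrite ltNge; apply/negP => hw; have := Hn0 k nk2; apply/negP; rewrite -leNgt.
apply: le_trans (total_ge w (size_restr x k)).
rewrite mulrBl expRD -mulNr.
by apply: ler_pM; rewrite ?expR_ge0// mulNr.
Qed.

(** Sequences of rates are needed because local dimensions may come arbitrarily close to h_X, which
    may also be infinite. Points heavy infinitely often at some rate are Q.nu-null by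
    [heavy_points_null]; the others form a dominated nu-null set. *)
Lemma singular (Hs Hs' : nat -> R) :
  (forall j, Hs' j < Hs j)%R -> (forall j, (Hs j)%:E < entropy X) ->
  (forall i j, (i <= j)%N -> (Hs' i <= Hs' j)%R) ->
  {ae nu, forall x, exists j, lower_dim_loc nu x < (Hs' j)%:E} ->
  {ae P, forall w, Qnu w setT = 0}.
Proof.
move=> HH hH Hmono aex.
pose D j : set S := lim_sup_set (fun n => [set x : S | expR (- (Hs' j * n%:R)) <= N (restr x n)]%R).
(* Not being heavy from level [m] on is an [always] condition once the implication makes it vacuous
   below [m]. *)
pose q j m k (r : R) := (m <= k)%N ==> (r < expR (- (Hs' j * k%:R)))%R.
have DC j : ~` D j = \bigcup_m always (q j m).
  rewrite /D /lim_sup_set setC_bigcap; apply: eq_bigcupr => m _.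
  apply/seteqP; split => [x Dx k|x qx [k /= mk]].
    by apply/implyP => mk; rewrite ltNge; apply/negP => h; apply: Dx; exists k.
  by have /implyP /(_ mk) := qx k; rewrite ltNge => /negP.
have domD j : dominated P nu Qnu (~` D j).
  rewrite DC; apply: dominated_bigcup; last by move=> m; exact: dominated_always.
  move=> m n mn; apply/subsetPset => x qx k; apply/implyP => nk.
  by have /implyP := qx k; apply; exact: leq_trans nk.
have niD : nonincreasing_seq (fun j => ~` D j).
  move=> i j ij; apply/subsetPset/subsetC => x Dx n _.
  have [k nk /= h] := Dx n I; exists k => //=; apply: le_trans h.
  by rewrite ler_expR lerN2 ler_wpM2r// Hmono.
have domI := dominated_bigcap niD domD.
have I0 : nu (\bigcap_j ~` D j) = 0.
  apply: measure_negligible; first exact: domI.1.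
  case: aex => A [mA A0 xA]; exists A; split => //; apply: subset_trans xA => x Dx /= [j xj].
  apply: (Dx j I) => n _.
  have [k nk h] := lower_dim_loc_lt xj n; exists k => //=.
  by rewrite -lee_fin cylmassE.
have aeI := dominated_null domI I0.
have aeD : {ae P, forall w, forall j, Qnu w (D j) = 0}.
  by apply: ae_foralln => j; exact: heavy_points_null.
apply: filterS2 aeI aeD => w h1 h2.
have mD j : measurable (D j) by rewrite -[D j]setCK; apply: measurableC; exact: (domD j).1.
rewrite -(setUv (\bigcup_j D j)) setC_bigcup.
apply/eqP; rewrite -measure_le0.
have mU : measurable (\bigcup_j D j) by exact: bigcup_measurable.
apply: (@le_trans _ _ (Qnu w (\bigcup_j D j) + Qnu w (\bigcap_j ~` D j))).
  exact: (measureU2 (Qnu w) mU domI.1).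
have -> : Qnu w (\bigcap_j ~` D j) = 0 := h1.
rewrite adde0.
have : (Qnu w).-negligible (\bigcup_j D j).
  by apply: negligible_bigcup => j; apply/negligibleP => //; exact: h2.
by move/(measure_negligible mU) => ->.
Qed.

End transfer.

(** * Dimension bounds *)

Lemma lim_sup_setP T (F : (set T)^nat) x :
  ~ lim_sup_set F x -> exists n0, forall n, (n0 <= n)%N -> ~ F n x.
Proof.
move=> Fx; apply: contrapT => /forallNP H; apply: Fx => n _.
apply: contrapT => K; apply: (H n) => m nm Fm; apply: K; exists m => //.
Qed.

Lemma null_ae d (T : measurableType d) (R : realType) (mu : {measure set T -> \bar R}) (A : set T) :
  measurable A -> mu A = 0 -> {ae mu, forall x, ~ A x}.
Proof. by move=> mA A0; exists A; split => // x /= /contrapT. Qed.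

Definition lim_inf_set T (F : (set T)^nat) : set T :=
  \bigcup_n \bigcap_(m in [set m | (n <= m)%N]) F m.

Lemma measurable_lim_inf_set d (T : measurableType d) (F : (set T)^nat) :
  (forall n, measurable (F n)) -> measurable (lim_inf_set F).
Proof.
by move=> mF; apply: bigcup_measurable => n _; apply: bigcap_measurableType => m _.
Qed.

Lemma measurable_lim_sup_set d (T : measurableType d) (F : (set T)^nat) :
  (forall n, measurable (F n)) -> measurable (lim_sup_set F).
Proof.
by move=> mF; apply: bigcap_measurable => // n _; apply: bigcup_measurable => m _.
Qed.

Lemma measure_lim_inf_set d (T : measurableType d) (R : realType) (mu : {measure set T -> \bar R})
  (F : (set T)^nat) : (forall n, measurable (F n)) ->
  mu (lim_inf_set F) <= limn_einf (fun n => mu (F n)).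
Proof.
move=> mF; pose G n := \bigcap_(m in [set m | (n <= m)%N]) F m.
have mG n : measurable (G n) by apply: bigcap_measurableType => m _.
have mL := measurable_lim_inf_set mF.
have cv : mu (G n) @[n --> \oo] --> mu (lim_inf_set F).
  apply: nondecreasing_cvg_mu => //.
  move=> m n mn; apply/subsetPset => x Gx k /= nk; apply: Gx => /=; exact: leq_trans nk.
rewrite -(cvg_lim _ cv)//; apply: lime_le; first exact: cvgP cv.
apply: nearW => n; apply: limn_einf_ge; exists n => m nm.
by apply: le_measure; rewrite ?inE//; exact: bigcap_inf.
Qed.

Section dimension.
Context (R : realType) (b : nat) (hb : (1 < b)%N).
Context (d : measure_display) (Omega : measurableType d)
  (P : probability Omega R) (Xs : seq 'I_b -> {RV P >-> R})
  (d0 : measure_display) (T0 : measurableType d0) (P0 : probability T0 R)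
  (X : {RV P0 >-> R}).
Local Notation S := (seqspace R hb).
Local Notation cyl u := (@cylinder R b hb u).
Context (nu : probability S R) (Qnu : R.-ftker Omega ~> S).
Hypothesis Xs_iid : iid_copies Xs X.
Hypothesis X_ge0 : forall t, (0 <= X t)%R.
Hypothesis Xs_ge0 : forall u w, (0 <= Xs u w)%R.
Hypothesis X_mean : \int[P0]_t (X t)%:E = 1.
Hypothesis Qnu_cascade : is_cascade_measure Xs nu Qnu.
Implicit Types (u v p : seq 'I_b) (x : S).
Local Notation N := (cylmass nu).

Let N0 u : (0 <= N u)%R := cylmass_ge0 nu u.

(** Fatou's lemma twice, for sets under [Qnu w] and for functions under [P]. The bound is asked for
    large [m] only, since [spine_tail] needs n <= m. *)
Lemma kernel_lim_inf (A : seq 'I_b -> set Omega) (e : R) :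
  (forall u, adapted_set Xs (size u) (A u)) ->
  (exists n0, forall m, (n0 <= m)%N -> level_weight Xs nu m A <= e%:E) ->
  exists g : Omega -> \bar R, [/\ measurable_fun setT g, forall w, 0 <= g w,
    forall w, Qnu w (lim_inf_set (fun m => level m A w)) <= g w &
    \int[P]_w g w <= e%:E].
Proof.
move=> aA [n0 He].
have ml m : measurable_fun setT (fun w => Qnu w (level m A w)).
  apply: measurable_kernel_level => u _; exact: (adapted_set_measurable hb (aA u)).
exists (fun w => limn_einf (fun m => Qnu w (level m A w))); split.
- exact: measurable_fun_limn_einf.
- by move=> w; apply: limn_einf_ge; exists 0%N.
- by move=> w; apply: measure_lim_inf_set => m; exact: measurable_level_set.
- apply: (le_trans (fatou P measurableT ml _)) => //.
  apply: (le_trans (limn_einf_sup _)); apply: limn_esup_le; exists n0 => m /He.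
  apply: le_trans.
  apply: (kernel_level_le Xs_iid X_ge0 Xs_ge0 X_mean Qnu_cascade) => u <-; exact: aA.
Qed.

(** Outside three null sets, for large n, Q.nu[x|n] >= exp (- de n) Q_n(x) nu[x|n], with Q_n(x) >=
    exp (H n) and nu[x|n] >= exp (- B n). *)
Lemma upper_dimension (B H de : R) : {ae nu, forall x, upper_dim_loc nu x < B%:E} ->
  H%:E < entropy X -> (0 < de)%R ->
  {ae P, forall w, {ae Qnu w, forall x, upper_dim_loc (Qnu w) x <= (B - H + de)%:E}}.
Proof.
move=> aeB hH de0.
pose q (j k : nat) (r : R) := (j <= k)%N ==> (expR (- (B * k%:R)) <= r)%R.
have qmono i j k r : (i <= j)%N -> q i k r -> q j k r.
  by move=> ij /implyP h; apply/implyP => jk; apply: h; exact: leq_trans jk.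
have aeq : {ae nu, forall x, exists j, forall k, q j k (N (restr x k))}.
  apply: filterS aeB => x /upper_dim_loc_lt[n0 Hn0]; exists n0 => k.
  by apply/implyP => n0k; rewrite -lee_fin cylmassE; exact: Hn0.
have U1 := always_transfer Xs_iid X_ge0 Xs_ge0 X_mean Qnu_cascade qmono aeq.
have U2 := light_levels Xs_iid X_ge0 Xs_ge0 X_mean Qnu_cascade hH.
pose E n w := [set x : S | Qnu w (cyl (restr x n)) <
  (expR (- (de * n%:R)) * (weight Xs (restr x n) w * N (restr x n)))%:E].
pose g n w := (expR (- (de * n%:R)) * mass Xs N n [::] w)%:E.
have mtot n : measurable_fun setT (mass Xs N n [::]).
  exact: (adapted_measurable hb (@adapted_mass _ _ _ _ _ Xs N n [::])).
have mE n w : measurable (E n w).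
  exact: (@measurable_level _ _ _ (fun u => Qnu w (cyl u) <
    (expR (- (de * n%:R)) * (weight Xs u w * N u))%:E)).
have r01 : (0 <= expR (- de) < 1)%R.
  by rewrite expR_ge0/= -[ltRHS](@expR0 R) ltr_expR oppr_lt0.
(* The cylinders to which Q.nu gives less than exp (- de n) times their mass at
   stage n have a total mass of mean at most exp (- de n). *)
have U3 : {ae P, forall w, Qnu w (lim_sup_set (E ^~ w)) = 0}.
  apply: (@kernel_borel_cantelli _ _ _ _ _ _ _ E g 1 _ mE _ _ _ r01).
  - by move=> n; apply/measurable_EFinP/measurable_funM.
  - by move=> n w; rewrite lee_fin mulr_ge0 ?expR_ge0// mass_ge0.
  - move=> n w.
    rewrite (measure_level (Qnu w) (fun u => Qnu w (cyl u) <
      (expR (- (de * n%:R)) * (weight Xs u w * N u))%:E)).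
    rewrite big_mkcond /g /mass.
    rewrite [leRHS](_ : _ = (expR (- (de * n%:R)) *
      \sum_(v : n.-tuple 'I_b) weight Xs v w * N v)%R%:E); last first.
      by congr (_ * _)%:E; apply: eq_bigl => v; rewrite take0 eqxx.
    rewrite mulr_sumr -sumEFin; apply: lee_sum => v _.
    case: ifPn => [/ltW//|_]; by rewrite lee_fin !mulr_ge0 ?expR_ge0 ?weight_ge0.
  - move=> n; rewrite /g; under eq_integral do rewrite EFinM.
    rewrite ge0_integralZl_EFin ?expR_ge0//; last 2 first.
    + by move=> w _; rewrite lee_fin mass_ge0.
    + exact/measurable_EFinP.
    by rewrite (total_mean nu Xs_iid X_ge0 Xs_ge0 X_mean) mule1 mul1r -expRM_natl mulrN mulrC.
apply: filterS3 U1 U2 U3 => w h1 h2 h3.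
have m1 : measurable (~` \bigcup_j always nu (q j)).
  apply: measurableC; apply: bigcup_measurable => j _.
  exact: (dominated_always Xs_iid X_ge0 Xs_ge0 X_mean Qnu_cascade (q j)).1.
have m2 : measurable (lim_sup_set (fun n =>
    [set x : S | weight Xs (restr x n) w < expR (H * n%:R)]%R)).
  apply: measurable_lim_sup_set => n.
  exact: (@measurable_level _ _ _ (fun u => weight Xs u w < expR (H * n%:R))%R).
have m3 : measurable (lim_sup_set (E ^~ w)) by exact: measurable_lim_sup_set.
apply: filterS3 (null_ae m1 h1) (null_ae m2 h2) (null_ae m3 h3) => x.
move=> nq nl nE; have [n2 H2] := lim_sup_setP nl; have [n3 H3] := lim_sup_setP nE.
have [j _ qx] : (\bigcup_j always nu (q j)) x by exact: contrapT nq.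
apply: upper_dim_loc_le; exists (maxn j (maxn n2 n3)) => n.
rewrite !geq_max => /and3P[jn n2n n3n].
have := H3 n n3n; rewrite /E /= => /negP; rewrite -leNgt; apply: le_trans.
have := H2 n n2n; rewrite /= => /negP; rewrite -leNgt => hw.
have /implyP /(_ jn) hN := qx n.
rewrite lee_fin.
rewrite (_ : - ((B - H + de) * n%:R) = - (de * n%:R) + (H * n%:R - B * n%:R))%R; last by ring.
rewrite expRD ler_wpM2l ?expR_ge0// expRD.
by apply: ler_pM; rewrite ?expR_ge0.
Qed.

Lemma lower_dimension (h be al c ga : R) : entropy X = h%:E -> (h < c)%R -> (c < al)%R ->
  (al <= be)%R -> (ga < al - c)%R ->
  {ae nu, forall x, be%:E < lower_dim_loc nu x} ->
  {ae P, forall w, {ae Qnu w, forall x, ga%:E <= lower_dim_loc (Qnu w) x}}.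
Proof.
move=> hE hc cal albe gac aebe.
pose q (j k : nat) (r : R) := (r <= j.+1%:R * expR (- (al * k%:R)))%R.
have qmono i j k r : (i <= j)%N -> q i k r -> q j k r.
  by move=> ij /le_trans; apply; rewrite ler_wpM2r ?expR_ge0// ler_nat ltnS.
have aeq : {ae nu, forall x, exists j, forall k, q j k (N (restr x k))}.
  apply: filterS aebe => x /(eventually_spread albe)[j Hj]; exists j => k.
  have /spreadP := Hj k; exact.
have U1 := always_transfer Xs_iid X_ge0 Xs_ge0 X_mean Qnu_cascade qmono aeq.
(* Barriers that the spine leaves with probability at most 2^-i: almost every
   point of Q.nu respects one of them. *)
have /choice[L HL] : forall i : nat, exists L : R, (0 <= L)%R /\
    forall u, \int[P]_w (weight Xs u w * \1_(~` good Xs c L u) w)%:E <= (2^-1 ^+ i)%:E.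
  move=> i; have e0 : (0 < 2^-1 ^+ i :> R)%R by rewrite exprn_gt0.
  have [Li L0 HLi] := upper_tail Xs_iid X_ge0 Xs_ge0 X_mean hE hc e0.
  exists Li; split => // u; rewrite /good setCK; apply: HLi.
    exact: uniq_prefixes.
  exact: nil_prefixes.
have half01 : (0 <= (2^-1 : R) < 1)%R by rewrite invr_ge0 ler0n/= invf_lt1// ltr1n.
pose bad i u := ~` good Xs c (L i) u.
have abad i u : adapted_set Xs (size u) (bad i u).
  by move=> v uv; apply: measurableC; exact: (@adapted_good _ _ _ _ _ Xs c (L i) u v uv).
have /choice[g Hg] : forall i : nat, exists g : Omega -> \bar R,
    [/\ measurable_fun setT g, forall w, 0 <= g w,
      forall w, Qnu w (lim_inf_set (fun m => level m (bad i) w)) <= g w &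
    \int[P]_w g w <= (2^-1 ^+ i)%:E].
  move=> i; apply: kernel_lim_inf; first exact: abad.
  exists 0%N => m _; apply: level_weightE; first by rewrite exprn_ge0.
  by move=> u _; exact: (HL i).2.
have mbad i w : measurable (lim_inf_set (fun m => level m (bad i) w : set S)).
  by apply: measurable_lim_inf_set => m; exact: measurable_level_set.
have U2 : {ae P, forall w, Qnu w (lim_sup_set (fun i =>
    lim_inf_set (fun m => level m (bad i) w))) = 0}.
  apply: (@kernel_borel_cantelli _ _ _ _ _ _ _
    (fun i w => lim_inf_set (fun m => level m (bad i) w)) g 1 _ mbad _ _ _ half01).
  - by move=> i; have [] := Hg i.
  - by move=> i; have [] := Hg i.
  - by move=> i; have [] := Hg i.
  - by move=> i; rewrite mul1r; have [] := Hg i.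
(* The point x has n-cylinder too heavy at stage m. The Q.nu-mass of a cylinder is
   the limit in m of its masses, so x being too heavy for the limit means
   belonging to the lower limit of these events. *)
pose A (i j n : nat) u : set Omega := if spread N al j.+1%:R u then
    good Xs c (L i) u `&` [set w | expR (- (ga * n%:R)) < mass Xs N (size u) (take n u) w]%R
  else set0.
have aA i j n u : adapted_set Xs (size u) (A i j n u).
  rewrite /A; case: ifPn => _ v uv; last exact: measurable0.
  apply: measurableI; first exact: (@adapted_good _ _ _ _ _ Xs c (L i) u v uv).
  by apply: (adapted_lt _ _ uv); [exact: adapted_cst|exact: adapted_mass].
pose D i j := (expR (L i) * j.+1%:R / (1 - expR (c - al)))%R.
have q1 : (expR (c - al) < 1)%R by rewrite -[ltRHS](@expR0 R) ltr_expR subr_lt0.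
have D0 i j : (0 <= D i j)%R.
  by rewrite !mulr_ge0 ?expR_ge0// invr_ge0 subr_ge0 ltW.
(* At threshold exp (- ga n), [spine_tail] yields exp ((c - al) n) exp (ga n), summable since ga <
   al - c. *)
have r01 : (0 <= expR (c - al + ga) < 1)%R.
  by rewrite expR_ge0/= -[ltRHS](@expR0 R) ltr_expR; lra.
have U3 : {ae P, forall w, forall i j, Qnu w (lim_sup_set (fun n =>
    lim_inf_set (fun m => level m (A i j n) w))) = 0}.
  apply: ae_foralln => i; apply: ae_foralln => j.
  have /choice[g' Hg'] : forall n : nat, exists g : Omega -> \bar R,
      [/\ measurable_fun setT g, forall w, 0 <= g w,
      forall w, Qnu w (lim_inf_set (fun m => level m (A i j n) w)) <= g w &
      \int[P]_w g w <= (D i j * expR (c - al + ga) ^+ n)%:E].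
    move=> n; apply: kernel_lim_inf; first exact: aA.
    exists n => m nm; apply: level_weightE.
      by rewrite mulr_ge0// exprn_ge0// expR_ge0.
    move=> u um; rewrite /A; case: ifPn => sp; last first.
      under eq_integral do rewrite indic0 mulr0.
      by rewrite integral0 lee_fin mulr_ge0// exprn_ge0// expR_ge0.
    have := @spine_tail _ _ _ _ _ _ _ _ _ _ Xs_iid X_ge0 Xs_ge0 X_mean hb N N0
      (@cylmass_sum R b hb nu)
      c (L i) al j.+1%:R m n u (expR (- (ga * n%:R))) cal (ler0n _ _) (expR_gt0 _) um nm sp.
    rewrite um => /le_trans; apply; rewrite lee_fin -/(D i j) -mulrA ler_wpM2l//.
    rewrite expRN invrK -!expRM_natl -expRD le_eqVlt; apply/orP; left; apply/eqP.
    by congr expR; ring.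
  apply: (@kernel_borel_cantelli _ _ _ _ _ _ _
    (fun n w => lim_inf_set (fun m => level m (A i j n) w)) g' (D i j) _ _ _ _ _ r01).
  - by move=> n w; apply: measurable_lim_inf_set => m; exact: measurable_level_set.
  - by move=> n; have [] := Hg' n.
  - by move=> n; have [] := Hg' n.
  - by move=> n; have [] := Hg' n.
  - by move=> n; have [] := Hg' n.
have U1' : {ae P, forall w, Qnu w (~` \bigcup_j always nu (q j)) = 0 /\
    forall p, (mass Xs N n p w)%:E @[n --> \oo] --> Qnu w (cyl p)}.
  by apply: filterS2 U1 (cascade_limit Xs_ge0 Qnu_cascade) => w.
apply: filterS3 U1' U2 U3 => w [h1 lim] h2 h3.
have m1 : measurable (~` \bigcup_j always nu (q j)).
  apply: measurableC; apply: bigcup_measurable => j _.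
  exact: (dominated_always Xs_iid X_ge0 Xs_ge0 X_mean Qnu_cascade (q j)).1.
have m2 : measurable (lim_sup_set (fun i => lim_inf_set (fun m => level m (bad i) w) : set S)).
  exact: measurable_lim_sup_set.
have h3' : {ae Qnu w, forall x, forall i j, ~ lim_sup_set (fun n =>
    lim_inf_set (fun m => level m (A i j n) w)) x}.
  apply: ae_foralln => i; apply: ae_foralln => j; apply: null_ae; last exact: h3.
  apply: measurable_lim_sup_set => n; apply: measurable_lim_inf_set => m.
  exact: measurable_level_set.
apply: filterS3 (null_ae m1 h1) (null_ae m2 h2) h3' => x.
move=> nq nb nA; have [i Hi] := lim_sup_setP nb.
have [j _ qx] : (\bigcup_j always nu (q j)) x by exact: contrapT nq.
have [n0 Hn0] := lim_sup_setP (nA i j).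
(* Leaving the barrier is irreversible: a prefix that is bad at level [k] makes all longer ones bad,
   so the point lies in the lower limit of the bad events. *)
have gx k : good Xs c (L i) (restr x k) w.
  apply: contrapT => bk; apply: (Hi i (leqnn i)); exists k => // m /= km.
  rewrite /level /bad /= => /goodP gm; apply: bk; apply/goodP => l; rewrite size_restr => lk.
  have := gm l; rewrite size_restr (leq_trans lk km) => /(_ isT).
  by rewrite !take_restr// (leq_trans lk).
have sx k : spread N al j.+1%:R (restr x k).
  by apply/spreadP => l _; exact: qx.
apply: lower_dim_loc_ge; exists n0 => n n0n.
rewrite leNgt; apply/negP => hlt; apply: (Hn0 n n0n).
have hlt' : (expR (- (ga * n%:R)))%:E < limn_einf (fun m => (mass Xs N m (restr x n) w)%:E).
  by rewrite (cvg_limn_einf_sup (lim (restr x n))).1.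
have [m0 Hm0] := limn_einf_gt hlt'.
exists (maxn m0 n) => // m /=; rewrite geq_max => /andP[m0m nm].
rewrite /level /A /= sx; split; first exact: gx.
by rewrite /= size_restr take_restr// -lte_fin; exact: Hm0.
Qed.

End dimension.

(** * From real rates to essential bounds, and the three parts of the theorem *)

Section ereal_approximation.
Context (R : realType).
Implicit Types y z : \bar R.

(** An inequality with a possibly infinite bound becomes countably many real ones, whose null sets
    can be united. *)
Lemma approx_below y : y != -oo -> exists s : nat -> R,
  (forall n, (s n)%:E < y) /\ forall z, (forall n, (s n)%:E <= z) -> y <= z.
Proof.
case: y => [r _| _|//].
  exists (fun n => r - n.+1%:R^-1)%R; split=> [n|z H].
    by rewrite lte_fin ltrBlDr ltrDl invr_gt0.
  apply/lee_addgt0Pr => e e0; pose n := Num.bound (e^-1)%R.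
  apply: (@le_trans _ _ ((r - n.+1%:R^-1)%:E + e%:E)); last exact: leeD2r.
  rewrite -EFinD lee_fin -addrA lerDl addrC subr_ge0.
  rewrite -[leRHS]invrK lef_pV2 ?posrE ?invr_gt0//.
  have e0' : (0 <= e^-1)%R by rewrite invr_ge0 ltW.
  by have := archi_boundP e0' => /ltW /le_trans; apply; rewrite ler_nat.
exists (fun n => n%:R); split=> [n|[z| |] H]; rewrite ?ltry ?leey//.
  have := H (Num.bound `|z|); rewrite lee_fin leNgt.
  by rewrite (le_lt_trans (ler_norm _) (archi_boundP (normr_ge0 _))).
by have := H 0%N; rewrite leeNy_eq.
Qed.

Lemma approx_above y : y != +oo -> exists s : nat -> R,
  (forall n, y < (s n)%:E) /\ forall z, (forall n, z <= (s n)%:E) -> z <= y.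
Proof.
move=> yoo; have [|s [s1 s2]] := @approx_below (- y); first by rewrite eqe_oppLR.
exists (fun n => - s n)%R; split=> [n|z H].
  by rewrite EFinN lteNr; exact: s1.
by rewrite -leeN2; apply: s2 => n; rewrite leeNr -EFinN.
Qed.

Lemma between (a : R) y : a%:E < y -> exists2 c : R, (a < c)%R & c%:E < y.
Proof.
case: y => [r| |]//; last by move=> _; exists (a + 1)%R; rewrite ?ltry// ltrDl.
by rewrite lte_fin => ar; exists ((a + r) / 2)%R; rewrite ?lte_fin; lra.
Qed.

End ereal_approximation.

Section ess.
Context d (T : measurableType d) (R : realType) (mu : {measure set T -> \bar R}).

Lemma ae_exists (Q : T -> Prop) : mu setT != 0 -> {ae mu, forall x, Q x} -> exists x, Q x.
Proof.
move=> mu0 [A [mA A0 QA]]; apply: contrapT => /forallNP nQ; move/eqP : mu0; apply.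
apply/eqP; rewrite -measure_le0 -A0; apply: le_measure; rewrite ?inE//.
by move=> x _; apply: QA; exact: nQ.
Qed.

End ess.

(** A finite total mass is below - g n, hence below exp (- g n), for large n. This settles negative
    rates, for which [lower_dimension] may have no room between h and the dimension of nu. *)
Lemma lower_dim_loc_nearly_ge0 (R : realType) (b : nat) (hb : (1 < b)%N)
    (mu : {measure set (seqspace R hb) -> \bar R}) x (g : R) :
  mu setT < +oo -> (g < 0)%R -> g%:E <= lower_dim_loc mu x.
Proof.
move=> muoo g0; apply: lower_dim_loc_ge.
have fmu : mu setT \is a fin_num by rewrite ge0_fin_numE.
have M0 : (0 <= fine (mu setT) / - g)%R by rewrite divr_ge0 ?fine_ge0// oppr_ge0 ltW.
exists (Num.bound (fine (mu setT) / - g)) => n n0n.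
apply: (@le_trans _ _ (mu setT)).
  by apply: le_measure; rewrite ?inE//; exact: measurable_cylinder.
rewrite -(fineK fmu) lee_fin -mulNr.
apply: (@le_trans _ _ (- g * n%:R)%R); last first.
  by have := expR_ge1Dx (- g * n%:R); apply: le_trans; rewrite lerDr.
rewrite mulrC -ler_pdivrMr ?oppr_gt0//.
apply: (le_trans (ltW (archi_boundP M0))).
by rewrite ler_nat.
Qed.

Section nonnegative_weights.
Context (R : realType) (b : nat) (hb : (1 < b)%N).
Context (d : measure_display) (Omega : measurableType d)
  (P : probability Omega R) (Xs : seq 'I_b -> {RV P >-> R})
  (d0 : measure_display) (T0 : measurableType d0) (P0 : probability T0 R)
  (X : {RV P0 >-> R}).
Local Notation S := (seqspace R hb).
Context (nu : probability S R) (Qnu : R.-ftker Omega ~> S).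
Hypothesis Xs_iid : iid_copies Xs X.
Hypothesis X_ge0 : forall t, (0 <= X t)%R.
Hypothesis Xs_ge0 : forall u w, (0 <= Xs u w)%R.
Hypothesis X_mean : \int[P0]_t (X t)%:E = 1.
Hypothesis Qnu_cascade : is_cascade_measure Xs nu Qnu.
Let hX := entropy X.

Let nuT : nu setT != 0.
Proof. by rewrite probability_setT onee_neq0. Qed.

Let entropy_fin : {ae nu, forall x, hX < lower_dim_loc nu x} ->
  exists h : R, entropy X = h%:E.
Proof.
move=> aeh; have [x hx] := ae_exists nuT aeh.
have := entropy_ge0 X_ge0 X_mean; move: hx; rewrite /hX.
case: (entropy X) => [r _ _|h _|_ h]; first by exists r.
  by move: h; rewrite ltNge leey.
by move: h; rewrite leeNy_eq.
Qed.

Let part_a : {ae nu, forall x, hX < lower_dim_loc nu x} -> Q_regular P nu Qnu.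
Proof.
move=> aeh; have [h hE] := entropy_fin aeh.
apply: etrans (esym (@probability_setT _ _ _ nu)).
by apply: (regular Xs_iid X_ge0 Xs_ge0 X_mean Qnu_cascade hE); rewrite -hE.
Qed.

Let part_b : {ae nu, forall x, lower_dim_loc nu x < hX} -> Q_singular P Qnu.
Proof.
move=> aeh.
suff : {ae P, forall w, Qnu w setT = 0}.
  apply: filterS => w Q0 A mA; apply/eqP; rewrite -measure_le0 -Q0.
  by apply: le_measure; rewrite ?inE.
(* If h_X = +oo, the integers serve as rates; otherwise h - 1 / (j + 1) and h - 2 / (j + 1) approach
   h from below. *)
have [e|hfin] := eqVneq hX +oo.
  apply: (@singular _ _ _ _ _ _ _ _ _ _ _ _ _ Xs_iid X_ge0 Xs_ge0 X_mean Qnu_cascade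
    (fun j => j.+1%:R) (fun j => j%:R)).
  - by move=> j; rewrite ltr_nat.
  - by move=> j; rewrite -/hX e ltry.
  - by move=> i j ij; rewrite ler_nat.
  - apply: filterS aeh => x; rewrite e; case: (lower_dim_loc nu x) => [r _|//|_].
      by exists (Num.bound `|r|); rewrite lte_fin (le_lt_trans (ler_norm _))// archi_boundP.
    by exists 0%N; rewrite ltNyr.
have [h hE] : exists h : R, hX = h%:E.
  have := entropy_ge0 X_ge0 X_mean; move: hfin; rewrite /hX.
  case: (entropy X) => [r _ _|//|_ h]; first by exists r.
  by move: h; rewrite leeNy_eq.
apply: (@singular _ _ _ _ _ _ _ _ _ _ _ _ _ Xs_iid X_ge0 Xs_ge0 X_mean Qnu_cascade
    (fun j => h - 1 / j.+1%:R)%R (fun j => h - 2 / j.+1%:R)%R).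
- by move=> j; rewrite ltrD2l ltrN2 ltr_pM2r ?invr_gt0// ltr1n.
- by move=> j; rewrite -/hX hE lte_fin gtrBl divr_gt0.
- by move=> i j ij; rewrite lerD2l lerN2 ler_wpM2l// lef_pV2 ?posrE// ler_nat ltnS.
- apply: filterS aeh => x; rewrite hE; case: (lower_dim_loc nu x) => [r|//|_]; last first.
    by exists 0%N; rewrite ltNyr.
  rewrite lte_fin => rh.
  have h0 : (0 <= 2 / (h - r))%R by rewrite divr_ge0// subr_ge0 ltW.
  exists (Num.bound (2 / (h - r))%R); rewrite lte_fin ltrBrDr -ltrBrDl.
  rewrite ltr_pdivrMr// mulrC -ltr_pdivrMr ?subr_gt0//.
  by apply: (lt_trans (archi_boundP h0)); rewrite ltr_nat.
Qed.

Let part_c : {ae nu, forall x, hX < lower_dim_loc nu x} ->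
  {ae P, forall w, ~ zero_measure (Qnu w) ->
        [/\ lower_dimH nu - hX <= lower_dimH (Qnu w),
            lower_dimH (Qnu w) <= upper_dimP (Qnu w)
          & upper_dimP (Qnu w) <= upper_dimP nu - hX]}.
Proof.
move=> aeh; have [h hE] := entropy_fin aeh.
have h0 : (0 <= h)%R by rewrite -lee_fin -hE; exact: entropy_ge0.
have C1 : {ae P, forall w, lower_dimH nu - hX <= lower_dimH (Qnu w)}.
  have [->|yNy] := eqVneq (lower_dimH nu - hX) -oo; first by apply: aeW => w; rewrite leNye.
  have [s [s1 s2]] := approx_below yNy.
  suff : {ae P, forall w n, {ae Qnu w, forall x, (s n)%:E <= lower_dim_loc (Qnu w) x}}.
    by apply: filterS => w H; apply: s2 => n; apply/ess_infP; exact: H.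
  apply: ae_foralln => n; set g := s n.
  have [g0|g0] := ltP g 0%R.
    apply: aeW => w; apply: aeW => x; apply: lower_dim_loc_nearly_ge0 => //.
    exact: kernel_finite.
  have := s1 n; rewrite -/g /hX hE lteBrDr// -EFinD => /between[be gbe beH].
  (* [c] is the midpoint of h and be - g, an interval that is nonempty since g + h < be; c < be uses
     g >= 0. *)
  apply: (@lower_dimension _ _ _ _ _ _ _ _ _ _ _ _ _ Xs_iid X_ge0 Xs_ge0 X_mean Qnu_cascade
     h be be ((h + (be - g)) / 2)%R g hE).
  - lra.
  - lra.
  - exact: lexx.
  - lra.
  - apply: filterS (ess_inf_le nu (lower_dim_loc nu)) => x; exact: lt_le_trans.
have C3 : {ae P, forall w, upper_dimP (Qnu w) <= upper_dimP nu - hX}.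
  have [->|yNy] := eqVneq (upper_dimP nu - hX) +oo; first by apply: aeW => w; rewrite leey.
  have [s [s1 s2]] := approx_above yNy.
  suff : {ae P, forall w n, {ae Qnu w, forall x, upper_dim_loc (Qnu w) x <= (s n)%:E}}.
    by apply: filterS => w H; apply: s2 => n; apply/ess_supP; exact: H.
  apply: ae_foralln => n; set g := s n.
  have := s1 n; rewrite -/g /hX hE lteBlDr// -EFinD => ph.
  have [B pB Bg] : exists2 B : R, upper_dimP nu < B%:E & (B < g + h)%R.
    have := @between R (- (g + h))%R (- upper_dimP nu).
    rewrite EFinN lteN2 => /(_ ph)[B B1 B2]; exists (- B)%R; last by rewrite ltrNl.
    by rewrite EFinN lteNr.
  (* The margin is split between a growth rate h - e of the weights, strictly below h_X, and the
     loss [de] = e. *)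
  pose e := ((g + h - B) / 2)%R.
  have e0 : (0 < e)%R by rewrite /e; lra.
  rewrite (_ : g = B - (h - e) + e)%R; last by rewrite /e; field.
  apply: (@upper_dimension _ _ _ _ _ _ _ _ _ _ _ _ _ Xs_iid X_ge0 Xs_ge0 X_mean Qnu_cascade) => //.
    by apply: filterS (ess_sup_ge nu (upper_dim_loc nu)) => x /le_lt_trans; apply.
  by rewrite hE lte_fin gtrBl.
apply: filterS2 C1 C3 => w c1 c3 nz; split => //.
have QT : Qnu w setT != 0.
  apply/eqP => Q0; apply: nz => A mA; apply/eqP; rewrite -measure_le0 -Q0.
  by apply: le_measure; rewrite ?inE.
have H : {ae Qnu w, forall x, lower_dimH (Qnu w) <= upper_dimP (Qnu w)}.
  apply: filterS2 (ess_inf_le (Qnu w) (lower_dim_loc (Qnu w)))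
     (ess_sup_ge (Qnu w) (upper_dim_loc (Qnu w))) => x l u.
  exact: le_trans l (le_trans (lower_le_upper_dim_loc _ _) u).
by have [] := ae_exists QT H.
Qed.

Lemma nonnegative_weights :
  [/\ ({ae nu, forall x, hX < lower_dim_loc nu x} -> Q_regular P nu Qnu) /\
      (hX < lower_dimH nu -> Q_regular P nu Qnu),
      ({ae nu, forall x, lower_dim_loc nu x < hX} -> Q_singular P Qnu) /\
      (upper_dimH nu < hX -> Q_singular P Qnu)
    & {ae nu, forall x, hX < lower_dim_loc nu x} ->
      {ae P, forall w, ~ zero_measure (Qnu w) ->
        [/\ lower_dimH nu - hX <= lower_dimH (Qnu w),
            lower_dimH (Qnu w) <= upper_dimP (Qnu w)
          & upper_dimP (Qnu w) <= upper_dimP nu - hX]}].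
Proof.
split; [split => // H|split => // H|exact: part_c].
  apply: part_a; apply: filterS (ess_inf_le nu (lower_dim_loc nu)) => x.
  exact: lt_le_trans.
apply: part_b; apply: filterS (ess_sup_ge nu (lower_dim_loc nu)) => x /le_lt_trans; exact.
Qed.

End nonnegative_weights.

(* The weights are only almost surely nonnegative; replacing them by their
   positive parts changes neither their law nor, almost surely, the cascade. *)
Section positive_part.
Context (R : realType) (d : measure_display) (T : measurableType d) (P : probability T R).

Lemma measurable_positive_part (Y : {RV P >-> R}) :
  measurable_fun setT (fun t => Num.max 0%R (Y t)).
Proof. exact: measurable_maxr. Qed.

Definition positive_part (Y : {RV P >-> R}) : {RV P >-> R} :=
  mfun_Sub (mem_set (measurable_positive_part Y)).

Lemma positive_partE Y t : positive_part Y t = Num.max 0%R (Y t).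
Proof. by []. Qed.

End positive_part.

Theorem theorem2p3 (R : realType) (b : nat) (hb : (2 <= b)%N)
    (d0 : measure_display) (T0 : measurableType d0) (P0 : probability T0 R)
    (X : {RV P0 >-> R})
    (X_ge0 : {ae P0, forall t, (0 <= X t)%R})
    (X_mean : 'E_P0[X] = 1)
    (d : measure_display) (Omega : measurableType d) (P : probability Omega R)
    (Xs : seq 'I_b -> {RV P >-> R})
    (Xs_iid : iid_copies Xs X)
    (nu : probability (seqspace R hb) R)
    (Qnu : R.-ftker Omega ~> seqspace R hb)
    (Qnu_cascade : is_cascade_measure Xs nu Qnu) :
  let hX := entropy X in
  [/\ ({ae nu, forall x, hX < lower_dim_loc nu x} -> Q_regular P nu Qnu) /\
      (hX < lower_dimH nu -> Q_regular P nu Qnu),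
      ({ae nu, forall x, lower_dim_loc nu x < hX} -> Q_singular P Qnu) /\
      (upper_dimH nu < hX -> Q_singular P Qnu)
    & {ae nu, forall x, hX < lower_dim_loc nu x} ->
      {ae P, forall w, ~ zero_measure (Qnu w) ->
        [/\ lower_dimH nu - hX <= lower_dimH (Qnu w),
            lower_dimH (Qnu w) <= upper_dimP (Qnu w)
          & upper_dimP (Qnu w) <= upper_dimP nu - hX]}].
Proof.
move=> hX.
have mmax : measurable_fun setT (fun x : R => Num.max 0%R x) by exact: measurable_maxr.
have mpre B : measurable B -> measurable ((Num.max (0 : R)%R) @^-1` B).
  by move=> mB; rewrite -[X in measurable X]setTI; exact: mmax.
have Xp : {ae P0, forall t, positive_part X t = X t}.
  by apply: filterS X_ge0 => t; rewrite positive_partE => /max_idPr.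
have iid' : iid_copies (fun u => positive_part (Xs u)) (positive_part X).
  have [ind law] := Xs_iid; split.
    move=> s B us s0 mB.
    exact: (ind s (fun u => (Num.max (0 : R)%R) @^-1` B u) us s0 (fun u => mpre _ (mB u))).
  by move=> u u0 A mA; exact: (law u u0 _ (mpre _ mA)).
have mX (Y : {RV P0 >-> R}) : measurable_fun setT (fun t => (Y t)%:E) by exact/measurable_EFinP.
have mean' : \int[P0]_t (positive_part X t)%:E = 1.
  rewrite -X_mean unlock; apply: ae_eq_integral => //.
  by apply: filterS Xp => t -> _.
have ent : entropy (positive_part X) = hX.
  apply: ae_eq_integral => //; try exact: measurable_entropy.
  by apply: filterS Xp => t -> _.
have Xs0 : {ae P, forall w, forall u, u != [::] -> (0 <= Xs u w)%R}.
  have [_ law] := Xs_iid.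
  have H (u : seq 'I_b) : u != [::] -> {ae P, forall w, (0 <= Xs u w)%R}.
    move=> u0; case: X_ge0 => A [mA A0 XA].
    have mneg : measurable [set x : R | (x < 0)%R].
      rewrite (_ : [set x | _] = `]-oo, 0%R[%classic); first exact: measurable_itv.
      by apply/seteqP; split => x /=; rewrite in_itv.
    exists (Xs u @^-1` [set x | (x < 0)%R]); split.
    - exact: measurable_funPTI.
    - have := law u u0 _ mneg; rewrite /distribution /pushforward /= => ->.
      apply/eqP; rewrite -measure_le0 -A0; apply: le_measure; rewrite ?inE//.
        exact: measurable_funPTI.
      by move=> t /= Xt; apply: XA => /=; apply/negP; rewrite -ltNge.
    - by move=> w /= /negP; rewrite -ltNge.
  (* Words are countable, so the null sets of all nonempty words unite into one; integers that code
     no word are sent to the empty word, which the condition skips. *)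
  pose dec n : seq 'I_b := odflt [::] (unpickle n).
  have : {ae P, forall w n, dec n != [::] -> (0 <= Xs (dec n) w)%R}.
    apply: ae_foralln => n; have [->|/H] := eqVneq (dec n) [::].
      by apply: aeW => w.
    by apply: filterS.
  by apply: filterS => w H' u; have := H' (pickle u); rewrite /dec pickleK.
have cascade' : is_cascade_measure (fun u => positive_part (Xs u)) nu Qnu.
  apply: filterS2 Xs0 Qnu_cascade => w w0 cv f cf bf.
  suff E n (x : seqspace R hb) : cascade_density (fun u => positive_part (Xs u)) n w x =
      cascade_density Xs n w x.
    by under eq_fun do under eq_integral do rewrite E; exact: cv.
  rewrite /cascade_density; apply: eq_big_nat => k /andP[k0 _].
  rewrite positive_partE; apply/max_idPr/w0.
  by rewrite -size_eq0 size_restr -lt0n.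
have Xp0 t : (0 <= positive_part X t)%R by rewrite positive_partE le_max lexx.
have Xsp0 u w : (0 <= positive_part (Xs u) w)%R by rewrite positive_partE le_max lexx.
by have := nonnegative_weights iid' Xp0 Xsp0 mean' cascade'; rewrite ent.
Qed.
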